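(* Let $\varepsilon>0$, let $p$ be an integer with $2\le p<\infty$ if $d\le2$ and $p=2$ if $d=3$, and let $F\in C^2(\mathbb R)$ with $F(0)=0$, $f=F'$. Assume: (a) there are constants $c_0>0$ and $c_1$ with $f(v)v\ge p c_0v^{2p}-c_1$ for all $v\in\mathbb R$; (b) for every $\eta>0$ there is a constant $c_2=c_2(\eta)$ with $|f(v)|\le\eta c_0v^{2p}+c_2$ for all $v\in\mathbb R$; (c) there is a constant $c_3$ with $\frac12c_0v^{2p}-c_3\le F(v)\le\frac32c_0v^{2p}+c_3$ for all $v\in\mathbb R$. Let $R,\alpha>0$ and let $$C_1(\alpha)=(c_1+c_2\alpha+2c_3)|\Omega|,\qquad c_2=c_2(\eta)\ \text{ with }\ \eta=\tfrac1\alpha\left(p-\tfrac32\right).$$ Fix any time mesh with steps $\{k_n\}$ and $k=\sup_{n\ge0}k_n<\infty$. Let $\{u^n\}_{n\ge0}$ be a solution of the implicit Euler scheme $$\bar\partial_tu^{n+1}+\varepsilon A^2u^{n+1}+Af(u^{n+1})=0,\quad n\ge0,\qquad u^0=u_0,$$ where $|\overline{u_0}|_{-1}\le R$ and $|m(u_0)|\le\alpha$. Then for all $n\ge0$ $$|\overline{u^{n+1}}|_{-1}^2\le\exp\left(-\frac{\varepsilon t^{n+1}}{\gamma_1^2+\varepsilon k}\right)|\overline{u_0}|_{-1}^2+2C_1(\alpha)\frac{\gamma_1^2+\varepsilon k}{\varepsilon}\left[1-\exp\left(-\frac{\varepsilon t^{n+1}}{\gamma_1^2+\varepsilon k}\right)\right].$$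 Furthermore, define $$\rho_{0k}(\alpha)=\left(2C_1(\alpha)\frac{\gamma_1^2+\varepsilon k}{\varepsilon}\right)^{1/2},$$ and let $\rho>\rho_{0k}$ be given. Then there exists a positive integer $n_{0k}$, depending on $R,\alpha,\rho$ and the time mesh (and not otherwise on $u_0$), such that $$|\overline{u^n}|_{-1}\le\rho,\qquad n\ge n_{0k}.$$
   Context: Let $d\in\{1,2,3\}$. Either $\Omega\subset\mathbb R^d$ is a bounded domain with sufficiently smooth boundary (Neumann case), or $\Omega=(0,L)^d$ (periodic case). $H=L^2(\Omega)$ has inner product $(\cdot,\cdot)$ and norm $\|\cdot\|$. $A=-\Delta$ with domain $\mathcal D(A)=\{v\in H^2(\Omega):\partial v/\partial\nu=0 \text{ on }\partial\Omega\}$ in the Neumann case, and the $L$-periodic (in each coordinate) $H^2$ functions in the periodic case. For $s\ge0$, $\dot H^s=\mathcal D(A^{s/2})$ and $|v|_s=\|A^{s/2}v\|$ (so $|v|_1=\|\nabla v\|$). For $v\in L^1(\Omega)$, $m(v)=|\Omega|^{-1}\int_\Omega v\,dx$ and $\bar v=v-m(v)$. $G$ denotes the inverse of $A$ acting on functions with zero average, and $|v|_{-1}=\|G^{1/2}v\|$ for $v$ with zero average. $\gamma_1>0$ is a constant depending only on $\Omega$ such that $|v-m(v)|_{-1}\le\gamma_1|v|_1$ for all $v\in H^1$. Time mesh: $0=t^0<t^1<\cdots<t^n<\cdots$ is a partition of $[0,\infty)$ (so $t^n\to\infty$), $k_n=t^{n+1}-t^n$, $k=\sup_nk_n$, and $\bar\partial_tv^{n+1}=(v^{n+1}-v^n)/k_n$.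 With $u_0\in L^2(\Omega)$, a solution of the scheme is a sequence such that $u^{n+1}$ and $\varepsilon Au^{n+1}+f(u^{n+1})$ lie in $\mathcal D(A)$ and $\bar\partial_tu^{n+1}+A(\varepsilon Au^{n+1}+f(u^{n+1}))=0$ in $L^2(\Omega)$ for all $n\ge0$. *)

(* Defs.v *)
From HB Require Import structures.
From mathcomp Require Import all_boot all_order all_algebra.
From mathcomp Require Import all_classical all_reals all_analysis.

Set Implicit Arguments.
Unset Strict Implicit.
Unset Printing Implicit Defensive.

Import Order.TTheory GRing.Theory Num.Theory.
Import numFieldNormedType.Exports.

Local Open Scope classical_set_scope.
Local Open Scope ring_scope.

(* The Borel sigma-algebra of R^n, generated by the coordinate functions. *)
Section borel_rV.
Variables (R : realType) (n : nat).

Definition coor_rV (i : 'I_n) (x : 'rV[R]_n) : measurableTypeR R := x ord0 i.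

Definition borel_rV : set (set 'rV[R]_n) := g_sigma_preimage coor_rV.

Let borel_rV0 : borel_rV set0.
Proof. exact: sigma_algebra0. Qed.

Let borel_rVC A : borel_rV A -> borel_rV (~` A).
Proof. exact: sigma_algebraC. Qed.

Let borel_rV_bigcup (F : (set 'rV[R]_n)^nat) :
  (forall i, borel_rV (F i)) -> borel_rV (\bigcup_i (F i)).
Proof. exact: sigma_algebra_bigcup. Qed.

HB.instance Definition _ :=
  @isMeasurable.Build (measure_tuple_display default_measure_display) 'rV[R]_n
  borel_rV borel_rV0 borel_rVC borel_rV_bigcup.

End borel_rV.

Section lebesgue_rV.
Variable R : realType.

Lemma measurable_coor_rV n (i : 'I_n) : measurable_fun setT (@coor_rV R n i).
Proof.
move=> _ Y mY; rewrite setTI; apply: sub_sigma_algebra => /=.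
rewrite -bigcup_seq/=; exists i => /=; first by rewrite mem_index_enum.
by exists Y => //; rewrite setTI.
Qed.

Lemma measurable_fun_rV d (T : measurableType d) n (f : T -> 'rV[R]_n) :
  (forall i, measurable_fun setT (@coor_rV R n i \o f)) -> measurable_fun setT f.
Proof.
move=> mf.
suff H : @g_sigma_preimage _ (measurableTypeR R) _ n (@coor_rV R n) `<=`
    [set A | measurable (f @^-1` A)].
  by move=> _ A mA; rewrite setTI; exact: H.
apply: smallest_sub.
  split => /=; first by rewrite preimage_set0.
  - by move=> A mA; rewrite setTD -preimage_setC; exact: measurableC.
  - by move=> F mF; rewrite preimage_bigcup; exact: bigcup_measurable.
move=> A; rewrite -bigcup_seq => -[i _ [B mB <-]] /=.
by rewrite setTI -comp_preimage -[X in measurable X]setTI; exact: mf.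
Qed.

Definition cons_rV n (z : measurableTypeR R * 'rV[R]_n) : 'rV[R]_n.+1 :=
  row_mx (z.1%:M : 'M[R]_1) z.2.

Lemma measurable_cons_rV n : measurable_fun setT (@cons_rV n).
Proof.
apply: measurable_fun_rV => i.
have [j ->|j ->] := fintype.split_ordP (i : 'I_(1 + n)).
- have -> : @coor_rV R n.+1 (lshift n j) \o @cons_rV n = fst.
    apply/funext => z /=; rewrite /coor_rV /cons_rV.
    by rewrite [LHS]row_mxEl !ord1 mxE.
  exact: measurable_fst.
- have -> : @coor_rV R n.+1 (rshift 1 j) \o @cons_rV n = @coor_rV R n j \o snd.
    by apply/funext => z /=; rewrite /coor_rV /cons_rV [LHS]row_mxEr.
  by apply: measurableT_comp => //; exact: measurable_coor_rV.
Qed.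

Definition lebesgue_rVS n (m : {measure set 'rV[R]_n -> \bar R}) :
  {measure set 'rV[R]_n.+1 -> \bar R}.
Proof.
refine (pushforward (@lebesgue_measure R \x^ m)%E (@cons_rV n)
  : {measure set _ -> \bar R}).
exact: measurable_cons_rV.
Defined.

(* Lebesgue measure on the Borel sets of R^n. *)
Fixpoint lebesgue_rV n : {measure set 'rV[R]_n -> \bar R} :=
  if n is n'.+1 then lebesgue_rVS (lebesgue_rV n') else \d_(0 : 'rV[R]_0).

End lebesgue_rV.

Section sobolev.
Context {R : realType} {d : nat}.
Notation mu := (lebesgue_rV R d).
Implicit Types (U : set 'rV[R]_d) (v w : 'rV[R]_d -> R)
  (g : 'I_d -> 'rV[R]_d -> R).

Definition unit_rV (i : 'I_d) : 'rV[R]_d := delta_mx ord0 i.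

Definition partial (i : 'I_d) v : 'rV[R]_d -> R :=
  fun x => 'D_(unit_rV i) v x.

Fixpoint isC (k : nat) v : Prop :=
  continuous v /\
  if k is k'.+1 then
    forall i, (forall x, derivable v x (unit_rV i)) /\ isC k' (partial i v)
  else True.

(* C^1 functions with compact support in U, extended by zero outside U. *)
Definition test_fun U v : Prop :=
  isC 1 v /\
  exists K, [/\ compact K, K `<=` U & forall x, ~ K x -> v x = 0].

(* Elements of L^2(U) are represented by functions on R^d, of which only the
   values almost everywhere in U matter. *)
Definition L2 U v : Prop := v \_ U \in Lfun mu 2%:E.

Definition ip U v w : R := \int[mu]_(x in U) (v x * w x).

Definition L2norm U v : R := Num.sqrt (ip U v v).

Definition vol U : R := fine (mu U).

Definition mean U v : R := (vol U)^-1 * \int[mu]_(x in U) v x.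

(* v - m(v) *)
Definition centered U v : 'rV[R]_d -> R := fun x => v x - mean U v.

Definition weak_grad U v g : Prop :=
  forall i phi, test_fun U phi ->
    \int[mu]_(x in U) (v x * partial i phi x) =
    - \int[mu]_(x in U) (g i x * phi x).

(* v lies in H^1(U) and its weak gradient is g. *)
Definition H1 U v g : Prop :=
  [/\ L2 U v, forall i, L2 U (g i) & weak_grad U v g].

(* H^1_0(U), the functions in H^1(U) with zero trace: the closure in the
   H^1-norm of the C^1 functions with compact support in U. *)
Definition H10 U v : Prop :=
  exists g (phi : nat -> 'rV[R]_d -> R),
    [/\ H1 U v g, forall j, test_fun U (phi j),
        L2norm U (fun x => phi j x - v x) @[j --> \oo] --> (0 : R) &
        forall i, L2norm U (fun x => partial i (phi j) x - g i x)
                    @[j --> \oo] --> (0 : R)].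

Definition periodic (L : R) v : Prop :=
  forall x i, v (x + L *: unit_rV i) = v x.

(* [Neumann rho] is the Neumann case on the domain {rho < 0}, where the C^2
   function rho is a defining function, i.e. grad rho <> 0 on the boundary;
   [Periodic L] is the periodic case on (0,L)^d. *)
Inductive setting : Type :=
| Neumann of ('rV[R]_d -> R)
| Periodic of R.

Definition dom (s : setting) : set 'rV[R]_d :=
  match s with
  | Neumann rho => [set x | rho x < 0]
  | Periodic L => [set x | forall i, 0 < x ord0 i < L]
  end.

Definition admissible (s : setting) : Prop :=
  match s with
  | Neumann rho =>
      [/\ isC 2 rho, dom s !=set0, bounded_set (dom s), connected (dom s) &
          forall x, (closure (dom s) `\` dom s) x ->
            exists i, partial i rho x != 0]
  | Periodic L => 0 < L
  end.

(* v lies in the space H^1 of the setting and g is its weak gradient: H^1(Omega)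
   in the Neumann case; in the periodic case the functions on (0,L)^d with an
   L-periodic extension V to R^d that has a weak gradient G on the whole of R^d.
   V and G are square integrable on a period, hence locally. *)
Definition in_H1 (s : setting) v g : Prop :=
  match s with
  | Neumann _ => H1 (dom s) v g
  | Periodic L =>
      [/\ L2 (dom s) v, forall i, L2 (dom s) (g i) &
        exists V G,
          [/\ measurable_fun setT V /\ (forall i, measurable_fun setT (G i)),
              periodic L V /\ (forall i, periodic L (G i)),
              (forall x, dom s x -> V x = v x) /\
              (forall i x, dom s x -> G i x = g i x) &
              weak_grad setT V G]]
  end.

(* The normal derivative on the boundary is grad rho . g / |grad rho|, so that
   it vanishes there if and only if the trace of grad rho . g does. *)
Definition boundary_cond (s : setting) g : Prop :=
  match s with
  | Neumann rho => H10 (dom s) (fun x => \sum_i partial i rho x * g i x)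
  | Periodic _ => True
  end.

(* The graph of A: v lies in D(A), i.e. in H^2 with the boundary condition, and
   w = A v = - Laplacian v; h i j is the weak second derivative d_j d_i v. *)
Definition graphA (s : setting) v w : Prop :=
  exists g (h : 'I_d -> 'I_d -> 'rV[R]_d -> R),
    [/\ in_H1 s v g, forall i, in_H1 s (g i) (h i), boundary_cond s g,
        L2 (dom s) w &
        ae_eq mu (dom s) w (fun x => - \sum_i h i i x)].

(* The functions in H = L^2(Omega) with zero average. *)
Definition L20 (s : setting) v : Prop := L2 (dom s) v /\ mean (dom s) v = 0.

(* G is the inverse of A acting on functions with zero average. *)
Definition inverse_of_A (s : setting)
    (G : ('rV[R]_d -> R) -> 'rV[R]_d -> R) : Prop :=
  (forall v, L20 s v -> L20 s (G v) /\ graphA s (G v) v) /\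
  (forall v w, L20 s v -> graphA s v w -> ae_eq mu (dom s) (G w) v).

(* S is the nonnegative self-adjoint square root G^{1/2} of G. *)
Definition nonneg_sqrt (s : setting)
    (G S : ('rV[R]_d -> R) -> 'rV[R]_d -> R) : Prop :=
  [/\ forall v, L20 s v -> L20 s (S v),
      forall a v w, L20 s v -> L20 s w ->
        ae_eq mu (dom s) (S (fun x => a * v x + w x))
          (fun x => a * S v x + S w x),
      forall v w, L20 s v -> L20 s w -> ip (dom s) (S v) w = ip (dom s) v (S w),
      forall v, L20 s v -> 0 <= ip (dom s) (S v) v &
      forall v, L20 s v -> ae_eq mu (dom s) (S (S v)) (G v)].

(* |v|_1 = |grad v|, as a function of the gradient of v *)
Definition norm1 (s : setting) g : R :=
  Num.sqrt (\sum_i L2norm (dom s) (g i) ^+ 2).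

(* |v|_{-1} = |G^{1/2} v|, with Ghalf = G^{1/2} *)
Definition normN1 (s : setting)
    (Ghalf : ('rV[R]_d -> R) -> 'rV[R]_d -> R) v : R :=
  L2norm (dom s) (Ghalf v).

Definition gamma1_const (s : setting) Ghalf (gamma1 : R) : Prop :=
  forall v g, in_H1 s v g ->
    normN1 s Ghalf (centered (dom s) v) <= gamma1 * norm1 s g.

(* The implicit Euler scheme with time steps k n and u 0 = u0. *)
Definition scheme (s : setting) (eps : R) (f : R -> R) (k : nat -> R)
    (u0 : 'rV[R]_d -> R) (u : nat -> 'rV[R]_d -> R) : Prop :=
  [/\ L2 (dom s) u0, u 0%N = u0 &
    forall n, exists Au b,
      [/\ graphA s (u n.+1) Au,
          graphA s (fun x => eps * Au x + f (u n.+1 x)) b &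
          ae_eq mu (dom s) (fun x => (u n.+1 x - u n x) / k n + b x) (cst 0)]].

End sobolev.
Arguments setting : clear implicits.

Section time_mesh.
Context {R : realType}.

Definition step (t : nat -> R) (n : nat) : R := t n.+1 - t n.

Definition time_mesh (t : nat -> R) : Prop :=
  [/\ t 0%N = 0, forall n, t n < t n.+1 & t @ \oo --> +oo].

End time_mesh.

(* Main.v *)
(** Write w = eps A u^{n+1} + f(u^{n+1}) and b = A w, so that u^{n+1} - u^n = - k_n b.
    Green's formula with the constant 1 gives m(b) = 0, hence conservation of the
    mean m. Testing with G(u^{n+1} - m) turns (b, G(u^{n+1} - m)) into
    (w, u^{n+1} - m) = eps |u^{n+1}|_1^2 + (f(u^{n+1}), u^{n+1} - m). The growth
    conditions with eta = (p - 3/2) / alpha give the pointwise bound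
    f(y) (y - m) >= - (c_1 + c_2 alpha + 2 c_3), so a_n = |u^n - m|_{-1}^2 satisfies
      a_{n+1} (1 + 2 k_n eps / gamma_1^2) <= a_n + 2 k_n C_1,
    and with q = gamma_1^2 + eps k the elementary inequalities for x = eps k_n / q
      1 <= e^{-x} (1 + 2 k_n eps / gamma_1^2),
      x <= (1 - e^{-x}) (1 + 2 k_n eps / gamma_1^2)
    yield the exponential decay by induction.

    Green's formula for weak derivatives on R^d comes from the difference
    quotient of s |-> (v, w(. + s e_i)), which by density of C^1 functions with
    compact support in L^2 converges to - (v', w), and to (v, w') after a
    translation. The Neumann case is reduced to it by the cut-offs
    smoothstep(- N rho - 1); the boundary layer term tends to 0 because the normal
    component of the gradient is an H^1 limit of test functions. The periodic case
    is reduced to it by a partition of unity subordinate to the period lattice. *)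

Require Import Defs.
From HB Require Import structures.
From mathcomp Require Import all_boot all_order all_algebra.
From mathcomp Require Import all_classical all_reals all_analysis.
From mathcomp Require Import measurable_realfun ring lra.

Set Implicit Arguments.
Unset Strict Implicit.
Unset Printing Implicit Defensive.

Import Order.TTheory GRing.Theory Num.Theory.
Import numFieldNormedType.Exports.

Local Open Scope classical_set_scope.
Local Open Scope ring_scope.

(** * Square-integrable functions *)

(** All functions are merely square integrable with weak derivatives, and the boundary condition is
    membership of [H10]. Products of two weakly differentiable functions are therefore integrated by
    parts through translations instead of mollification, and the boundary is approached only through
    cut-offs instead of traces. [G] and [Ghalf] are given by their algebraic relations up to null
    sets. For this reason the energy step never describes G(u^{n+1} - m) as the solution of an
    equation: symmetry moves both copies of [Ghalf] onto b = A w, where G A w = w - m(w) holds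
    because [G] inverts A.

    The value q = gamma_1^2 + eps k lets one rate serve all steps. With kap = 2 k_n eps / gamma_1^2
    one step contracts by 1 / (1 + kap), and the condition x <= kap / (1 + kap) on x = eps k_n / q
    reads gamma_1^2 + 2 eps k_n <= 2 q. *)

Section square_integrable.
Context d (T : measurableType d) (R : realType).
Variable mu : {measure set T -> \bar R}.
Implicit Types v w : T -> R.
Notation L2T := (Lfun mu 2%:E).
Notation intg v := (mu.-integrable setT (EFin \o v)).

Lemma intgZ a v : intg v -> intg (fun x => a * v x).
Proof. by move=> iv; rewrite /comp; under eq_fun do rewrite EFinM; exact: integrableZl. Qed.

Lemma intgD v w : intg v -> intg w -> intg (fun x => v x + w x).
Proof. by move=> iv iw; rewrite /comp; under eq_fun do rewrite EFinD; exact: integrableD. Qed.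

Lemma intg_meas v : intg v -> measurable_fun setT v.
Proof. by move=> /measurable_int /measurable_EFinP. Qed.

Lemma le_intg v w : measurable_fun setT v -> (forall x, `|v x| <= `|w x|) ->
  intg w -> intg v.
Proof.
move=> mv vw; apply: le_integrable => //; first exact/measurable_EFinP.
by move=> x _; rewrite lee_fin.
Qed.

Lemma Lfun2P v : v \in L2T <->
  measurable_fun setT v /\ intg (fun x => v x ^+ 2).
Proof.
split=> [l2v|[mv /integrableP[_ iv]]].
  split; last exact: Lfun2_integrable_sqr.
  by move: l2v; rewrite inE => /andP[/[!inE]].
rewrite inE; apply/andP; split; rewrite inE//=.
rewrite /finite_norm unlock poweR_lty//=.
apply: le_lt_trans iv; apply: ge0_le_integral => //=.
- apply/measurable_EFinP.
  apply/(@measurableT_comp _ _ _ _ _ _ (fun x : R => x `^ 2)%R) => //.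
  exact/measurableT_comp.
- apply/measurable_EFinP; apply/measurableT_comp => //; exact: measurable_funX.
- by move=> x _; rewrite lee_fin normrX powR_mulrn.
Qed.

Lemma Lfun2_meas v : v \in L2T -> measurable_fun setT v.
Proof. by move=> /Lfun2P[]. Qed.

Lemma Lfun2_intM v w : v \in L2T -> w \in L2T -> intg (fun x => v x * w x).
Proof. by move=> lv lw; apply/Lfun1_integrable/Lfun2_mul_Lfun1. Qed.

Lemma le_Lfun2 v w : measurable_fun setT v -> w \in L2T ->
  (forall x, `|v x| <= `|w x|) -> v \in L2T.
Proof.
move=> mv /Lfun2P[mw iw] vw; apply/Lfun2P; split=> //.
apply: le_integrable iw => //; first by apply/measurable_EFinP; exact: measurable_funX.
by move=> x _; rewrite lee_fin !normrX ler_pXn2r ?nnegrE.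
Qed.

Lemma Lfun2Z a v : v \in L2T -> (fun x => a * v x) \in L2T.
Proof.
move=> /Lfun2P[mv iv]; apply/Lfun2P; split; first exact: measurable_funM.
by under eq_fun do rewrite exprMn; exact: intgZ.
Qed.

Lemma Lfun2D v w : v \in L2T -> w \in L2T -> (fun x => v x + w x) \in L2T.
Proof.
move=> lv lw; move: (lv) (lw) => /Lfun2P[mv iv] /Lfun2P[mw iw].
apply/Lfun2P; split; first exact: measurable_funD.
rewrite (_ : (fun _ => _) = fun x => v x ^+ 2 + 2 * (v x * w x) + w x ^+ 2); last first.
  by apply/funext => x; ring.
by do 2 apply: intgD => //; apply: intgZ; exact: Lfun2_intM.
Qed.

Lemma Lfun2B v w : v \in L2T -> w \in L2T -> (fun x => v x - w x) \in L2T.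
Proof.
move=> lv lw; rewrite (_ : (fun _ => _) = fun x => v x + -1 * w x).
  by apply: Lfun2D => //; exact: Lfun2Z.
by apply/funext => x; rewrite mulN1r.
Qed.

Lemma Lfun2_0 : (fun=> 0) \in L2T.
Proof.
apply/Lfun2P; split => //; under eq_fun do rewrite expr0n/=; exact: integrable0.
Qed.

Lemma Lfun2_sum (I : Type) (r : seq I) (v : I -> T -> R) :
  (forall i, v i \in L2T) -> (fun x => \sum_(i <- r) v i x) \in L2T.
Proof.
move=> lv; elim: r => [|i r ih].
  by under eq_fun do rewrite big_nil; exact: Lfun2_0.
by under eq_fun do rewrite big_cons; exact: Lfun2D.
Qed.

Lemma Lfun2_bddM c v w : measurable_fun setT v -> (forall x, `|v x| <= c) ->
  w \in L2T -> (fun x => v x * w x) \in L2T.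
Proof.
move=> mv vc lw; apply: (@le_Lfun2 _ (fun x => c * w x)).
- by apply: measurable_funM => //; exact: Lfun2_meas.
- exact: Lfun2Z.
- by move=> x; rewrite !normrM ler_wpM2r// (le_trans (vc x))// ler_norm.
Qed.

Lemma intg_bddM c v w : measurable_fun setT v -> (forall x, `|v x| <= c) ->
  intg w -> intg (fun x => v x * w x).
Proof.
move=> mv vc iw.
apply: le_intg (intgZ c iw); first by apply: measurable_funM => //; exact: intg_meas.
by move=> x; rewrite !normrM ler_wpM2r// (le_trans (vc x))// ler_norm.
Qed.

Lemma intg_sum (I : Type) (r : seq I) (v : I -> T -> R) :
  (forall i, intg (v i)) -> intg (fun x => \sum_(i <- r) v i x).
Proof.
move=> iv; elim: r => [|i r ih].
  by under eq_fun do rewrite big_nil; exact: integrable0.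
by under eq_fun do rewrite big_cons; exact: intgD.
Qed.

Lemma Rintegral_sum (I : Type) (r : seq I) (v : I -> T -> R) :
  (forall i, intg (v i)) ->
  \int[mu]_x \sum_(i <- r) v i x = \sum_(i <- r) \int[mu]_x v i x.
Proof.
move=> iv; elim: r => [|i r ih].
  by under eq_Rintegral do rewrite big_nil; rewrite big_nil Rintegral_cst// mul0r.
under eq_Rintegral do rewrite big_cons.
by rewrite big_cons -ih RintegralD//; exact: intg_sum.
Qed.

Definition dot v w : R := \int[mu]_x (v x * w x).

Lemma dotC v w : dot v w = dot w v.
Proof. by apply: eq_Rintegral => x _; rewrite mulrC. Qed.

Lemma dotDl v v' w : v \in L2T -> v' \in L2T -> w \in L2T ->
  dot (fun x => v x + v' x) w = dot v w + dot v' w.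
Proof.
move=> lv lv' lw; rewrite -RintegralD//; try exact: Lfun2_intM.
by apply: eq_Rintegral => x _; rewrite mulrDl.
Qed.

Lemma dotBl v v' w : v \in L2T -> v' \in L2T -> w \in L2T ->
  dot (fun x => v x - v' x) w = dot v w - dot v' w.
Proof.
move=> lv lv' lw; rewrite -RintegralB//; try exact: Lfun2_intM.
by apply: eq_Rintegral => x _; rewrite mulrBl.
Qed.

Lemma dotZl a v w : v \in L2T -> w \in L2T ->
  dot (fun x => a * v x) w = a * dot v w.
Proof.
move=> lv lw; rewrite -RintegralZl//; last exact: Lfun2_intM.
by apply: eq_Rintegral => x _; rewrite mulrA.
Qed.

Lemma dotDr v w w' : v \in L2T -> w \in L2T -> w' \in L2T ->
  dot v (fun x => w x + w' x) = dot v w + dot v w'.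
Proof. by move=> *; rewrite dotC dotDl// !(dotC v). Qed.

Lemma dotBr v w w' : v \in L2T -> w \in L2T -> w' \in L2T ->
  dot v (fun x => w x - w' x) = dot v w - dot v w'.
Proof. by move=> *; rewrite dotC dotBl// !(dotC v). Qed.

Lemma dotZr a v w : v \in L2T -> w \in L2T ->
  dot v (fun x => a * w x) = a * dot v w.
Proof. by move=> *; rewrite dotC dotZl// (dotC v). Qed.

Lemma dot_ge0 v : 0 <= dot v v.
Proof. by apply: Rintegral_ge0 => x _; rewrite -expr2 sqr_ge0. Qed.

Lemma dot_le_half_sqr v w : v \in L2T -> w \in L2T ->
  2 * dot v w <= dot v v + dot w w.
Proof.
move=> lv lw; have := dot_ge0 (fun x => v x - w x).
rewrite dotBl//; last exact: Lfun2B.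
by rewrite !dotBr// (dotC w v); lra.
Qed.

Definition nrm v : R := Num.sqrt (dot v v).

Lemma nrm_ge0 v : 0 <= nrm v. Proof. exact: sqrtr_ge0. Qed.

Lemma sqr_nrm v : nrm v ^+ 2 = dot v v.
Proof. by rewrite sqr_sqrtr// dot_ge0. Qed.

Lemma normr_dot v w : v \in L2T -> w \in L2T -> `|dot v w| <= nrm v * nrm w.
Proof.
move=> lv lw.
have q t : 0 <= dot v v + 2 * t * dot v w + t ^+ 2 * dot w w.
  have ltw : (fun x => t * w x) \in L2T by exact: Lfun2Z.
  rewrite (le_trans (dot_ge0 (fun x => v x + t * w x)))//.
  rewrite dotDl//; last exact: Lfun2D.
  rewrite !dotDr// !dotZl// !dotZr// (dotC w v).
  by rewrite le_eqVlt; apply/orP; left; apply/eqP; ring.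
rewrite -ler_sqr ?nnegrE ?mulr_ge0 ?nrm_ge0// exprMn !sqr_nrm real_normK ?num_real//.
set a := dot v v in q *; set b := dot v w in q *; set c := dot w w in q *.
have c0 : 0 <= c by exact: dot_ge0.
have [c00|cn0] := eqVneq c 0.
  suff : b = 0 by move=> ->; rewrite c00; lra.
  apply/eqP; apply: contraT => bn0.
  (* With |w| = 0 the quadratic in t is affine; at this t it equals - a - 2 < 0. *)
  have := q (- (a + 1) / b); rewrite c00 mulr0 addr0.
  have -> : 2 * (- (a + 1) / b) * b = - 2 * (a + 1) by field.
  have : 0 <= a by exact: dot_ge0.
  lra.
have cp : 0 < c by rewrite lt_def cn0.
(* The minimiser of the quadratic in t. *)
have := q (- b / c); rewrite -(@pmulr_rge0 _ c)//.
have -> : c * (a + 2 * (- b / c) * b + (- b / c) ^+ 2 * c) = a * c - b ^+ 2 by field.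
lra.
Qed.

Lemma ler_nrmD v w : v \in L2T -> w \in L2T ->
  nrm (fun x => v x + w x) <= nrm v + nrm w.
Proof.
move=> lv lw; rewrite -ler_sqr ?nnegrE ?addr_ge0 ?nrm_ge0// sqrrD !sqr_nrm.
rewrite dotDl//; last exact: Lfun2D.
rewrite !dotDr// (dotC w v).
have := le_trans (ler_norm _) (normr_dot lv lw); rewrite mulr2n; lra.
Qed.

Lemma nrmZ a v : v \in L2T -> nrm (fun x => a * v x) = `|a| * nrm v.
Proof.
move=> lv; rewrite /nrm dotZl ?dotZr//; last exact: Lfun2Z.
by rewrite mulrA -expr2 sqrtrM ?sqr_ge0// sqrtr_sqr.
Qed.

Lemma nrm_distC v w : nrm (fun x => v x - w x) = nrm (fun x => w x - v x).
Proof.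
by congr Num.sqrt; apply: eq_Rintegral => x _; ring.
Qed.

Lemma le_nrm v w : v \in L2T -> w \in L2T -> (forall x, `|v x| <= `|w x|) ->
  nrm v <= nrm w.
Proof.
move=> lv lw vw; rewrite ler_wsqrtr// le_Rintegral//; try exact: Lfun2_intM.
by move=> x _; rewrite -!expr2 -[leLHS]real_normK ?num_real//
  -[leRHS]real_normK ?num_real// ler_sqr ?nnegrE.
Qed.

Lemma dominated_cvgR (f_ : (T -> R)^nat) (f g : T -> R) :
  (forall n, measurable_fun setT (f_ n)) -> measurable_fun setT f -> intg g ->
  (forall x, f_ ^~ x @ \oo --> f x) -> (forall n x, `|f_ n x| <= g x) ->
  intg f /\ (fun n => \int[mu]_x f_ n x) @ \oo --> \int[mu]_x f x.
Proof.
move=> mf_ mf ig ff fg.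
have [] := @dominated_convergence _ _ _ mu setT measurableT
  (fun n => EFin \o f_ n) (EFin \o f) (EFin \o g).
- by move=> n; apply/measurable_EFinP; exact: mf_.
- exact/measurable_EFinP.
- by apply: aeW => x _; apply: cvg_EFin; [exact: nearW|exact: ff].
- exact: ig.
- by apply: aeW => x n _ /=; rewrite lee_fin.
move=> if_ _ cf; split=> //.
apply: fine_cvg; rewrite fineK//; exact: integrable_fin_num.
Qed.

(** Lebesgue's theorem for |v_n - v|^2 with majorant 4 g^2; the bound |v| <= g needed for it is
    inherited in the limit. *)
Lemma dominated_cvg_nrm (v_ : (T -> R)^nat) (v g : T -> R) :
  (forall n, measurable_fun setT (v_ n)) -> measurable_fun setT v -> g \in L2T ->
  (forall x, v_ ^~ x @ \oo --> v x) -> (forall n x, `|v_ n x| <= g x) ->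
  (fun n => nrm (fun x => v_ n x - v x)) @ \oo --> 0.
Proof.
move=> mv_ mv lg vv vg.
have vg' x : `|v x| <= g x.
  have h : (fun n => `|v_ n x|) @ \oo --> `|v x| by apply: cvg_norm; exact: vv.
  rewrite -(cvg_lim _ h)//; apply: limr_le; last exact: nearW.
  by apply/cvg_ex; exists `|v x|.
have [|||||_] := @dominated_cvgR (fun n x => (v_ n x - v x) * (v_ n x - v x))
    (fun=> 0) (fun x => 4 * (g x * g x)).
- by move=> n; apply: measurable_funM; exact: measurable_funB.
- by [].
- by apply: intgZ; exact: Lfun2_intM.
- move=> x; rewrite -[0](mulr0 0) -{1 2}(subrr (v x)).
  by apply: cvgM; apply: cvgB => //; exact: cvg_cst.
- move=> n x; rewrite normrM -expr2.
  have : `|v_ n x - v x| <= 2 * g x.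
    by rewrite (le_trans (ler_normB _ _))//; have := vg n x; have := vg' x; lra.
  move=> h; rewrite (_ : 4 * _ = (2 * g x) ^+ 2); last by ring.
  by rewrite ler_pXn2r ?nnegrE// mulr_ge0// (le_trans (normr_ge0 _) (vg' x)).
rewrite Rintegral_cst// mul0r => h.
rewrite -(sqrtr0 R).
by apply: (cvg_comp _ _ h); exact: sqrt_continuous.
Qed.

Lemma cvg_dot (v_ w_ : (T -> R)^nat) v w :
  (forall n, v_ n \in L2T) -> (forall n, w_ n \in L2T) -> v \in L2T -> w \in L2T ->
  (fun n => nrm (fun x => v_ n x - v x)) @ \oo --> 0 ->
  (fun n => nrm (fun x => w_ n x - w x)) @ \oo --> 0 ->
  (fun n => dot (v_ n) (w_ n)) @ \oo --> dot v w.
Proof.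
move=> lv_ lw_ lv lw cv cw; apply/subr_cvg0.
apply/norm_cvg0P.
apply: (@squeeze_cvgr _ _ _ _ (fun=> 0) (fun n => nrm (fun x => v_ n x - v x) *
  (nrm (fun x => w_ n x - w x) + nrm w) + nrm v * nrm (fun x => w_ n x - w x))).
- apply: nearW => n; rewrite normr_ge0/=.
  have lvn : (fun x => v_ n x - v x) \in L2T by exact: Lfun2B.
  have lwn : (fun x => w_ n x - w x) \in L2T by exact: Lfun2B.
  have -> : dot (v_ n) (w_ n) - dot v w =
    dot (fun x => v_ n x - v x) (w_ n) + dot v (fun x => w_ n x - w x).
    by rewrite dotBl// dotBr//; ring.
  rewrite (le_trans (ler_normD _ _))// lerD//; last exact: normr_dot.
  rewrite (le_trans (normr_dot _ _))// ler_wpM2l ?nrm_ge0//.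
  have -> : w_ n = fun x => (w_ n x - w x) + w x by apply/funext => x; rewrite subrK.
  rewrite (_ : (fun x => w_ n x - w x + w x - w x) = (fun x => w_ n x - w x)).
    exact: ler_nrmD.
  by apply/funext => x; rewrite addrK.
- exact: cvg_cst.
- rewrite [X in _ --> X](_ : _ = 0 * (0 + nrm w) + nrm v * 0); last by ring.
  apply: cvgD; apply: cvgM => //; last exact: cvg_cst.
  by apply: cvgD => //; exact: cvg_cst.
Qed.

Lemma ae_eq_dot v v' w : v \in L2T -> v' \in L2T -> w \in L2T ->
  ae_eq mu setT v v' -> dot v w = dot v' w.
Proof.
move=> lv lv' lw vv'; rewrite /dot /Rintegral; congr fine.
apply: ae_eq_integral => //; try by apply: (measurable_int mu); exact: Lfun2_intM.
by apply: filterS vv' => x + _ => /(_ I) ->.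
Qed.

End square_integrable.

(** * Functions of class C^1 *)

Section pointwise_continuity.
Context {R : realType} {T : topologicalType}.
Implicit Types v w : T -> R.

Lemma contD v w : continuous v -> continuous w -> continuous (fun x => v x + w x).
Proof. by move=> cv cw x; exact: (continuousD (cv x) (cw x)). Qed.

Lemma contM v w : continuous v -> continuous w -> continuous (fun x => v x * w x).
Proof. by move=> cv cw x; exact: (continuousM (cv x) (cw x)). Qed.

Lemma contN v : continuous v -> continuous (fun x => - v x).
Proof. by move=> cv x; exact: (continuousN (cv x)). Qed.

Lemma contB v w : continuous v -> continuous w -> continuous (fun x => v x - w x).
Proof. by move=> cv cw; apply: contD => //; exact: contN. Qed.

Lemma contV v : (forall x, v x != 0) -> continuous v -> continuous (fun x => (v x)^-1).
Proof. by move=> v0 cv x; exact: (continuousV (v0 x) (cv x)). Qed.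

Lemma cont_norm v : continuous v -> continuous (fun x => `|v x|).
Proof. by move=> cv x; apply: cvg_norm; exact: cv. Qed.

Lemma cont_max v w : continuous v -> continuous w ->
  continuous (fun x => Num.max (v x) (w x)).
Proof.
move=> cv cw; under eq_fun do rewrite maxr_absE.
apply: contM; last exact: cst_continuous.
by apply: contD; [exact: contD|apply: cont_norm; exact: contB].
Qed.

Lemma cont_sum (I : Type) (r : seq I) (v : I -> T -> R) :
  (forall i, continuous (v i)) -> continuous (fun x => \sum_(i <- r) v i x).
Proof.
move=> cv; elim: r => [|i r ih].
  by under eq_fun do rewrite big_nil; exact: cst_continuous.
by under eq_fun do rewrite big_cons; exact: contD.
Qed.

End pointwise_continuity.

Section C1_calculus.
Context {R : realType} {d : nat}.
Notation V := 'rV[R]_d.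
Implicit Types (v w : V -> R) (dv dw : 'I_d -> V -> R).

(** The gradient is an explicit argument, so that the rules for sums, products, compositions and
    translations compute it; [isC 1] only speaks of [partial]. *)
Definition C1 v dv : Prop := [/\ continuous v, forall i, continuous (dv i) &
  forall i x, is_derive x (unit_rV i) v (dv i x)].

Lemma C1_isC v dv : C1 v dv -> isC 1 v.
Proof.
move=> [cv cdv dvv]; split=> // i; split=> [x|/=]; first by case: (dvv i x).
by split=> // x; rewrite (_ : partial i v = dv i)//; apply/funext => y; case: (dvv i y).
Qed.

Lemma C1_partial v dv i : C1 v dv -> partial i v = dv i.
Proof. by move=> [_ _ dvv]; apply/funext => y; case: (dvv i y). Qed.

Lemma isC_C1 v : isC 1 v -> C1 v (partial ^~ v).
Proof.
move=> [cv h]; split=> // i; first by have [_ []] := h i.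
by move=> x; have [dx _] := h i; exact: DeriveDef.
Qed.

(** Turns a directional derivative into a derivative on the line, where the one-variable chain rule
    applies. *)
Lemma is_derive_line (f : V -> R) x u (df : R) :
  is_derive x u f df <-> is_derive (0 : R) (1 : R) (fun s : R => f (s *: u + x)) df.
Proof.
have E : (fun h : R => h^-1 *: (f (h *: u + x) - f x)) =
  (fun h : R => h^-1 *: (f ((h *: 1 + 0) *: u + x) - f (0 *: u + x))).
  by apply/funext => h; rewrite scale0r add0r addr0 /GRing.scale/= mulr1.
split=> -[dd dE]; apply: DeriveDef.
- by rewrite /derivable -E.
- by rewrite -dE /derive -E.
- by rewrite /derivable E.
- by rewrite -dE /derive E.
Qed.

Lemma is_derive_along (f : V -> R) x u (df : R) (s : R) :
  is_derive (x + s *: u) u f df ->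
  is_derive s (1 : R) (fun s : R => f (x + s *: u)) df.
Proof.
have E : (fun h : R => h^-1 *: (f (h *: u + (x + s *: u)) - f (x + s *: u))) =
  (fun h : R => h^-1 *: (f (x + (h *: 1 + s) *: u) - f (x + s *: u))).
  apply/funext => h; rewrite (_ : h *: (1 : R) = h); last exact: mulr1.
  by rewrite scalerDl addrCA.
move=> [dd dE]; apply: DeriveDef; first by rewrite /derivable -E.
by rewrite -dE /derive E.
Qed.

Lemma is_derive_comp1 (h : R -> R) (f : V -> R) x u (dh df : R) :
  is_derive (f x) 1 h dh -> is_derive x u f df ->
  is_derive x u (h \o f) (dh * df).
Proof.
move=> hh /is_derive_line hf; apply/is_derive_line.
have := @is_derive1_comp R h (fun s : R => f (s *: u + x)) 0 dh df.
by rewrite scale0r add0r => H; exact: H.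
Qed.

Lemma C1_cst c : C1 (fun=> c) (fun _ _ => 0).
Proof.
split=> [||i x]; first exact: cst_continuous.
- by move=> i; exact: cst_continuous.
- exact: is_derive_cst.
Qed.

Lemma C1D v dv w dw : C1 v dv -> C1 w dw ->
  C1 (fun x => v x + w x) (fun i x => dv i x + dw i x).
Proof.
move=> [cv cdv dvv] [cw cdw dww]; split.
- exact: contD.
- by move=> i; exact: contD.
- by move=> i x; apply: is_deriveD.
Qed.

Lemma C1M v dv w dw : C1 v dv -> C1 w dw ->
  C1 (fun x => v x * w x) (fun i x => v x * dw i x + w x * dv i x).
Proof.
move=> [cv cdv dvv] [cw cdw dww]; split.
- exact: contM.
- by move=> i; apply: contD; exact: contM.
- by move=> i x; apply: is_deriveM.
Qed.

Lemma C1Z c v dv : C1 v dv -> C1 (fun x => c * v x) (fun i x => c * dv i x).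
Proof.
move=> cv; have := C1M (C1_cst c) cv.
by congr C1; apply/funext => i; apply/funext => x; rewrite mulr0 addr0.
Qed.

Lemma C1B v dv w dw : C1 v dv -> C1 w dw ->
  C1 (fun x => v x - w x) (fun i x => dv i x - dw i x).
Proof.
move=> cv cw; have := C1D cv (C1Z (-1) cw).
congr C1; first by apply/funext => x; rewrite mulN1r.
by apply/funext => i; apply/funext => x; rewrite mulN1r.
Qed.

Lemma C1_sum (I : Type) (r : seq I) (v : I -> V -> R) (dv : I -> 'I_d -> V -> R) :
  (forall k, C1 (v k) (dv k)) ->
  C1 (fun x => \sum_(k <- r) v k x) (fun i x => \sum_(k <- r) dv k i x).
Proof.
move=> cv; elim: r => [|k r ih].
  have := C1_cst 0; congr C1; first by apply/funext => x; rewrite big_nil.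
  by apply/funext => i; apply/funext => x; rewrite big_nil.
have := C1D (cv k) ih; congr C1; first by apply/funext => x; rewrite big_cons.
by apply/funext => i; apply/funext => x; rewrite big_cons.
Qed.

Lemma C1_prod (I : Type) (r : seq I) (v : I -> V -> R) :
  (forall k, exists dv, C1 (v k) dv) ->
  exists dv, C1 (fun x => \prod_(k <- r) v k x) dv.
Proof.
move=> cv; elim: r => [|k r [dw ih]].
  by exists (fun _ _ => 0); under eq_fun do rewrite big_nil; exact: C1_cst.
have [dv cdv] := cv k; eexists; under eq_fun do rewrite big_cons.
exact: C1M cdv ih.
Qed.

Lemma C1_comp (h dh : R -> R) v dv :
  (forall s : R, is_derive s (1 : R) h (dh s)) -> continuous dh -> C1 v dv ->
  C1 (fun x => h (v x)) (fun i x => dh (v x) * dv i x).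
Proof.
move=> dhh cdh [cv cdv dvv]; split.
- move=> x; apply: continuous_comp; first exact: cv.
  by apply: differentiable_continuous; apply/derivable1_diffP; case: (dhh (v x)).
- move=> i; apply: contM => // x.
  by apply: continuous_comp; [exact: cv|exact: cdh].
- by move=> i x; exact: is_derive_comp1.
Qed.

Lemma C1_coord (j : 'I_d) : C1 (fun x : V => x ord0 j) (fun i _ => (i == j)%:R).
Proof.
split; [exact: coord_continuous|by move=> i; exact: cst_continuous|].
move=> i x; apply/is_derive_line.
rewrite (_ : (fun _ => _) = (fun s : R => s * (i == j)%:R + x ord0 j)).
  by apply: is_derive_eq; rewrite addr0 /GRing.scale/= mulr0 add0r mulr1.
by apply/funext => s; rewrite !mxE eqxx/= eq_sym.
Qed.

Lemma C1V v dv : (forall x, v x != 0) -> C1 v dv ->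
  exists dw, C1 (fun x => (v x)^-1) dw.
Proof.
move=> v0 [cv cdv dvv]; exists (fun i x => - (v x) ^- 2 * dv i x); split.
- exact: contV.
- move=> i; apply: contM => //; apply: contN; apply: contV.
    by move=> x; rewrite expf_neq0.
  exact: contM.
- move=> i x; apply: (@is_derive_comp1 (fun s : R => s^-1)) => //.
  have := @is_deriveV R id (v x) 1 1 (v0 x) (is_derive_id _ _).
  by rewrite /GRing.scale/= mulr1.
Qed.

Lemma continuous_shift (h : V) : continuous (fun x : V => x + h).
Proof. by move=> x; apply: continuousD => //; exact: cst_continuous. Qed.

Lemma C1_shift v dv (h : V) : C1 v dv -> C1 (fun x => v (x + h)) (fun i x => dv i (x + h)).
Proof.
have ch := @continuous_shift h.
move=> [cv cdv dvv]; split.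
- by move=> x; apply: (@continuous_comp _ _ _ (fun x : V => x + h) v); [exact: ch|exact: cv].
- by move=> i x; apply: (@continuous_comp _ _ _ (fun x : V => x + h) (dv i)); [exact: ch|exact: cdv].
- move=> i x; apply/is_derive_line; have /is_derive_line := dvv i (x + h).
  by under eq_fun do rewrite addrA.
Qed.

End C1_calculus.

(** * A C^1 step function on the line *)

Section smooth_step.
Context {R : realType}.
Implicit Types s : R.

Definition pos_sqr s : R := Num.max s 0 ^+ 2.

Lemma is_derive_pos_sqr s : is_derive s 1 pos_sqr (2 * Num.max s 0).
Proof.
have H : h^-1 *: (pos_sqr (h *: 1 + s) - pos_sqr s) @[h --> 0^'] --> 2 * Num.max s 0.
  apply/subr_cvg0; apply/norm_cvg0P.
  (* The first-order Taylor remainder of the truncated square is at most h^2. *)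
  apply: (@squeeze_cvgr _ _ _ _ (fun=> 0) (fun h : R => `|h|)).
  - near=> h; rewrite normr_ge0/=.
    have h0 : h != 0 by near: h; exact: nbhs_dnbhs_neq.
    rewrite /GRing.scale/= mulr1.
    have -> : h^-1 * (pos_sqr (h + s) - pos_sqr s) - 2 * Num.max s 0 =
      h^-1 * (pos_sqr (h + s) - pos_sqr s - 2 * Num.max s 0 * h) by field.
    rewrite normrM normfV ler_pdivrMl ?normr_gt0// -expr2 real_normK ?num_real//.
    rewrite /pos_sqr ler_norml; case: (leP (h + s) 0); case: (leP s 0) => *; apply/andP; split; nra.
  - exact: cvg_cst.
  - rewrite -[X in _ --> X](normr0 R); apply: cvg_norm; exact: nbhs_dnbhs.
apply: DeriveDef; first by apply/cvg_ex; eexists; exact: H.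
exact: cvg_lim H.
Unshelve. all: by end_near. Qed.

(** A quadratic spline with knots 0, 1/2 and 1: its second derivative is 4 on (0, 1/2), -4 on (1/2,
    1) and 0 elsewhere, so it rises from 0 to 1 and is C^1. Being piecewise polynomial, it can be
    estimated by case analysis and arithmetic alone. *)
Definition smoothstep s : R :=
  2 * pos_sqr s + (-4) * pos_sqr (s - 2^-1) + 2 * pos_sqr (s - 1).

Definition dsmoothstep s : R :=
  4 * Num.max s 0 + (-8) * Num.max (s - 2^-1) 0 + 4 * Num.max (s - 1) 0.

Lemma is_derive_smoothstep s : is_derive s 1 smoothstep (dsmoothstep s).
Proof.
have shift c : is_derive s 1 (fun s => pos_sqr (s - c)) (2 * Num.max (s - c) 0).
  have := @is_derive1_comp R pos_sqr (fun s => s - c) s (2 * Num.max (s - c) 0) 1.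
  rewrite mulr1; apply; first exact: is_derive_pos_sqr.
  by apply: is_derive_eq; rewrite subr0.
have h0 := is_derive_pos_sqr s; have h1 := shift 2^-1; have h2 := shift 1.
rewrite /smoothstep; apply: is_derive_eq; rewrite /dsmoothstep/= /GRing.scale/=; ring.
Qed.

Lemma dsmoothstep_continuous : continuous dsmoothstep.
Proof.
have cid : continuous (fun s : R => s) by move=> s.
have cc (c : R) : continuous (fun _ : R => c) by exact: cst_continuous.
have cm (c : R) : continuous (fun s : R => Num.max (s - c) 0).
  by apply: cont_max => //; exact: contB.
apply: contD; first apply: contD; apply: contM => //; exact: cont_max.
Qed.

Lemma smoothstep_le0 s : s <= 0 -> smoothstep s = 0.
Proof.
move=> s0; rewrite /smoothstep /pos_sqr.
by case: (leP s 0); case: (leP (s - 2^-1) 0); case: (leP (s - 1) 0) => *; lra.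
Qed.

Lemma smoothstep_ge1 s : 1 <= s -> smoothstep s = 1.
Proof.
move=> s1; rewrite /smoothstep /pos_sqr.
by case: (leP s 0); case: (leP (s - 2^-1) 0); case: (leP (s - 1) 0) => *; nra.
Qed.

Lemma smoothstep_itv s : 0 <= smoothstep s <= 1.
Proof.
rewrite /smoothstep /pos_sqr.
by case: (leP s 0); case: (leP (s - 2^-1) 0); case: (leP (s - 1) 0) => *; apply/andP; split; nra.
Qed.

Lemma dsmoothstep_ge1 s : 1 <= s -> dsmoothstep s = 0.
Proof.
move=> s1; rewrite /dsmoothstep.
by case: (leP s 0); case: (leP (s - 2^-1) 0); case: (leP (s - 1) 0) => *; lra.
Qed.

Lemma dsmoothstep_bounded s : `|dsmoothstep s| <= 2.
Proof.
rewrite /dsmoothstep ler_norml.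
by case: (leP s 0); case: (leP (s - 2^-1) 0); case: (leP (s - 1) 0) => *; apply/andP; split; lra.
Qed.

End smooth_step.

(** * Translation invariance of Lebesgue measure on row vectors *)

Section borel_rV_theory.
Context {R : realType} {n : nat}.
Notation V := 'rV[R]_n.

Lemma measurable_coord (i : 'I_n) (Y : set R) : measurable Y ->
  measurable [set x : V | Y (x ord0 i)].
Proof. by move=> mY; rewrite -[X in measurable X]setTI; exact: measurable_coor_rV. Qed.

Lemma measurable_box (Y : 'I_n -> set R) : (forall i, measurable (Y i)) ->
  measurable [set x : V | forall i, Y i (x ord0 i)].
Proof.
move=> mY; rewrite (_ : mkset _ =
  \bigcap_(i in [set: 'I_n]) [set x : V | Y i (x ord0 i)]).
  by apply: fin_bigcap_measurable => [|i _]; [exact: finite_finset|exact: measurable_coord].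
by apply/seteqP; split=> x /= h; [move=> i _; exact: h|move=> i; exact: h].
Qed.

Lemma coord_le_norm (x : V) i : `|x ord0 i| <= `|x|.
Proof.
rewrite [leRHS]/Num.norm/= mx_normrE.
exact: (@le_bigmax _ _ _ 0 (fun ij : 'I_1 * 'I_n => `|x ij.1 ij.2|) (ord0, i)).
Qed.

Lemma norm_lt_coord (x : V) e : 0 < e -> (forall i, `|x ord0 i| < e) -> `|x| < e.
Proof.
move=> e0 xe; rewrite [ltLHS]/Num.norm/= mx_normrE.
by apply/bigmax_ltP; split=> // -[j i] _ /=; rewrite ord1.
Qed.

(** The sigma-algebra is generated by coordinates, so an open set is written as the countable union
    of the cubes with rational centre and radius 1 / (m + 1) that it contains. *)
Lemma open_measurable_rV (U : set V) : open U -> measurable U.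
Proof.
move=> oU.
pose box (p : {ffun 'I_n -> rat} * nat) : set V :=
  [set x | forall i, `|x ord0 i - ratr (p.1 i)| < p.2.+1%:R^-1].
have mbox p : measurable (box p).
  apply: (@measurable_box (fun i => [set y | `|y - ratr (p.1 i)| < p.2.+1%:R^-1])) => i.
  rewrite (_ : mkset _ = ball (ratr (p.1 i) : R) p.2.+1%:R^-1).
    exact: measurable_ball.
  by apply/seteqP; split=> y /=; rewrite /ball/= distrC.
pose F p := if `[< box p `<=` U >] then box p else set0.
have -> : U = \bigcup_p F p.
  apply/seteqP; split=> [x Ux|x [p _]]; last first.
    by rewrite /F; case: asboolP => // h; exact: h.
  have /nbhs_ballP[e /= e0 eU] : nbhs x U by exact: open_nbhs_nbhs.
  (* Points of the chosen cube and x itself are both within 1 / (m + 1) of the rational centre,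
     hence the half of e. *)
  have [m me] : exists m : nat, m.+1%:R^-1 < e / 2.
    have [m _ /(_ m (leqnn _))/= h] := near_infty_natSinv_lt (PosNum (divr_gt0 e0 (ltr0Sn R 1))).
    by exists m.
  have m0 : 0 < m.+1%:R^-1 :> R by rewrite invr_gt0.
  have q i : {q : rat | `|x ord0 i - ratr q| < m.+1%:R^-1}.
    apply: cid; have [|q] := @rat_in_itvoo R (x ord0 i - m.+1%:R^-1) (x ord0 i + m.+1%:R^-1).
      by rewrite ltrBlDr -addrA ltrDl addr_gt0.
    rewrite in_itv/= => /andP[q1 q2]; exists q; rewrite ltr_norml; apply/andP; split.
      by rewrite ltrBrDl ltrBlDr.
    by rewrite ltrBlDr -ltrBlDl.
  exists ([ffun i => sval (q i)], m) => //; rewrite /F; case: asboolP => [_|].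
    by move=> i/=; rewrite ffunE; exact: (svalP (q i)).
  case; move=> y by_; apply: eU; rewrite mx_norm_ball/=.
  apply: norm_lt_coord => // i; rewrite !mxE.
  have := by_ i; rewrite ffunE/= => h1; have h2 := svalP (q i).
  rewrite (_ : x ord0 i - y ord0 i = (x ord0 i - ratr (sval (q i))) - (y ord0 i - ratr (sval (q i)))); last by ring.
  by rewrite (le_lt_trans (ler_normB _ _))// [e]splitr ltrD// (lt_trans _ me).
apply: countable_bigcupT_measurable => [|p]; first exact: countableP.
by rewrite /F; case: asboolP.
Qed.

Lemma closed_measurable_rV (U : set V) : closed U -> measurable U.
Proof.
by move=> cU; rewrite -[U]setCK; apply: measurableC; apply: open_measurable_rV; exact: closed_openC.
Qed.

Lemma continuous_measurable_rV (f : V -> R) : continuous f -> measurable_fun setT f.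
Proof.
move=> /continuousP cf; apply: (measurability _ (RGenOpens.measurableE R)).
move=> _ [_ [a [b ->] <-]]; rewrite setTI; apply: open_measurable_rV.
exact/cf/interval_open.
Qed.

Lemma measurable_shift (h : V) : measurable_fun setT (fun x : V => x + h).
Proof.
apply: measurable_fun_rV => i.
rewrite (_ : _ \o _ = fun x => coor_rV i x + h ord0 i); last first.
  by apply/funext => x /=; rewrite /coor_rV mxE.
by apply: measurable_funD => //; exact: measurable_coor_rV.
Qed.

End borel_rV_theory.

Section lebesgue_rV_theory.
Context {R : realType}.

(** Translation preserves the length of half-open intervals, and these lengths determine Lebesgue
    measure. *)
Lemma lebesgue_measure_shift (h : R) (A : set R) : measurable A ->
  lebesgue_measure ((fun s => s + h) @^-1` A) = lebesgue_measure A.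
Proof.
have mh : measurable_fun setT (fun s : measurableTypeR R => s + h : measurableTypeR R).
  by apply: measurable_funD.
move=> mA; pose phi : {mfun measurableTypeR R >-> measurableTypeR R} :=
  HB.pack (fun s : measurableTypeR R => s + h : measurableTypeR R) (isMeasurableFun.Build _ _ _ _ _ mh).
apply/esym; apply: (@lebesgue_measure_unique R (pushforward lebesgue_measure phi)) => //.
move=> _ [[a b]] _ <-; rewrite /pushforward /=.
rewrite [X in _ = lebesgue_measure X](_ : _ = `]a - h, b - h]%classic); last first.
  by apply/seteqP; split=> s /=; rewrite !in_itv/= ltrBlDr lerBrDr.
by rewrite !lebesgue_measure_itv/= !lte_fin ltrD2r; case: ifP => // _; rewrite -!EFinB; congr EFin; ring.
Qed.

Lemma lebesgue_rV_prod n (A : set 'rV[R]_n.+1) X B : measurable X -> measurable B ->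
  @cons_rV R n @^-1` A = X `*` B ->
  lebesgue_rV R n.+1 A = (lebesgue_measure X * lebesgue_rV R n B)%E.
Proof.
move=> mX mB AE.
have -> : lebesgue_rV R n.+1 A = (@lebesgue_measure R \x^ lebesgue_rV R n)%E (@cons_rV R n @^-1` A) by [].
by rewrite AE product_measure2E.
Qed.

Lemma lebesgue_rV_box_fin n (Y : 'I_n -> set R) : (forall i, measurable (Y i)) ->
  (forall i, lebesgue_measure (Y i) < +oo)%E ->
  (lebesgue_rV R n [set x | forall i, Y i (x ord0 i)] < +oo)%E.
Proof.
elim: n Y => [|n ih] Y mY fY.
  by rewrite /= diracE ltry.
rewrite (@lebesgue_rV_prod _ _ (Y ord0)
  [set x : 'rV[R]_n | forall i, Y (lift ord0 i) (x ord0 i)])//.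
- by rewrite lte_mul_pinfty// ?ge0_fin_numE//; exact: (ih (fun i => Y (lift ord0 i))).
- exact: mY.
- by apply: (@measurable_box R n (fun i => Y (lift ord0 i))).
apply/seteqP; split=> -[a x] /=.
  move=> h; split; first by have := h ord0; rewrite mxE; case: splitP => // j _; rewrite !mxE !ord1 eqxx.
  by move=> i; have := h (lift ord0 i); rewrite mxE; case: splitP => //= j; [by rewrite ord1|case => /ord_inj ->].
move=> [h0 h] i; rewrite mxE; case: splitP => j ij.
  by rewrite mxE !ord1 eqxx (_ : i = ord0)//; apply: ord_inj; rewrite ij ord1.
by rewrite (_ : i = lift ord0 j)//; exact: ord_inj.
Qed.

Lemma lebesgue_rV_hyperplane n (i : 'I_n) (a : R) :
  lebesgue_rV R n [set x | x ord0 i = a] = 0%E.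
Proof.
elim: n i => [[]//|n ih] i.
have [->|[j ->]] : i = ord0 \/ exists j : 'I_n, i = lift ord0 j.
  by case: (unliftP ord0 i) => [j|] ->; [right; exists j|left].
- rewrite (@lebesgue_rV_prod _ _ [set a] setT)//.
    by rewrite lebesgue_measure_set1 mul0e.
  by apply/seteqP; split=> -[b x] /=; rewrite mxE; case: splitP => // k _; rewrite !mxE !ord1 eqxx// => -[].
- rewrite (@lebesgue_rV_prod _ _ setT [set x : 'rV[R]_n | x ord0 j = a])//.
  + by rewrite ih mule0.
  + by apply: (@measurable_coord R n j [set a]).
  by apply/seteqP; split=> -[b x] /=; rewrite mxE; case: splitP => k //=;
    rewrite ?ord1// => -[] /ord_inj -> // [].
Qed.

(** Induction on the dimension: the section of the shifted set at y is a one-dimensional translate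
    of the section of A at y + h', so it has the same length; the remaining shift by h' is absorbed
    by the integral over y, since by induction the pushed-forward measure is the measure itself. *)
Lemma lebesgue_rV_shift n (h : 'rV[R]_n) (A : set 'rV[R]_n) : measurable A ->
  lebesgue_rV R n ((fun x => x + h) @^-1` A) = lebesgue_rV R n A.
Proof.
elim: n h A => [|n ih] h A mA.
  by congr (lebesgue_rV R 0 _); apply/seteqP; split=> x /=; rewrite !(thinmx0 (x + h)) !(thinmx0 x).
pose h0 := h ord0 ord0; pose h' : 'rV[R]_n := \row_i h ord0 (lift ord0 i).
have consD a x : cons_rV (a, x) + h = cons_rV (a + h0, x + h').
  apply/rowP => i; rewrite !mxE; case: splitP => j ij; rewrite !mxE !ord1 ?eqxx; congr (_ + h _ _).
    by apply: ord_inj; rewrite ij ord1.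
  exact: ord_inj.
pose A' := @cons_rV R n @^-1` A.
have mA' : measurable A' by rewrite -[A']setTI; exact: measurable_cons_rV.
transitivity (\int[lebesgue_rV R n]_y (lebesgue_measure (ysection A' (y + h')%R)))%E.
  apply: eq_integral => y _ /=.
  rewrite -[RHS](lebesgue_measure_shift h0); last exact: measurable_ysection.
  congr lebesgue_measure; apply/seteqP; split=> a; rewrite /ysection/= !inE/=.
    by rewrite /A'/= -consD.
  by rewrite /A'/= -consD.
rewrite -(@ge0_integral_pushforward _ _ _ _ _ _ (measurable_shift h') (lebesgue_rV R n) setT
   (lebesgue_measure \o ysection A'))//.
- apply: eq_measure_integral => [|mh B mB _]; [exact: measurable_shift|exact: ih].
- exact: measurable_fun_ysection.
Qed.

End lebesgue_rV_theory.

Section lebesgue_rV_integral.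
Context {R : realType} {n : nat}.
Notation V := 'rV[R]_n.
Notation mu := (lebesgue_rV R n).
Notation intg v := (mu.-integrable setT (EFin \o v)).
Implicit Types (h : V) (v w : V -> R).

Lemma bounded_lebesgue_fin (A : set V) : measurable A -> bounded_set A -> (mu A < +oo)%E.
Proof.
move=> mA [M [_ /(_ (M + 1)) MA]].
have {}MA x : A x -> `|x| <= M + 1 by apply: MA; rewrite ltrDl.
pose Y : set R := `[- (M + 1), M + 1]%classic.
have : (mu [set x : V | forall i, Y (x ord0 i)] < +oo)%E.
  apply: (@lebesgue_rV_box_fin R n (fun=> Y)) => i; first exact: measurable_itv.
  by rewrite /Y lebesgue_measure_itv/=; case: ifP; rewrite ?ltry// -EFinD ltry.
apply: le_lt_trans; apply: le_measure; rewrite ?inE//.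
  by apply: (@measurable_box R n (fun=> Y)) => i; exact: measurable_itv.
move=> x Ax i /=; rewrite /Y/= in_itv/= -ler_norml; apply: le_trans (MA _ Ax).
exact: coord_le_norm.
Qed.

Lemma integral_shift h (f : V -> \bar R) : measurable_fun setT f ->
  (forall x, 0 <= f x)%E ->
  (\int[mu]_x f (x + h)%R = \int[mu]_x f x)%E.
Proof.
move=> mf f0.
rewrite -(@ge0_integral_pushforward _ _ _ _ _ _ (measurable_shift h) mu setT f)//.
by apply: eq_measure_integral => [|mh B mB _]; [exact: measurable_shift|exact: lebesgue_rV_shift].
Qed.

Lemma intg_shift h v : intg v -> intg (fun x => v (x + h)).
Proof.
move=> /integrableP[mv iv]; apply/integrableP; split.
  by apply: (measurableT_comp mv); exact: measurable_shift.
by rewrite (@integral_shift h (fun x => `|(EFin \o v) x|)%E)//; exact: measurableT_comp.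
Qed.

Lemma Rintegral_shift h v : intg v -> \int[mu]_x v (x + h) = \int[mu]_x v x.
Proof.
move=> iv; rewrite /Rintegral; congr fine.
rewrite -(@integral_pushforward _ _ _ _ _ _ (measurable_shift h) mu setT (EFin \o v))//.
- by apply: eq_measure_integral => [|mh B mB _]; [exact: measurable_shift|exact: lebesgue_rV_shift].
- exact: measurable_int iv.
- exact: intg_shift.
Qed.

Lemma Lfun2_shift h v : v \in Lfun mu 2%:E -> (fun x => v (x + h)) \in Lfun mu 2%:E.
Proof.
move=> /Lfun2P[mv iv]; apply/Lfun2P; split; last exact: (intg_shift h iv).
by apply: (measurableT_comp mv); exact: measurable_shift.
Qed.

Lemma dot_shift h v w : v \in Lfun mu 2%:E -> w \in Lfun mu 2%:E ->
  dot mu (fun x => v (x + h)) w = dot mu v (fun x => w (x - h)).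
Proof.
move=> lv lw; rewrite /dot -(Rintegral_shift (- h)).
  by apply: eq_Rintegral => x _; rewrite subrK.
by apply: Lfun2_intM => //; exact: Lfun2_shift.
Qed.

Lemma nrm_shift h v : v \in Lfun mu 2%:E -> nrm mu (fun x => v (x + h)) = nrm mu v.
Proof.
move=> lv; rewrite /nrm dot_shift//; last exact: Lfun2_shift.
by congr Num.sqrt; apply: eq_Rintegral => x _; rewrite subrK.
Qed.

End lebesgue_rV_integral.

(** * Test functions and their density in L^2 *)

Section compact_support.
Context {R : realType} {d : nat}.
Notation V := 'rV[R]_d.
Notation mu := (lebesgue_rV R d).
Notation intg v := (mu.-integrable setT (EFin \o v)).
Notation L2T := (Lfun mu 2%:E).
Implicit Types (v w : V -> R) (K U : set V).

Definition cball (M : R) : set V := [set x | `|x| <= M].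

Lemma closed_cball M : closed (cball M).
Proof.
rewrite (_ : cball M = (fun x : V => `|x|) @^-1` [set y | y <= M])//.
by apply: closed_comp; [move=> x _; exact: norm_continuous|exact: closed_le].
Qed.

Lemma bounded_cball M : bounded_set (cball M).
Proof. by exists M; split; [exact: num_real|move=> y My x; rewrite /cball/= => xM; rewrite (le_trans xM)// ltW]. Qed.

Lemma compact_cball M : compact (cball M).
Proof. by apply: bounded_closed_compact; [exact: bounded_cball|exact: closed_cball]. Qed.

Lemma compact_sub_cball K : compact K -> exists M, K `<=` cball M.
Proof.
move=> /compact_bounded[M [_ /(_ (M + 1))]]; rewrite ltrDl ltr01 => /(_ isT) KM.
by exists (M + 1).
Qed.

Lemma compact_closed_rV K : compact K -> closed K.
Proof. by apply: compact_closed; exact: norm_hausdorff. Qed.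

Lemma measurable_cball M : measurable (cball M).
Proof. by apply: closed_measurable_rV; exact: closed_cball. Qed.

Lemma indic_intg (A : set V) : measurable A -> bounded_set A -> intg (\1_A).
Proof.
move=> mA bA; apply/integrableP; split; first exact/measurable_EFinP.
under eq_integral do rewrite /= ger0_norm//.
by rewrite integral_indic// setIT; exact: bounded_lebesgue_fin.
Qed.

Lemma indic_Lfun2 (A : set V) : measurable A -> bounded_set A -> (\1_A : V -> R) \in L2T.
Proof.
move=> mA bA; apply/Lfun2P; split; first by [].
rewrite (_ : (fun x => _) = \1_A); first exact: indic_intg.
by apply/funext => x; rewrite indicE; case: (x \in A); rewrite ?expr1n ?expr0n.
Qed.

Lemma continuous_bounded_compact v K : continuous v -> compact K ->
  exists2 c, 0 <= c & forall x, K x -> `|v x| <= c.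
Proof.
move=> cv cK.
have /compact_bounded[M [_ /(_ (`|M| + 1))]] : compact (v @` K).
  by apply: continuous_compact => //; exact: continuous_subspaceT.
rewrite (le_lt_trans (ler_norm M)) ?ltrDl// => /(_ isT) vM.
by exists (`|M| + 1) => [|x Kx]; [exact: addr_ge0|apply: vM; exists x].
Qed.

Lemma compact_supp_bounded v K : continuous v -> compact K ->
  (forall x, ~ K x -> v x = 0) -> exists2 c, 0 <= c & forall x, `|v x| <= c.
Proof.
move=> cv cK v0; have [c c0 vc] := continuous_bounded_compact cv cK.
exists c => // x; have [Kx|nKx] := pselect (K x); first exact: vc.
by rewrite v0// normr0.
Qed.

Lemma compact_supp_Lfun2 v K : continuous v -> compact K ->
  (forall x, ~ K x -> v x = 0) -> v \in L2T.
Proof.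
move=> cv cK v0; have [c c0 vc] := compact_supp_bounded cv cK v0.
have -> : v = fun x => v x * \1_K x.
  apply/funext => x; rewrite indicE; case: (boolP (x \in K)) => [_|/negP]; first by rewrite mulr1.
  by rewrite inE => /v0 ->; rewrite mul0r.
apply: Lfun2_bddM vc _; first exact: continuous_measurable_rV.
apply: indic_Lfun2; last exact: compact_bounded.
by apply: closed_measurable_rV; exact: compact_closed_rV.
Qed.

Lemma compact_supp_intg v K : continuous v -> compact K ->
  (forall x, ~ K x -> v x = 0) -> intg v.
Proof.
move=> cv cK v0; have [c c0 vc] := compact_supp_bounded cv cK v0.
have -> : v = fun x => v x * \1_K x.
  apply/funext => x; rewrite indicE; case: (boolP (x \in K)) => [_|/negP]; first by rewrite mulr1.
  by rewrite inE => /v0 ->; rewrite mul0r.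
apply: intg_bddM vc _; first exact: continuous_measurable_rV.
apply: indic_intg; last exact: compact_bounded.
by apply: closed_measurable_rV; exact: compact_closed_rV.
Qed.

(** Off a closed set the difference quotients vanish for small h. K is only closed, not compact,
    because the lemma also serves for a function minus a constant, with K the complement of an open
    set where that function is constant. *)
Lemma partial_off_support v dv K i : C1 v dv -> closed K ->
  (forall x, ~ K x -> v x = 0) -> forall x, ~ K x -> dv i x = 0.
Proof.
move=> [_ _ dvv] cK v0 x nKx; have [dd <-] := dvv i x.
have : \forall h \near (0 : R)^', h^-1 *: (v (h *: unit_rV i + x) - v x) = 0.
  have oK : open (~` K) by exact: closed_openC.
  have : \forall h \near (0 : R), (~` K) (h *: unit_rV i + x).
    have ch : {for 0, continuous (fun h : R => h *: (unit_rV i : V) + x)}.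
      apply: continuousD; last exact: cst_continuous.
      by move=> z; apply: cvgZr_tmp; exact: cvg_id.
    apply: ch; rewrite scale0r add0r; exact: open_nbhs_nbhs.
  move=> /(@nbhs_dnbhs _ 0) H; near=> h.
  rewrite (v0 _ nKx) v0 ?subrr ?scaler0//; near: h; exact: H.
move=> H; rewrite /derive; apply: cvg_lim => //.
by apply: cvg_near_cst.
Unshelve. all: by end_near. Qed.

(** The counterpart of [test_fun] with the gradient as an argument; [tf_test] and [test_tf] pass
    between the two. *)
Definition tf U v (dv : 'I_d -> V -> R) : Prop :=
  C1 v dv /\ exists K, [/\ compact K, K `<=` U & forall x, ~ K x -> v x = 0].

Lemma tf_test U v dv : tf U v dv -> test_fun U v.
Proof. by move=> [cv hK]; split=> //; exact: C1_isC cv. Qed.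

Lemma test_tf U v : test_fun U v -> tf U v (partial ^~ v).
Proof. by move=> [cv hK]; split=> //; exact: isC_C1. Qed.

Lemma tfT U v dv : tf U v dv -> tf setT v dv.
Proof. by move=> [cv [K [cK _ vK]]]; split=> //; exists K. Qed.

Lemma tf_off U v dv : tf U v dv -> forall x, ~ U x -> v x = 0 /\ forall i, dv i x = 0.
Proof.
move=> [cv [K [cK KU vK]]] x Ux; split=> [|i]; first by apply: vK; apply: contra_not Ux => /KU.
apply: (partial_off_support i cv (compact_closed_rV cK) vK).
by apply: contra_not Ux => /KU.
Qed.

Lemma tf_cont U v dv : tf U v dv -> continuous v. Proof. by case=> [[]]. Qed.
Lemma tf_dcont U v dv i : tf U v dv -> continuous (dv i). Proof. by case=> [[]]. Qed.

Lemma tf_Lfun2 U v dv : tf U v dv -> v \in L2T.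
Proof. by move=> [[cv _ _] [K [cK _ vK]]]; exact: compact_supp_Lfun2 vK. Qed.

Lemma tf_dLfun2 U v dv i : tf U v dv -> dv i \in L2T.
Proof.
move=> [hv [K [cK _ vK]]]; have [_ cdv _] := hv.
apply: (compact_supp_Lfun2 (cdv i) cK).
exact: (partial_off_support i hv (compact_closed_rV cK) vK).
Qed.

Lemma tf_intg U v dv : tf U v dv -> intg v.
Proof. by move=> [[cv _ _] [K [cK _ vK]]]; exact: compact_supp_intg vK. Qed.

Lemma tf_bounded U v dv : tf U v dv -> exists2 c, 0 <= c & forall x, `|v x| <= c.
Proof. by move=> [[cv _ _] [K [cK _ vK]]]; exact: compact_supp_bounded vK. Qed.

Lemma tf_dbounded U v dv i : tf U v dv -> exists2 c, 0 <= c & forall x, `|dv i x| <= c.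
Proof.
move=> [hv [K [cK _ vK]]]; have [_ cdv _] := hv.
apply: (compact_supp_bounded (cdv i) cK).
exact: (partial_off_support i hv (compact_closed_rV cK) vK).
Qed.

Lemma tfMl U v dv w dw : C1 v dv -> tf U w dw ->
  tf U (fun x => v x * w x) (fun i x => v x * dw i x + w x * dv i x).
Proof.
move=> cv [cw [K [cK KU wK]]]; split; first exact: C1M.
by exists K; split=> // x /wK ->; rewrite mulr0.
Qed.

Lemma tfD U v dv w dw : tf U v dv -> tf U w dw ->
  tf U (fun x => v x + w x) (fun i x => dv i x + dw i x).
Proof.
move=> [cv [K [cK KU vK]]] [cw [K' [cK' KU' wK']]]; split; first exact: C1D.
exists (K `|` K'); split; first exact: compactU.
  by move=> x [/KU|/KU'].
by move=> x /not_orP[/vK -> /wK' ->]; rewrite addr0.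
Qed.

Lemma tfZ U c v dv : tf U v dv -> tf U (fun x => c * v x) (fun i x => c * dv i x).
Proof.
move=> [cv [K [cK KU vK]]]; split; first exact: C1Z.
by exists K; split=> // x /vK ->; rewrite mulr0.
Qed.

Lemma tf0 U : tf U (fun=> 0) (fun _ _ => 0).
Proof. by split; [exact: C1_cst|exists set0; split=> //; exact: compact0]. Qed.

Lemma tf_shift v dv (h : V) : tf setT v dv ->
  tf setT (fun x => v (x + h)) (fun i x => dv i (x + h)).
Proof.
move=> [cv [K [cK _ vK]]]; split; first exact: C1_shift.
have [M KM] := compact_sub_cball cK.
exists (cball (M + `|h|)); split=> //; first exact: compact_cball.
move=> x; apply: contra_notP => vx; have /KM : K (x + h) by apply: contrapT => /vK.
rewrite /cball/= => xh; rewrite -[x](addrK h) (le_trans (ler_normB _ _))// lerD2r//.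
Qed.

(** The norm is the sup norm, so balls are cubes and a product of one-variable bumps works; the
    factor b is 1 on [-M, M] and 0 outside [-M - 1, M + 1]. *)
Lemma bump_exists (M : R) : 0 <= M -> exists chi dchi, [/\ tf setT chi dchi,
  forall x, 0 <= chi x <= 1, forall x, cball M x -> chi x = 1 &
  forall x, ~ cball (M + 1) x -> chi x = 0].
Proof.
move=> M0; pose b (s : R) := smoothstep (M + 1 - s) * smoothstep (M + 1 + s).
pose chi (x : V) := \prod_(i < d) b (x ord0 i).
have cb : exists dchi, C1 chi dchi.
  apply: C1_prod => k.
  have ck := @C1_coord R d k; have cc := @C1_cst R d (M + 1).
  have C1s := C1_comp (@is_derive_smoothstep R) (@dsmoothstep_continuous R).
  by eexists; exact: C1M (C1s _ _ _ (C1B cc ck)) (C1s _ _ _ (C1D cc ck)).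
have b01 s : 0 <= b s <= 1.
  have /andP[h1 h2] := smoothstep_itv (M + 1 - s); have /andP[h3 h4] := smoothstep_itv (M + 1 + s).
  by rewrite /b mulr_ge0//= mulr_ile1.
have chi0 x : ~ cball (M + 1) x -> chi x = 0.
  move=> /negP; rewrite /cball/= -ltNge => xM.
  have [i xi] : exists i, M + 1 < `|x ord0 i|.
    apply: contrapT => h; move: xM; rewrite ltNge => /negP; apply.
    rewrite leNgt; apply/negP => xM; apply: h; apply: contrapT => h.
    have : `|x| < `|x|; last by rewrite ltxx.
    apply: norm_lt_coord; first by rewrite (lt_trans _ xM)// ltr_wpDl.
    by move=> i; rewrite (le_lt_trans _ xM)// leNgt; apply/negP => xi; apply: h; exists i.
  apply/eqP; rewrite prodf_seq_eq0; apply/hasP; exists i; first by rewrite mem_index_enum.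
  rewrite /= /b mulf_eq0; move: xi; rewrite ltr_normr => /orP[xi|xi].
    by rewrite smoothstep_le0 ?eqxx// subr_le0 ltW.
  apply/orP; right; apply/eqP; apply: smoothstep_le0.
  have aux (y : R) : M + 1 < - y -> M + 1 + y <= 0 by lra.
  exact: aux.
have [dchi cchi] := cb; exists chi, dchi; split=> //.
- by split=> //; exists (cball (M + 1)); split=> //; exact: compact_cball.
- move=> x; rewrite prodr_ge0/=; last by move=> i _; have /andP[] := b01 (x ord0 i).
  rewrite [leRHS](_ : 1 = \prod_(i < d) 1); last by rewrite big1.
  by apply: ler_prod => i _; exact: b01.
- move=> x xM; apply: big1 => i _.
  have := le_trans (coord_le_norm x i) xM; rewrite ler_norml => /andP[h1 h2].
  by rewrite /b !smoothstep_ge1 ?mulr1//; lra.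
Qed.

(** Local integrability, tested on balls: it covers square integrable functions as well as
    constants, to which [is_derive_shift_int] is also applied. *)
Definition loc v := measurable_fun setT v /\ forall M, intg (fun x => v x * \1_(cball M) x).

Lemma Lfun2_loc v : v \in L2T -> loc v.
Proof.
move=> lv; split=> [|M]; first exact: Lfun2_meas lv.
by apply: Lfun2_intM => //; apply: indic_Lfun2; [exact: measurable_cball|exact: bounded_cball].
Qed.

Lemma cst_loc c : loc (fun=> c).
Proof.
split=> // M; apply: intgZ; apply: indic_intg; [exact: measurable_cball|exact: bounded_cball].
Qed.

Lemma intg_compact_supp v w M : loc v -> continuous w ->
  (forall x, ~ cball M x -> w x = 0) -> intg (fun x => v x * w x).
Proof.
move=> [mv iv] cw w0; have [c c0 wc] := compact_supp_bounded cw (@compact_cball M) w0.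
rewrite (_ : (fun _ => _) = fun x => w x * (v x * \1_(cball M) x)).
  by apply: intg_bddM wc (iv M); exact: continuous_measurable_rV.
apply/funext => x; rewrite indicE; case: (boolP (x \in cball M)) => [_|/negP].
  by rewrite mulr1 mulrC.
by rewrite inE => /w0 ->; rewrite mulr0 mul0r.
Qed.

Lemma is_derive_shift_int v phi dphi i (s : R) : loc v -> tf setT phi dphi ->
  is_derive s 1 (fun s => \int[mu]_x (v x * phi (x + s *: unit_rV i)))
    (\int[mu]_x (v x * dphi i (x + s *: unit_rV i))).
Proof.
move=> lv tp; have [cp [K [cK _ pK]]] := tp; have [_ cdp dpp] := cp.
have [M KM] := compact_sub_cball cK.
have p0 x : ~ cball M x -> phi x = 0 by move=> xM; apply: pK; apply: contra_not xM => /KM.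
have dp0 x : ~ cball M x -> dphi i x = 0.
  by move=> xM; exact: (partial_off_support i cp (@closed_cball M) p0).
have [c c0 dpc] := compact_supp_bounded (cdp i) (@compact_cball M) dp0.
pose e : V := unit_rV i; pose f (s : R) (x : V) := v x * phi (x + s *: e).
have der1 y (x : V) : is_derive y (1 : R) (f ^~ x) (v x * dphi i (x + y *: e)).
  apply: is_deriveZ.
  exact: is_derive_along.
have d1 y x : derive1 (f ^~ x) y = v x * dphi i (x + y *: e).
  by rewrite derive1E; case: (der1 y x).
(* A ball containing the supports of all translates phi(. + y e) with |y - s| < 1, so that g
   dominates the derivatives uniformly in y. *)
pose M' := M + (`|s| + 1) * `|e|.
pose g x := c * `|v x * \1_(cball M') x|.
have supp (w : V -> R) (y : R) x : `]s - 1, s + 1[%classic y ->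
    (forall x, ~ cball M x -> w x = 0) -> ~ cball M' x -> w (x + y *: e) = 0.
  rewrite /= in_itv/= => /andP[y1 y2] w0 xM'; apply: w0; apply: contra_not xM'.
  rewrite /cball/= /M' => xM; rewrite -[x](addrK (y *: e)) (le_trans (ler_normB _ _))//.
  rewrite lerD// normrZ ler_wpM2r// -[y](subrK s) addrC (le_trans (ler_normD _ _))// lerD2l.
  rewrite ler_norml; lra.
have ip y : `]s - 1, s + 1[%classic y -> intg (f y).
  move=> sy; apply: (@intg_compact_supp _ _ M') => //; last by move=> x; exact: supp.
  by have [] := tf_shift (y *: e) tp => -[].
have := @cvg_differentiation_under_integral R _ _ mu f setT measurableT s (s - 1) (s + 1).
rewrite /= in_itv/= gtrBl ltrDl ltr01 => /(_ isT).
have ex y x : derivable (f ^~ x) y 1 by case: (der1 y x).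
move=> /(_ ip (fun y x _ _ => ex y x) g).
move=> /(_ (fun x => mulr_ge0 c0 (normr_ge0 _))).
have ig : intg g by apply: intgZ; have := integrable_norm (lv.2 M'); apply: eq_integrable.
move=> /(_ ig) H.
have {}H : h^-1 *: (\int[mu]_y f (h + s) y - \int[mu]_y f s y) @[h --> 0^'] -->
   \int[mu]_x (v x * dphi i (x + s *: e)).
  rewrite (_ : \int[mu]_x (v x * _) = \int[mu]_y partial1of2 f s y); last first.
    by apply: eq_Rintegral => y _; rewrite /partial1of2 d1.
  apply: H => y x sy _; rewrite /partial1of2 d1 /g indicE.
  case: (boolP (x \in cball M')) => [_|/negP].
    by rewrite mulr1 normrM mulrC ler_wpM2r.
  rewrite inE => xM'; rewrite (supp (dphi i))// ?mulr0 ?normr0 ?mulr0//.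
apply: DeriveDef.
  by apply/cvg_ex; eexists; under eq_fun do rewrite scaler1; exact: H.
by rewrite /derive; under eq_fun do rewrite scaler1; apply: cvg_lim.
Qed.

End compact_support.

Section density.
Context {R : realType} {d : nat}.
Notation V := 'rV[R]_d.
Notation mu := (lebesgue_rV R d).
Notation L2T := (Lfun mu 2%:E).
Implicit Types (v w psi : V -> R) (A : set V).

Section smooth_approximation_of_sets.
Variable M : R.
(** The error is measured on a ball because the approximable sets must be closed under complement:
    neither their indicators nor the functions psi are square integrable on the whole space. *)
Let B : V -> R := \1_(cball M).

Let lB : B \in L2T.
Proof. by apply: indic_Lfun2; [exact: measurable_cball|exact: bounded_cball]. Qed.

Let lMB v c : measurable_fun setT v -> (forall x, `|v x| <= c) -> (fun x => v x * B x) \in L2T.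
Proof. by move=> mv vc; exact: Lfun2_bddM vc lB. Qed.

(* The sets with this property form a sigma-algebra that contains the half
   spaces [a < x i], hence all Borel sets. *)
Let approx A : Prop := measurable A /\ forall e, 0 < e -> exists psi,
  [/\ exists dpsi, C1 psi dpsi, forall x, 0 <= psi x <= 1 &
      nrm mu (fun x => (\1_A x - psi x) * B x) < e].

Let diff_bdd A psi x : 0 <= psi x <= 1 -> `|\1_A x - psi x| <= 1.
Proof.
move=> /andP[p0 p1]; rewrite indicE; case: (x \in A); rewrite /= ler_norml; lra.
Qed.

Let l2_diff A psi : measurable A -> (exists dpsi, C1 psi dpsi) ->
  (forall x, 0 <= psi x <= 1) -> (fun x => (\1_A x - psi x) * B x) \in L2T.
Proof.
move=> mA [dpsi [cpsi _ _]] p01; apply: (@lMB _ 1); last by move=> x; exact: diff_bdd.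
by apply: measurable_funB => //; exact: continuous_measurable_rV.
Qed.

Let approx0 : approx set0.
Proof.
split=> // e e0; exists (fun=> 0); split.
- by exists (fun _ _ => 0); exact: C1_cst.
- by move=> x; rewrite lexx ler01.
- rewrite /nrm /dot (_ : Rintegral _ _ _ = 0) ?sqrtr0//.
  by under eq_Rintegral do rewrite indic0 subr0 mul0r mul0r; rewrite Rintegral_cst// mul0r.
Qed.

Let approxC A : approx A -> approx (~` A).
Proof.
move=> [mA hA]; split; first exact: measurableC.
move=> e /hA[psi [[dpsi cp] p01 pe]]; exists (fun x => 1 - psi x); split.
- by eexists; exact: C1B (C1_cst 1) cp.
- by move=> x; have := p01 x; lra.
- rewrite (le_lt_trans _ pe)// /nrm /dot ler_wsqrtr// le_eqVlt; apply/orP; left; apply/eqP.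
  by apply: eq_Rintegral => x _; rewrite !indicE in_setC; case: (x \in A) => /=; ring.
Qed.

Let approxU A A' : approx A -> approx A' -> approx (A `|` A').
Proof.
move=> [mA hA] [mA' hA']; split; first exact: measurableU.
move=> e e0; have e20 : 0 < e / 2 by rewrite divr_gt0.
have [psi [[dpsi cp] p01 pe]] := hA _ e20.
have [psi' [[dpsi' cp'] p01' pe']] := hA' _ e20.
(* The same polynomial expresses the indicator of a union by the two indicators, and the difference
   of the two values splits into the two given errors with factors in [0, 1]. *)
exists (fun x => 1 - (1 - psi x) * (1 - psi' x)); split.
- by eexists; exact: C1B (C1_cst 1) (C1M (C1B (C1_cst 1) cp) (C1B (C1_cst 1) cp')).
- move=> x; have /andP[] := p01 x; have /andP[] := p01' x => *; apply/andP; split; nra.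
have l1 : (fun x => `|(\1_A x - psi x) * B x|) \in L2T.
  have l := l2_diff mA (ex_intro _ _ cp) p01.
  by apply: (le_Lfun2 _ l) => [|x]; [apply: measurableT_comp => //; exact: Lfun2_meas l|rewrite normr_id].
have l2 : (fun x => `|(\1_A' x - psi' x) * B x|) \in L2T.
  have l := l2_diff mA' (ex_intro _ _ cp') p01'.
  by apply: (le_Lfun2 _ l) => [|x]; [apply: measurableT_comp => //; exact: Lfun2_meas l|rewrite normr_id].
have E v : nrm mu (fun x => `|v x|) = nrm mu v.
  by congr Num.sqrt; apply: eq_Rintegral => x _; rewrite -!expr2 real_normK ?num_real.
rewrite [e]splitr (le_lt_trans _ (ltrD pe pe'))//.
rewrite -(E (fun x => _)) -[X in X + _]E -[X in _ + X]E (le_trans _ (ler_nrmD l1 l2))//.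
rewrite E; apply: le_nrm.
- apply: l2_diff; first exact: measurableU.
    by eexists; exact: C1B (C1_cst 1) (C1M (C1B (C1_cst 1) cp) (C1B (C1_cst 1) cp')).
  by move=> x; have /andP[] := p01 x; have /andP[] := p01' x => *; apply/andP; split; nra.
- exact: Lfun2D.
move=> x; rewrite [leRHS]ger0_norm ?addr_ge0// !normrM -mulrDl ler_wpM2r//.
have -> : \1_(A `|` A') x = 1 - (1 - \1_A x) * (1 - \1_A' x) :> R.
  by rewrite !indicE in_setU; case: (x \in A); case: (x \in A') => /=; ring.
have -> : 1 - (1 - \1_A x) * (1 - \1_A' x) - (1 - (1 - psi x) * (1 - psi' x)) =
  (1 - psi' x) * (\1_A x - psi x) + (1 - \1_A x) * (\1_A' x - psi' x) :> R by ring.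
rewrite (le_trans (ler_normD _ _))// !normrM lerD// ler_piMl//.
  by have /andP[] := p01' x => *; rewrite ger0_norm; lra.
by rewrite indicE; case: (x \in A); rewrite /= ?subrr ?normr0 ?subr0 ?normr1.
Qed.

(** Finite unions are approximable, and their indicators converge pointwise to that of the countable
    union with majorant B, hence in L^2 on the ball. *)
Let approx_bigcup (F : nat -> set V) : (forall n, approx (F n)) -> approx (\bigcup_n F n).
Proof.
move=> aF; have mU : measurable (\bigcup_n F n) by apply: bigcupT_measurable => n; case: (aF n).
split=> // e e0.
pose U n := \big[setU/set0]_(k < n) F k.
have aU n : approx (U n).
  by elim: n => [|n ih]; rewrite /U ?big_ord0// big_ord_recr/=; exact: approxU.
have mB : measurable_fun setT B by exact: Lfun2_meas lB.
have UB : (fun n => nrm mu (fun x => \1_(U n) x * B x - \1_(\bigcup_n F n) x * B x)) @ \oo --> (0 : R).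
apply: (@dominated_cvg_nrm _ _ _ mu _ _ B) => //.
- by move=> n; apply: measurable_funM => //; apply: measurable_indic; case: (aU n).
- by apply: measurable_funM => //; exact: measurable_indic.
- move=> x; apply: cvgM; last exact: cvg_cst.
  rewrite indicE; case: (boolP (x \in _)) => [/set_mem[N _ FNx]|/negP xF].
    apply: cvg_near_cst; exists N.+1 => //= n Nn.
    by rewrite indicE mem_set// /U -(bigcup_mkord n F); exists N.
  apply: cvg_near_cst; apply: nearW => n; rewrite indicE memNset//.
  by rewrite /U -(bigcup_mkord n F) => -[k _ Fk]; apply: xF; rewrite inE; exists k.
- move=> n x; rewrite normrM [X in _ * X]ger0_norm ?indic_ge0// ler_piMl ?indic_ge0//.
  by rewrite indicE; case: (x \in _); rewrite ?normr1 ?normr0.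
move/cvgrPdist_lt : UB => /(_ (e / 2)); rewrite divr_gt0// => /(_ isT)[N _ /(_ N (leqnn N))/=].
rewrite sub0r normrN ger0_norm ?nrm_ge0// nrm_distC => UN.
have [psi [cp p01 pe]] := (aU N).2 (e / 2) (divr_gt0 e0 (ltr0Sn _ 1)).
exists psi; split=> //; rewrite [e]splitr (le_lt_trans _ (ltrD UN pe))//.
rewrite (le_trans _ (ler_nrmD _ _))//.
- rewrite le_eqVlt; apply/orP; left; apply/eqP; congr nrm; apply/funext => x; ring.
- have [dpsi [cpsi _ _]] := cp.
  have ind1 (A : set V) x : `|\1_A x| <= 1 :> R.
    by rewrite indicE; case: (x \in _); rewrite ?normr1 ?normr0.
  by apply: Lfun2B; apply: (@lMB _ 1) => //; apply: measurable_indic; case: (aU N).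
- by apply: l2_diff => //; case: (aU N).
Qed.

(** For fixed i the admissible sets Y of reals again form a sigma-algebra, so that open half-lines
    suffice. *)
Let approx_coord (i : 'I_d) (Y : set R) : measurable Y -> approx [set x : V | Y (x ord0 i)].
Proof.
move=> mY.
suff : measurable `<=` [set Z : set R | approx [set x : V | Z (x ord0 i)]] by apply.
rewrite [X in X `<=` _](RGenOInfty.measurableE R).
apply: smallest_sub.
  split=> /=.
  - exact: approx0.
  - move=> Z aZ; have := approxC aZ.
    by congr approx; apply/seteqP; split=> x /=; tauto.
  - move=> F aF; rewrite (_ : mkset _ = \bigcup_n [set x : V | F n (x ord0 i)]).
      exact: approx_bigcup.
    by apply/seteqP; split.
move=> _ [a ->] /=.
set A := (X in approx X).
have mA : measurable A by apply: (@measurable_coord R d i `]a, +oo[%classic); exact: measurable_itv.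
split=> // e e0.
(* Steepening ramps that vanish for x_i <= a and equal 1 once x_i - a >= 1 / n; they converge
   pointwise to the indicator of the open half space. *)
pose psi n (x : V) : R := smoothstep (n%:R * (x ord0 i - a)).
have cpsi n : exists dpsi, C1 (psi n) dpsi.
  have C1s := C1_comp (@is_derive_smoothstep R) (@dsmoothstep_continuous R).
  by eexists; exact: C1s (C1Z n%:R (C1B (C1_coord i) (C1_cst a))).
have p01 n x : 0 <= psi n x <= 1 by exact: smoothstep_itv.
have mB : measurable_fun setT B by exact: Lfun2_meas lB.
have UB : (fun n => nrm mu (fun x => psi n x * B x - \1_A x * B x)) @ \oo --> (0 : R).
apply: (@dominated_cvg_nrm _ _ _ mu _ _ B) => //.
- move=> n; apply: measurable_funM => //; have [dpsi [cp _ _]] := cpsi n.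
  exact: continuous_measurable_rV.
- by apply: measurable_funM => //; exact: measurable_indic.
- move=> x; apply: cvgM; last exact: cvg_cst.
  rewrite indicE; case: (boolP (x \in A)).
    rewrite inE /A/= in_itv/= andbT => ax.
    apply: cvg_near_cst; have xa : 0 < x ord0 i - a by rewrite subr_gt0.
    exists (Num.trunc (x ord0 i - a)^-1).+1 => //= n Nn; rewrite /psi smoothstep_ge1//.
    by rewrite -ler_pdivrMr// div1r ltW// (lt_le_trans (truncnS_gt _))// ler_nat; exact: Nn.
  move=> /negP; rewrite inE /A/= in_itv/= andbT => /negP; rewrite -leNgt => xa.
  apply: cvg_near_cst; apply: nearW => n; rewrite /psi smoothstep_le0//.
  by rewrite mulr_ge0_le0// subr_le0.
- move=> n x; rewrite normrM [X in _ * X]ger0_norm ?indic_ge0// ler_piMl ?indic_ge0//.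
  by have /andP[? ?] := p01 n x; rewrite ger0_norm.
move/cvgrPdist_lt : UB => /(_ e e0)[N _ /(_ N (leqnn N))/=].
rewrite sub0r normrN ger0_norm ?nrm_ge0// => UN.
exists (psi N); split=> //; rewrite nrm_distC in UN.
rewrite (le_lt_trans _ UN)// le_eqVlt; apply/orP; left; apply/eqP.
by congr nrm; apply/funext => x; ring.
Qed.

Lemma smooth_approx_set A : measurable A -> forall e, 0 < e -> exists psi,
  [/\ exists dpsi, C1 psi dpsi, forall x, 0 <= psi x <= 1 &
      nrm mu (fun x => (\1_A x - psi x) * \1_(cball M) x) < e].
Proof.
suff H : @borel_rV R d `<=` approx by move=> mA; exact: (H _ mA).2.
apply: smallest_sub.
  split=> /=; first exact: approx0.
  - by move=> A' aA'; rewrite setTD; exact: approxC.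
  - by move=> F aF; exact: approx_bigcup.
by move=> A'; rewrite -bigcup_seq => -[i _ [Y mY <-]]; rewrite setTI; exact: approx_coord.
Qed.

End smooth_approximation_of_sets.

Let dense w : Prop := w \in L2T /\ forall e, 0 < e -> exists phi dphi,
  tf setT phi dphi /\ nrm mu (fun x => w x - phi x) < e.

Let dense_indic A M : 0 <= M -> measurable A -> dense (\1_(A `&` cball M)).
Proof.
move=> M0 mA.
have mAM : measurable (A `&` cball M) by apply: measurableI => //; exact: measurable_cball.
have lA : \1_(A `&` cball M) \in L2T.
  apply: indic_Lfun2 => //; have [N [? NM]] := @bounded_cball R d M.
  by exists N; split=> // x Nx y [_ My]; exact: NM My.
split=> // e e0.
have [chi [dchi [tchi c01 c1 c0]]] := @bump_exists R d M M0.
(* The set approximated is already cut to radius M while the error is measured up to radius M + 1.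
   Hence psi is small on the shell where chi falls from 1 to 0, and multiplication by chi does not
   increase the error. *)
have [psi [[dpsi cp] p01 pe]] := smooth_approx_set (M + 1) mAM e0.
exists (fun x => psi x * chi x); eexists; split; first exact: tfMl cp tchi.
have lB : \1_(cball (M + 1)) \in L2T by apply: indic_Lfun2; [exact: measurable_cball|exact: bounded_cball].
apply: le_lt_trans pe; apply: le_nrm.
- by apply: Lfun2B => //; exact: tf_Lfun2 (tfMl cp tchi).
- apply: (@Lfun2_bddM _ _ _ _ 1) => //.
    by apply: measurable_funB => //; apply: continuous_measurable_rV; case: cp.
  move=> x; have := p01 x; rewrite indicE; case: (x \in _) => /= /andP[? ?]; rewrite ler_norml; lra.
move=> x; rewrite !indicE.
have [xM|xM] := pselect (cball (M + 1) x); last first.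
  by rewrite c0// memNset ?mulr0 ?subrr ?normr0// => -[_]; rewrite /cball/= => xM'; apply: xM; rewrite /cball/= (le_trans xM')// lerDl.
rewrite (mem_set xM) mulr1.
have [xM'|xM'] := pselect (cball M x); first by rewrite c1// mulr1.
rewrite memNset ?sub0r ?normrN ?normrM; last by move=> -[].
by have /andP[? ?] := c01 x; rewrite ler_piMr// ger0_norm.
Qed.

Let dense0 : dense (fun=> 0).
Proof.
split=> [|e e0]; first exact: Lfun2_0.
exists (fun=> 0), (fun _ _ => 0); split; first exact: tf0.
rewrite /nrm /dot (_ : Rintegral _ _ _ = 0) ?sqrtr0//.
by under eq_Rintegral do rewrite subr0 mul0r; rewrite Rintegral_cst// mul0r.
Qed.

Let denseD v w : dense v -> dense w -> dense (fun x => v x + w x).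
Proof.
move=> [lv hv] [lw hw]; split=> [|e e0]; first exact: Lfun2D.
have [p [dp [tp pe]]] := hv _ (divr_gt0 e0 (ltr0Sn _ 1)).
have [q [dq [tq qe]]] := hw _ (divr_gt0 e0 (ltr0Sn _ 1)).
exists (fun x => p x + q x); eexists; split; first exact: tfD tp tq.
rewrite [e]splitr (le_lt_trans _ (ltrD pe qe))// (le_trans _ (ler_nrmD _ _))//.
- by rewrite le_eqVlt; apply/orP; left; apply/eqP; congr nrm; apply/funext => x; ring.
- by apply: Lfun2B => //; exact: tf_Lfun2 tp.
- by apply: Lfun2B => //; exact: tf_Lfun2 tq.
Qed.

Let denseZ c v : dense v -> dense (fun x => c * v x).
Proof.
move=> [lv hv]; split=> [|e e0]; first exact: Lfun2Z.
have c0 : 0 < `|c| + 1 by rewrite ltr_wpDl.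
have [p [dp [tp pe]]] := hv _ (divr_gt0 e0 c0).
exists (fun x => c * p x); eexists; split; first exact: tfZ tp.
rewrite (_ : (fun _ => _) = fun x => c * (v x - p x)); last by apply/funext => x; ring.
rewrite nrmZ; last by apply: Lfun2B => //; exact: tf_Lfun2 tp.
rewrite ltr_pdivlMr// in pe; rewrite (le_lt_trans _ pe)// mulrC ler_wpM2l ?nrm_ge0//.
by rewrite lerDl.
Qed.

Let dense_lim (w_ : (V -> R)^nat) w : (forall n, dense (w_ n)) -> w \in L2T ->
  (fun n => nrm mu (fun x => w_ n x - w x)) @ \oo --> 0 -> dense w.
Proof.
move=> dw_ lw ww; split=> // e e0; have e2 : 0 < e / 2 by rewrite divr_gt0.
move/cvgrPdist_lt : ww => /(_ _ e2)[N _ /(_ N (leqnn N))/=].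
rewrite sub0r normrN ger0_norm ?nrm_ge0// nrm_distC => UN.
have [p [dp [tp pe]]] := (dw_ N).2 _ e2.
exists p, dp; split=> //; rewrite [e]splitr (le_lt_trans _ (ltrD UN pe))//.
rewrite (le_trans _ (ler_nrmD _ _))//.
- by rewrite le_eqVlt; apply/orP; left; apply/eqP; congr nrm; apply/funext => x; ring.
- by apply: Lfun2B => //; have [] := dw_ N.
- by apply: Lfun2B => //; [have [] := dw_ N|exact: tf_Lfun2 tp].
Qed.

Import HBNNSimple.

Let dense_nnsfun (f : {nnsfun V >-> R}) M : 0 <= M -> dense (fun x => f x * \1_(cball M) x).
Proof.
move=> M0.
rewrite (_ : (fun _ => _) =
  fun x => \sum_(y <- finmap.enum_fset (fset_set (range f))) (y * \1_(f @^-1` [set y] `&` cball M) x)); last first.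
  apply/funext => x; rewrite fimfunE fsbig_finite//= mulr_suml.
  by apply: eq_bigr => y _; rewrite indicI mulrA.
elim: (finmap.enum_fset _) => [|y s ih].
  by under eq_fun do rewrite big_nil; exact: dense0.
under eq_fun do rewrite big_cons.
by apply: denseD => //; apply: denseZ; apply: dense_indic.
Qed.

(** Simple functions increasing to w, cut off to growing balls, converge in L^2 because w dominates
    them. *)
Let dense_ge0 w : w \in L2T -> (forall x, 0 <= w x) -> dense w.
Proof.
move=> lw w0; have mw := Lfun2_meas lw.
have mw' : measurable_fun setT (EFin \o w) by exact/measurable_EFinP.
pose f := nnsfun_approx measurableT mw'.
apply: (@dense_lim (fun n x => f n x * \1_(cball n%:R) x)) => //.
  by move=> n; apply: dense_nnsfun.
have fw n x : f n x <= w x.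
  rewrite -lee_fin /f nnsfun_approxE; apply: le_approx => //.
  by move=> y _ /=; rewrite lee_fin.
apply: (@dominated_cvg_nrm _ _ _ mu _ _ w) => //.
- move=> n; apply: measurable_funM => //; apply: measurable_indic; exact: measurable_cball.
- move=> x; rewrite -[X in _ --> X]mulr1; apply: cvgM.
    have /fine_cvg : EFin \o f^~ x @ \oo --> (w x)%:E.
      by apply: cvg_nnsfun_approx => // y _ /=; rewrite lee_fin.
    exact.
  apply: cvg_near_cst; exists (Num.trunc `|x|).+1 => //= n Nn; rewrite indicE mem_set//.
  by rewrite /cball/= ltW// (lt_le_trans (truncnS_gt _))// ler_nat; exact: Nn.
- move=> n x; rewrite normrM [X in _ * X]ger0_norm ?indic_ge0//.
  rewrite (le_trans (ler_piMr _ _))// ?indicE ?lern1 ?leq_b1//.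
  by rewrite ger0_norm.
Qed.

Lemma tf_dense w : w \in L2T -> forall e, 0 < e -> exists phi dphi,
  tf setT phi dphi /\ nrm mu (fun x => w x - phi x) < e.
Proof.
move=> lw; suff [] : dense w by [].
have lp : (fun x => Num.max (w x) 0) \in L2T.
  apply: (le_Lfun2 _ lw); first by apply: measurable_maxr => //; exact: Lfun2_meas lw.
  by move=> x; case: (leP (w x) 0) => h; rewrite ?normr0.
have ln : (fun x => Num.max (- w x) 0) \in L2T.
  apply: (le_Lfun2 _ lw).
    by apply: measurable_maxr => //; apply: measurableT_comp => //; exact: Lfun2_meas lw.
  by move=> x; case: (leP (- w x) 0) => h; rewrite ?normr0// normrN.
rewrite (_ : w = fun x => Num.max (w x) 0 + -1 * Num.max (- w x) 0); last first.
  by apply/funext => x; case: (leP (w x) 0); case: (leP (- w x) 0) => *; lra.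
apply: denseD; last apply: denseZ; apply: dense_ge0 => // x; rewrite le_max lexx orbT//.
Qed.

End density.

(** * Integration by parts for weak derivatives on R^d *)

Section weak_derivative.
Context {R : realType} {d : nat}.
Notation V := 'rV[R]_d.
Notation mu := (lebesgue_rV R d).
Notation L2T := (Lfun mu 2%:E).
Notation dot := (dot mu).
Notation nrm := (nrm mu).
Implicit Types (v w phi : V -> R) (i : 'I_d) (s : R).

(** By translation invariance the integral of phi(. + s e_i) is constant in s; its derivative at s =
    0 is the integral of the partial derivative. *)
Lemma int_partial0 phi dphi i : tf setT phi dphi -> \int[mu]_x dphi i x = 0.
Proof.
move=> tp; have [_] := is_derive_shift_int i 0 (cst_loc 1) tp.
under eq_Rintegral do rewrite scale0r addr0 mul1r.
move=> <-; rewrite (_ : (fun s => _) = cst (\int[mu]_x phi x)).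
  exact: derive_cst.
apply/funext => s; rewrite -(Rintegral_shift (s *: unit_rV i) (tf_intg tp)).
by apply: eq_Rintegral => x _; rewrite mul1r.
Qed.

Definition wderiv i v v' : Prop := forall phi dphi, tf setT phi dphi ->
  dot v (dphi i) = - dot v' phi.

Section difference_quotients.
Variables (i : 'I_d) (v v' : V -> R).
Hypotheses (lv : v \in L2T) (lv' : v' \in L2T) (vv' : wderiv i v v').
Let e : V := unit_rV i.
Let incr s w := dot v (fun x => w (x + s *: e)) - dot v w.

Let is_derive_incr phi dphi s : tf setT phi dphi ->
  is_derive s (1 : R) (fun s => incr s phi) (- dot v' (fun x => phi (x + s *: e))).
Proof.
move=> tp; rewrite -(vv' (tf_shift (s *: e) tp)).
have h := is_derive_shift_int i s (Lfun2_loc lv) tp.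
rewrite -[X in is_derive _ _ _ X]subr0.
exact: (is_deriveB _ _).
Qed.

(** Mean value theorem in s. The bound involves the norm of phi but not that of its gradient, which
    is why it survives the passage from test functions to all of L^2. *)
Let incr_tf_le phi dphi s : tf setT phi dphi ->
  `|incr s phi| <= `|s| * (nrm v' * nrm phi).
Proof.
move=> tp; pose c s := incr s phi.
have c0 : c 0 = 0.
  by rewrite /c /incr (_ : (fun x => _) = phi) ?subrr//; apply/funext => x; rewrite scale0r addr0.
have dc (t : R) := is_derive_incr t tp.
have cc : continuous c.
  by move=> t; apply: differentiable_continuous; apply/derivable1_diffP; case: (dc t).
have bd t : `|- dot v' (fun x => phi (x + t *: e))| <= nrm v' * nrm phi.
  rewrite normrN (le_trans (normr_dot lv' _))//; first exact: tf_Lfun2 (tf_shift _ tp).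
  by rewrite nrm_shift//; exact: tf_Lfun2 tp.
have [s0|s0] := leP 0 s.
  have [x _] := MVT_segment s0 (fun t _ => dc t) (continuous_subspaceT cc).
  rewrite -/(c 0) -/(c s) c0 !subr0 => ->.
  by rewrite normrM mulrC ler_wpM2l.
have [x _] := MVT_segment (ltW s0) (fun t _ => dc t) (continuous_subspaceT cc).
rewrite -/(c 0) -/(c s) c0 sub0r => /eqP; rewrite eqr_oppLR => /eqP ->.
by rewrite normrN normrM mulrC sub0r normrN ler_wpM2l.
Qed.

Let incrB w w' s : w \in L2T -> w' \in L2T ->
  incr s w = incr s (fun x => w x - w' x) + incr s w'.
Proof.
move=> lw lw'; have lsw := Lfun2_shift (s *: e) lw; have lsw' := Lfun2_shift (s *: e) lw'.
by rewrite /incr dotBr// dotBr//; ring.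
Qed.

(** Not small in s, but valid for every w in L^2; it controls the approximation error in the density
    argument at fixed s. *)
Let incr_crude w s : w \in L2T -> `|incr s w| <= 2 * nrm v * nrm w.
Proof.
move=> lw; rewrite (le_trans (ler_normB _ _))//.
have := normr_dot lv (Lfun2_shift (s *: e) lw); rewrite nrm_shift//.
have := normr_dot lv lw; lra.
Qed.

Let incr_le w s : w \in L2T -> `|incr s w| <= `|s| * (nrm v' * nrm w).
Proof.
move=> lw; apply/ler_addgt0Pr => a a0.
(* Replacing w by p costs 2 |v| n through [incr_crude] and |s| |v'| n through the change of norm,
   where n = |w - p|; the summand 1 keeps c positive. *)
pose c := 2 * nrm v + `|s| * nrm v' + 1.
have c0 : 0 < c by rewrite ltr_wpDl// addr_ge0// mulr_ge0// ?nrm_ge0.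
have [p [dp [tp pe]]] := tf_dense lw (divr_gt0 a0 c0).
have lp := tf_Lfun2 tp; have lwp := Lfun2B lw lp.
rewrite (incrB s lw lp) (le_trans (ler_normD _ _))//.
have h1 := incr_crude s lwp; have h2 := incr_tf_le s tp.
have h3 : nrm p <= nrm w + nrm (fun x => w x - p x).
  rewrite [X in nrm X <= _](_ : p = fun x => w x + (p x - w x)).
    rewrite (nrm_distC _ w); apply: ler_nrmD => //; exact: Lfun2B.
  by apply/funext => x; ring.
set n := nrm (fun x => w x - p x) in pe h1 h3; have n0 : 0 <= n by exact: nrm_ge0.
have h4 : `|s| * (nrm v' * nrm p) <= `|s| * (nrm v' * nrm w) + `|s| * nrm v' * n.
  by rewrite -mulrA -mulrDr -mulrDr ler_wpM2l// ler_wpM2l// nrm_ge0.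
have h5 : c * n <= a by rewrite mulrC -ler_pdivlMr// ltW.
have h6 : c * n = 2 * nrm v * n + `|s| * nrm v' * n + n by rewrite /c; ring.
lra.
Qed.

(** For a test function p this is [is_derive_incr] at 0. Passing from w to p costs |v'| |w - p| in
    the quotient, uniformly in s by [incr_le], and as much again in the limit; hence c = 2 |v'| +
    1. *)
Lemma diff_quotient w a : w \in L2T -> 0 < a -> exists2 del : R, 0 < del &
  forall s, s != 0 -> `|s| < del ->
  `|(dot v (fun x => w (x + s *: e)) - dot v w) / s + dot v' w| <= a.
Proof.
move=> lw a0; pose c := 2 * nrm v' + 1.
have c0 : 0 < c by rewrite ltr_wpDl// mulr_ge0// nrm_ge0.
have a2 : 0 < a / 2 by rewrite divr_gt0.
have [p [dp [tp pe]]] := tf_dense lw (divr_gt0 a2 c0).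
have lp := tf_Lfun2 tp; have lwp := Lfun2B lw lp.
have [dd dE] := is_derive_incr 0 tp.
have : h^-1 *: (incr (h *: 1 + 0) p - incr 0 p) @[h --> (0:R)^'] -->
    - dot v' (fun x => p (x + 0 *: e)) by rewrite -dE; exact: dd.
rewrite (_ : (fun x => p (x + 0 *: e)) = p); last by apply/funext => x; rewrite scale0r addr0.
have -> : incr 0 p = 0.
  by rewrite /incr (_ : (fun x => _) = p) ?subrr//; apply/funext => x; rewrite scale0r addr0.
move=> /cvgrPdist_le/(_ _ a2)/nbhs_ballP[del /= del0 H].
exists del => // s s0 sdel.
have := H s; rewrite /ball/= sub0r normrN => /(_ sdel s0).
rewrite subr0 addr0 (_ : s *: 1 = s); last exact: mulr1.
rewrite -normrN opprB opprK => {}H.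
rewrite -/(incr s w) (incrB s lw lp) mulrDl.
have -> : dot v' w = dot v' (fun x => w x - p x) + dot v' p by rewrite dotBr//; ring.
rewrite addrACA (le_trans (ler_normD _ _))// [leRHS]splitr lerD//; last by rewrite mulrC.
have h1 := incr_le s lwp; have h2 := normr_dot lv' lwp.
rewrite (le_trans (ler_normD _ _))//.
have h3 : `|incr s (fun x => w x - p x) / s| <= nrm v' * nrm (fun x => w x - p x).
  by rewrite normrM normfV ler_pdivrMr ?normr_gt0// mulrC.
set n := nrm (fun x => w x - p x) in pe h2 h3; have n0 : 0 <= n by exact: nrm_ge0.
have h5 : c * n <= a / 2 by rewrite mulrC -ler_pdivlMr// ltW.
have h6 : c * n = 2 * (nrm v' * n) + n by rewrite /c; ring.
lra.
Qed.

End difference_quotients.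

(* The difference quotient at 0 of s |-> dot v (w (. + s e_i)) converges both
   to - dot v' w and, after a translation, to dot v w'. *)
Lemma wderiv_by_parts i v v' w w' : v \in L2T -> v' \in L2T -> w \in L2T -> w' \in L2T ->
  wderiv i v v' -> wderiv i w w' -> dot v w' + dot v' w = 0.
Proof.
move=> lv lv' lw lw' vv' ww'; apply/eqP; rewrite -normr_le0; apply/ler_addgt0Pr => a a0.
rewrite add0r; have a2 : 0 < a / 2 by rewrite divr_gt0.
have [d1 d10 H1] := diff_quotient lv lv' vv' lw a2.
have [d2 d20 H2] := diff_quotient lw lw' ww' lv a2.
pose s := Num.min d1 d2 / 2; have s0 : 0 < s by rewrite divr_gt0// lt_min d10.
have sm : s < Num.min d1 d2 by rewrite /s ltr_pdivrMr// ltr_pMr ?ltr1n// lt_min d10.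
move: sm; rewrite lt_min => /andP[sd1 sd2].
have := H1 s; rewrite gt_eqF// gtr0_norm// => /(_ isT sd1) {}H1.
(* With the roles exchanged and the step - s, translation invariance gives the same increment
   divided by - s, that is - q; adding the two estimates eliminates q. *)
have := H2 (- s); rewrite oppr_eq0 gt_eqF// normrN gtr0_norm// => /(_ isT sd2) {}H2.
have E : dot w (fun x => v (x + - s *: unit_rV i)) = dot v (fun x => w (x + s *: unit_rV i)).
  by rewrite dotC dot_shift// scaleNr opprK.
rewrite E (dotC mu w v) (dotC mu w' v) invrN mulrN in H2.
set q := (_ / s) in H1 H2.
rewrite [X in `|X|](_ : _ = (- q + dot v w') + (q + dot v' w)); last by ring.
by rewrite (le_trans (ler_normD _ _))// [leRHS]splitr lerD.
Qed.

Definition wderiv_in (U : set V) i v v' : Prop := forall phi dphi, tf U phi dphi ->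
  dot v (dphi i) = - dot v' phi.

(** Leibniz rule: phi times chi is a test function in U. Only the products with the cut-off are
    asked to be in L^2, since a periodic v is not square integrable on the whole space. *)
Lemma wderiv_cutoff U i v v' chi dchi : tf U chi dchi -> wderiv_in U i v v' ->
  (fun x => chi x * v x) \in L2T -> (fun x => chi x * v' x) \in L2T ->
  (fun x => dchi i x * v x) \in L2T ->
  wderiv i (fun x => chi x * v x) (fun x => chi x * v' x + dchi i x * v x).
Proof.
move=> tchi vv' l1 l2 l3 phi dphi tphi.
have [cphi _] := tphi; have lphi := tf_Lfun2 tphi; have ldphi := tf_dLfun2 i tphi.
have := vv' _ _ (tfMl cphi tchi).
rewrite dotDl// opprD.
have -> : dot v (fun x => phi x * dchi i x + chi x * dphi i x) =
   dot (fun x => dchi i x * v x) phi + dot (fun x => chi x * v x) (dphi i).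
  rewrite /dot -RintegralD//; try exact: Lfun2_intM.
  by apply: eq_Rintegral => x _; ring.
have -> : dot v' (fun x => phi x * chi x) = dot (fun x => chi x * v' x) phi.
  by apply: eq_Rintegral => x _; ring.
move=> h; lra.
Qed.

(** Each factor receives its own cut-off, so that both are globally in L^2. The Neumann case takes
    the two equal; the periodic case takes th = 1 around the support of chi. *)
Lemma local_by_parts U i v v' w w' chi dchi th dth :
  tf U chi dchi -> tf U th dth -> wderiv_in U i v v' -> wderiv_in U i w w' ->
  (fun x => chi x * v x) \in L2T -> (fun x => chi x * v' x) \in L2T ->
  (fun x => dchi i x * v x) \in L2T ->
  (fun x => th x * w x) \in L2T -> (fun x => th x * w' x) \in L2T ->
  (fun x => dth i x * w x) \in L2T ->
  \int[mu]_x (chi x * th x * (v x * w' x + v' x * w x) +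
     (chi x * dth i x + th x * dchi i x) * (v x * w x)) = 0.
Proof.
move=> tc tt vv' ww' l1 l2 l3 l4 l5 l6.
have := wderiv_by_parts l1 (Lfun2D l2 l3) l4 (Lfun2D l5 l6)
  (wderiv_cutoff tc vv' l1 l2 l3) (wderiv_cutoff tt ww' l4 l5 l6).
rewrite /dot -RintegralD//; try by apply: Lfun2_intM => //; exact: Lfun2D.
by move=> <-; apply: eq_Rintegral => x _; ring.
Qed.

End weak_derivative.

(** * Green's formula, Neumann case *)

Section restriction.
Context {R : realType} {d : nat}.
Notation V := 'rV[R]_d.
Notation mu := (lebesgue_rV R d).
Notation L2T := (Lfun mu 2%:E).
Implicit Types (v w : V -> R) (U : set V).

Lemma restr_out U v x : ~ U x -> (v \_ U) x = 0.
Proof. by move=> Ux; rewrite patchE memNset. Qed.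

Lemma restr_map2 (op : R -> R -> R) U v w : op 0 0 = 0 ->
  (fun x => op (v x) (w x)) \_ U = fun x => op ((v \_ U) x) ((w \_ U) x).
Proof.
by move=> op0; apply/funext => x; rewrite !patchE; case: ifP.
Qed.

Lemma ipE U v w : ip U v w = dot mu (v \_ U) (w \_ U).
Proof.
rewrite /ip /dot Rintegral_mkcond; apply: eq_Rintegral => x _.
by rewrite (@restr_map2 *%R) ?mulr0.
Qed.

Lemma L2normE U v : L2norm U v = nrm mu (v \_ U).
Proof. by rewrite /L2norm ipE. Qed.

Lemma weak_grad_wderiv U v (g : 'I_d -> V -> R) i : weak_grad U v g ->
  wderiv_in U i (v \_ U) (g i \_ U).
Proof.
move=> vg phi dphi tp; have := vg i phi (tf_test tp).
rewrite (C1_partial i tp.1) (Rintegral_mkcond _ U (fun x => v x * _)).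
rewrite (Rintegral_mkcond _ U (fun x => g i x * _)) => h.
have off := tf_off tp.
transitivity (\int[mu]_x ((fun x => v x * dphi i x) \_ U) x).
  apply: eq_Rintegral => x _; rewrite !patchE; case: ifP => //.
  by rewrite mul0r.
rewrite h; congr (- _); apply: eq_Rintegral => x _; rewrite !patchE; case: ifP => //.
by rewrite mul0r.
Qed.

End restriction.

Lemma cvg_sum0 (R : realType) (I : Type) (r : seq I) (f : I -> nat -> R) :
  (forall i, f i @ \oo --> (0 : R)) -> (fun n => \sum_(i <- r) f i n) @ \oo --> (0 : R).
Proof.
move=> f0; elim: r => [|i r ih].
  rewrite (_ : (fun n => _) = fun=> 0); first exact: cvg_cst.
  by apply/funext => n; rewrite big_nil.
rewrite (_ : (fun n => _) = fun n => f i n + \sum_(i <- r) f i n).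
  by rewrite -[X in _ --> X]addr0; exact: cvgD.
by apply/funext => n; rewrite big_cons.
Qed.

Section neumann.
Context {R : realType} {d : nat}.
Notation V := 'rV[R]_d.
Notation mu := (lebesgue_rV R d).
Notation L2T := (Lfun mu 2%:E).
Notation dot := (dot mu).
Notation nrm := (nrm mu).
Notation intg v := (mu.-integrable setT (EFin \o v)).
Implicit Types (v w phi : V -> R).

Variable rho : V -> R.
Hypothesis adm : admissible (Neumann rho).
Let Om : set V := [set x | rho x < 0].

Let C1rho : C1 rho (partial ^~ rho).
Proof.
have [[crho h] _ _ _ _] := adm; split=> // i; first by have [_ []] := h i.
by move=> x; have [dx _] := h i; exact: DeriveDef.
Qed.

Let C1drho i : C1 (partial i rho) (partial ^~ (partial i rho)).
Proof. by have [[_ h] _ _ _ _] := adm; apply: isC_C1; have [] := h i. Qed.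

Let crho : continuous rho. Proof. by case: C1rho. Qed.

Lemma neumann_dom_open : open Om.
Proof.
rewrite (_ : Om = rho @^-1` [set y | y < 0])//.
by apply: open_comp; [move=> x _; exact: crho|exact: open_lt].
Qed.

Let compact_closure : compact (closure Om).
Proof.
have [_ _ bOm _ _] := adm.
have [M OmM] : exists M, Om `<=` cball M.
  have [M [_ /(_ (M + 1))]] := bOm; rewrite ltrDl ltr01 => /(_ isT) OM.
  by exists (M + 1).
apply: bounded_closed_compact; last exact: closed_closure.
have [N [Nr NM]] := @bounded_cball R d M.
exists N; split=> // x Nx y; rewrite closureE => Oy.
by apply: (NM _ Nx); apply: Oy; split; [exact: closed_cball|].
Qed.

Let bounded_on v : continuous v -> exists2 c, 0 <= c & forall x, Om x -> `|v x| <= c.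
Proof.
move=> cv; have [c c0 vc] := continuous_bounded_compact cv compact_closure.
by exists c => // x Ox; apply: vc; exact: subset_closure.
Qed.

Let D (x : V) : R := \sum_i partial i rho x * partial i rho x.

Let D_ge0 x : 0 <= D x. Proof. by apply: sumr_ge0 => i _; rewrite -expr2 sqr_ge0. Qed.

(** The maximum of |rho| and |grad rho|^2 is positive on the compact closure, since rho < 0 inside
    and the gradient does not vanish on the rest of it. Its minimum is the constant: where - rho
    lies below it, the maximum must be attained by |grad rho|^2. *)
Let gradient_lower_bound : exists2 c, 0 < c & forall x, Om x -> - rho x < c -> c <= D x.
Proof.
have [_ [x0 Ox0] _ _ grad] := adm.
pose m (x : V) := Num.max `|rho x| (D x).
have cm : continuous m.
  apply: cont_max; first exact: cont_norm.
  by apply: cont_sum => i; apply: contM; case: (C1drho i).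
have [c] := @compact_EVT_min _ R m (closure Om) (ex_intro _ x0 (subset_closure Ox0))
  compact_closure (continuous_subspaceT cm).
rewrite inE => clc mc; exists (m c).
  rewrite /m lt_max; have [Oc|nOc] := pselect (Om c).
    by rewrite normr_gt0 lt_eqF.
  have [i hi] := grad c (conj clc nOc).
  apply/orP; right; rewrite /D (bigD1 i)//= ltr_pwDl//.
    by rewrite -expr2 exprn_even_gt0.
  by apply: sumr_ge0 => j _; rewrite -expr2 sqr_ge0.
move=> x Ox rx; have := mc x; rewrite inE => /(_ (subset_closure Ox)).
by rewrite {2}/m le_max ltr0_norm// leNgt rx.
Qed.

(** Z is grad rho / |grad rho|^2 near the boundary; it is C^1 because rho is C^2. *)
Let transverse_field : exists c (Z : 'I_d -> V -> R) (dZ : 'I_d -> 'I_d -> V -> R),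
  [/\ 0 < c, forall i, C1 (Z i) (dZ i) &
      forall x, Om x -> - rho x < c -> \sum_i Z i x * partial i rho x = 1].
Proof.
have [c c0 Dc] := gradient_lower_bound.
have C1D' : exists dD, C1 D dD by eexists; apply: C1_sum => i; apply: C1M; exact: C1drho.
have [dD cD] := C1D'.
(* A C^1 replacement of D that never vanishes and agrees with D wherever D >= c. *)
pose E (x : V) := D x + pos_sqr (c - D x).
have cpos : continuous (fun s : R => 2 * Num.max s 0).
  by apply: contM; [exact: cst_continuous|apply: cont_max; [move=> s|exact: cst_continuous]].
have [dE cE] : exists dE, C1 E dE.
  by eexists; exact: C1D cD (C1_comp (@is_derive_pos_sqr R) cpos (C1B (C1_cst c) cD)).
have E0 x : E x != 0.
  rewrite gt_eqF// /E; have := D_ge0 x; rewrite le_eqVlt => /predU1P[<-|D0].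
    by rewrite subr0 add0r /pos_sqr max_l ?exprn_gt0// ltW.
  by rewrite ltr_pwDl// sqr_ge0.
have [dF cF] := C1V E0 cE.
exists c, (fun i x => partial i rho x * (E x)^-1).
exists (fun i j x => partial i rho x * dF j x + (E x)^-1 * partial j (partial i rho) x).
split=> // [i|x Ox rx]; first exact: C1M (C1drho i) cF.
have Dx := Dc x Ox rx.
have -> : E x = D x by rewrite /E /pos_sqr max_r ?expr0n ?addr0// subr_le0.
under eq_bigr do rewrite mulrAC.
by rewrite -mulr_suml -/(D x) divff// gt_eqF// (lt_le_trans c0).
Qed.

(* [chi n] vanishes where [- rho <= 1 / N n] and is 1 where [2 / N n <= - rho]. *)
Let N (n : nat) : R := n.+1%:R.
Let chi n (x : V) : R := smoothstep (- N n * rho x - 1).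
Let dchi n i (x : V) : R := - N n * dsmoothstep (- N n * rho x - 1) * partial i rho x.

Let N0 n : 0 < N n. Proof. by rewrite ltr0n. Qed.

Let C1chi n : C1 (chi n) (dchi n).
Proof.
have := C1_comp (@is_derive_smoothstep R) (@dsmoothstep_continuous R)
  (C1B (C1Z (- N n) C1rho) (C1_cst 1)).
congr C1; apply/funext => i; apply/funext => x.
by rewrite /dchi subr0 mulrA (mulrC (dsmoothstep _)).
Qed.

Let chi01 n x : 0 <= chi n x <= 1. Proof. exact: smoothstep_itv. Qed.

Let tfchi n : tf Om (chi n) (dchi n).
Proof.
split=> //; exists [set x | rho x <= - (N n)^-1]; split.
- have cl : closed [set x | rho x <= - (N n)^-1].
    rewrite (_ : mkset _ = rho @^-1` [set y | y <= - (N n)^-1])//.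
    by apply: closed_comp; [move=> x _; exact: crho|exact: closed_le].
  apply: (subclosed_compact cl compact_closure) => x /= xN.
  by apply: subset_closure; rewrite /Om/= (le_lt_trans xN)// oppr_lt0 invr_gt0.
- by move=> x /= xN; rewrite /Om/= (le_lt_trans xN)// oppr_lt0 invr_gt0.
- move=> x /= /negP; rewrite -ltNge => xN; apply: smoothstep_le0.
  rewrite subr_le0 mulNr -mulrN -ler_pdivlMl// mulr1 lerNl ltW//.
Qed.

Let chi_cvg x : Om x -> (fun n => chi n x) @ \oo --> (1 : R).
Proof.
move=> Ox; have rx : 0 < - rho x by rewrite oppr_gt0.
apply: cvg_near_cst; exists (Num.trunc (2 / - rho x)) => //= n Nn.
apply: smoothstep_ge1; rewrite lerBrDr mulNr -mulrN -[1 + 1]/(2%:R) -ler_pdivrMr//.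
by rewrite ltW// (lt_le_trans (truncnS_gt _))// ler_nat ltnS.
Qed.

(** The weight chi n * chi n of [local_by_parts] with equal cut-offs, shifted by a constant: the
    gradient is unchanged, but zeta n tends to 0 in the domain instead of 1. [dzeta] keeps the
    unsimplified form in which that lemma produces it. *)
Let zeta n (x : V) : R := chi n x * chi n x - 1.
Let dzeta n (i : 'I_d) (x : V) : R := chi n x * dchi n i x + chi n x * dchi n i x.

Let C1zeta n : C1 (zeta n) (dzeta n).
Proof.
have := C1B (C1M (C1chi n) (C1chi n)) (C1_cst 1).
by congr C1; apply/funext => i; apply/funext => x; rewrite subr0.
Qed.

Let zeta_le1 n x : `|zeta n x| <= 1.
Proof. by have /andP[? ?] := chi01 n x; rewrite /zeta ler_norml; apply/andP; split; nra. Qed.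

Let mzeta n : measurable_fun setT (zeta n).
Proof. by apply: continuous_measurable_rV; case: (C1zeta n). Qed.

Let zeta_L2_cvg0 v : v \in L2T -> (forall x, ~ Om x -> v x = 0) ->
  (fun n => nrm (fun x => zeta n x * v x)) @ \oo --> (0 : R).
Proof.
move=> lv v0.
have H : (fun n => nrm (fun x => zeta n x * v x - (fun=> 0) x)) @ \oo --> (0 : R).
  apply: (@dominated_cvg_nrm _ _ _ mu _ _ (fun x => `|v x|)) => //.
  - by move=> n; apply: measurable_funM => //; exact: Lfun2_meas lv.
  - apply: (le_Lfun2 _ lv) => [|x]; last by rewrite normr_id.
    by apply: measurableT_comp => //; exact: Lfun2_meas lv.
  - move=> x; have [Ox|nOx] := pselect (Om x); last first.
      by rewrite v0//; under eq_fun do rewrite mulr0; exact: cvg_cst.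
    rewrite -[X in _ --> X](mul0r (v x)); apply: cvgM; last exact: cvg_cst.
    rewrite -(subrr (1 : R)) -{1}[1]mulr1.
    by apply: cvgB; [apply: cvgM; exact: chi_cvg|exact: cvg_cst].
  - by move=> n x; rewrite normrM ler_piMl.
by under eq_fun => n do under [X in nrm X]eq_fun => x do rewrite -[zeta n x * v x]subr0.
Qed.

Let b n (x : V) : R := (chi n x + chi n x) * (- N n * dsmoothstep (- N n * rho x - 1)).

Let dzetaE n i x : dzeta n i x = b n x * partial i rho x.
Proof. by rewrite /dzeta /dchi /b; ring. Qed.

Let b_bdd n : measurable_fun setT (b n) /\ exists C, forall x, `|b n x| <= C.
Proof.
have cb : continuous (b n).
  apply: contM; first by apply: contD; case: (C1chi n).
  apply: contM; first exact: cst_continuous.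
  move=> x; apply: (@continuous_comp _ _ _ (fun x => - N n * rho x - 1) dsmoothstep).
    by apply: contB; [apply: contM => //; exact: cst_continuous|exact: cst_continuous].
  exact: dsmoothstep_continuous.
split; first exact: continuous_measurable_rV.
exists (2 * (N n * 2)) => x; rewrite !normrM normrN.
apply: ler_pM => //.
  by have /andP[? ?] := chi01 n x; rewrite ger0_norm; lra.
by rewrite (ger0_norm (ltW (N0 n))) ler_wpM2l ?dsmoothstep_bounded// ltW.
Qed.

Let bdd_on v w C : continuous v -> 0 <= C -> (forall x, Om x -> `|v x| <= C) -> w \in L2T ->
  (forall x, ~ Om x -> w x = 0) ->
  (fun x => v x * w x) \in L2T /\ nrm (fun x => v x * w x) <= C * nrm w.
Proof.
move=> cv C0 vC lw w0.
have le x : `|v x * w x| <= `|C * w x|.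
  have [Ox|/w0 ->] := pselect (Om x); last by rewrite !mulr0.
  by rewrite !normrM (ger0_norm C0) ler_wpM2r// vC.
have l : (fun x => v x * w x) \in L2T.
  apply: (le_Lfun2 _ (Lfun2Z C lw) le); apply: measurable_funM; last exact: Lfun2_meas lw.
  exact: continuous_measurable_rV.
split=> //; rewrite (le_trans (le_nrm l (Lfun2Z C lw) le))// nrmZ// ger0_norm//.
Qed.

(* [b n] lives in a boundary layer of width O(1 / n) and has size O(n). Since
   [Z . grad rho = 1] there, [b n = Z . grad (zeta n)], and testing the weak
   gradient of [u] with [zeta n * Z i * phi] leaves only [zeta n], which is
   bounded; this replaces a trace theorem. *)
Let boundary_tf (u : V -> R) (gu : 'I_d -> V -> R) : u \in L2T -> (forall i, gu i \in L2T) ->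
  (forall i, wderiv_in Om i u (gu i)) ->
  exists2 C, 0 <= C & \forall n \near \oo, forall phi dphi, tf Om phi dphi ->
    `|\int[mu]_x (b n x * u x * phi x)| <=
    C * \sum_i (nrm (fun x => zeta n x * u x) * (nrm phi + nrm (dphi i)) +
                nrm (fun x => zeta n x * gu i x) * nrm phi).
Proof.
move=> lu lgu ugu.
have [c [Z [dZ [c0 cZ ZE]]]] := transverse_field.
have [C C0 ZC] : exists2 C, 0 <= C &
    forall i x, Om x -> `|Z i x| <= C /\ `|dZ i i x| <= C.
  have bd (I : finType) (f : I -> V -> R) : (forall i, continuous (f i)) ->
      exists2 C, 0 <= C & forall i x, Om x -> `|f i x| <= C.
    move=> cf; have h i := bounded_on (cf i).
    exists (\sum_i sval (cid2 (h i))); first by apply: sumr_ge0 => i _; case: cid2.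
    move=> i x Ox; rewrite (bigD1 i)//=.
    have : `|f i x| <= sval (cid2 (h i)) by case: cid2 => C ? H; exact: H.
    move=> /le_trans; apply; rewrite lerDl; apply: sumr_ge0 => j _; by case: cid2.
  have [C1' ? h1] := bd _ Z (fun i => let: And3 a _ _ := cZ i in a).
  have [C2' ? h2] := bd _ (fun i => dZ i i) (fun i => let: And3 _ b _ := cZ i in b i).
  exists (C1' + C2') => [|i x Ox]; first exact: addr_ge0.
  by split; [rewrite (le_trans (h1 i x Ox))// lerDl|rewrite (le_trans (h2 i x Ox))// lerDr].
exists C => //.
have contZ i : continuous (Z i) by case: (cZ i).
have contdZ i : continuous (dZ i i) by case: (cZ i).
near=> n => phi dphi tp.
have [cp _] := tp; have lp := tf_Lfun2 tp; have ldp i := tf_dLfun2 i tp.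
have poff x : ~ Om x -> phi x = 0 by move=> /(tf_off tp)[].
have dpoff i x : ~ Om x -> dphi i x = 0 by move=> /(tf_off tp)[_].
have lzu : (fun x => zeta n x * u x) \in L2T by exact: Lfun2_bddM (@zeta_le1 n) lu.
have lzg i : (fun x => zeta n x * gu i x) \in L2T by exact: Lfun2_bddM (@zeta_le1 n) (lgu i).
have lZp i : (fun x => Z i x * phi x) \in L2T by exact: tf_Lfun2 (tfMl (cZ i) tp).
have ldZp i : (fun x => Z i x * dphi i x + phi x * dZ i i x) \in L2T.
  exact: tf_dLfun2 i (tfMl (cZ i) tp).
have key i : \int[mu]_x (b n x * u x * (phi x * (Z i x * partial i rho x))) =
    - (dot (fun x => zeta n x * u x) (fun x => Z i x * dphi i x + phi x * dZ i i x)
    + dot (fun x => zeta n x * gu i x) (fun x => Z i x * phi x)).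
  have := ugu i _ _ (tfMl (C1zeta n) (tfMl (cZ i) tp)).
  have -> : dot (gu i) (fun x => zeta n x * (Z i x * phi x)) =
    dot (fun x => zeta n x * gu i x) (fun x => Z i x * phi x).
    by apply: eq_Rintegral => x _; ring.
  move=> h; apply/eqP; rewrite -subr_eq0 opprK addrA.
  have -> : forall a b c : R, a + b + c = (a + b) - (- c) by move=> *; ring.
  rewrite -h subr_eq0; apply/eqP.
  rewrite /dot -RintegralD//.
  - by apply: eq_Rintegral => x _; rewrite dzetaE; ring.
  - have [mb [B bB]] := b_bdd n.
    rewrite (_ : (fun _ => _) = fun x => (b n x * u x) * (partial i rho x * (Z i x * phi x))); last first.
      by apply/funext => x; ring.
    apply: Lfun2_intM; first exact: Lfun2_bddM bB lu.
    exact: tf_Lfun2 (tfMl (C1drho i) (tfMl (cZ i) tp)).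
  - exact: Lfun2_intM.
have -> : \int[mu]_x (b n x * u x * phi x) =
    \sum_i \int[mu]_x (b n x * u x * (phi x * (Z i x * partial i rho x))).
  have [mb [B bB]] := b_bdd n.
  rewrite -Rintegral_sum => [|i]; last first.
    rewrite (_ : (fun _ => _) = fun x => (b n x * u x) * (partial i rho x * (Z i x * phi x))); last first.
      by apply/funext => x; ring.
    apply: Lfun2_intM; first exact: Lfun2_bddM bB lu.
    exact: tf_Lfun2 (tfMl (C1drho i) (tfMl (cZ i) tp)).
  apply: eq_Rintegral => x _; rewrite -mulr_sumr -mulr_sumr.
  have [Ox|/poff ->] := pselect (Om x); last by rewrite mul0r !mulr0.
  have [rx|rx] := ltP (- rho x) c; first by rewrite ZE// mulr1.
  (* Outside the layer where Z is normalised, the ramp is already flat as soon as 2 <= N n * c. *)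
  suff -> : b n x = 0 by rewrite !mul0r.
  rewrite /b dsmoothstep_ge1 ?mulr0// lerBrDr mulNr -mulrN -[1 + 1]/(2%:R).
  rewrite -ler_pdivrMl// mulrC (le_trans _ rx)// ler_pdivrMr// mulrC -ler_pdivrMr//.
  near: n; exists (Num.trunc (2 / c)) => //= n Nn.
  by rewrite ltW// (lt_le_trans (truncnS_gt _))// ler_nat ltnS.
rewrite (le_trans (ler_norm_sum _ _ _))// mulr_sumr ler_sum// => i _.
rewrite key normrN (le_trans (ler_normD _ _))// mulrDr lerD//.
  rewrite (le_trans (normr_dot _ _))// mulrCA ler_wpM2l ?nrm_ge0//.
  have [l1 n1] : (fun x => Z i x * dphi i x) \in L2T /\ nrm (fun x => Z i x * dphi i x) <= C * nrm (dphi i).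
    exact: (bdd_on (contZ i) C0 (fun x Ox => (ZC i x Ox).1) (ldp i) (dpoff i)).
  have [l2 n2] : (fun x => dZ i i x * phi x) \in L2T /\ nrm (fun x => dZ i i x * phi x) <= C * nrm phi.
    exact: (bdd_on (contdZ i) C0 (fun x Ox => (ZC i x Ox).2) lp poff).
  rewrite (_ : (fun x => _) = fun x => Z i x * dphi i x + dZ i i x * phi x); last first.
    by apply/funext => x; ring.
  by rewrite (le_trans (ler_nrmD _ _))// mulrDr addrC lerD.
rewrite (le_trans (normr_dot _ _))// mulrCA ler_wpM2l ?nrm_ge0//.
exact: (bdd_on (contZ i) C0 (fun x Ox => (ZC i x Ox).1) lp poff).2.
Unshelve. all: by end_near. Qed.

(** Summed over i, [local_by_parts] with both cut-offs equal to chi n gives the integral of chi n ^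
    2 * P plus a layer term T n in which the gradient of u no longer occurs and g enters only
    through q = grad rho . g. As n grows, the first tends to the integral of P by dominated
    convergence, so T n -> 0 is what remains. *)
Lemma green_neumann (u : V -> R) gu g h :
  H1 Om u gu -> (forall i, H1 Om (g i) (h i)) ->
  H10 Om (fun x => \sum_i partial i rho x * g i x) ->
  dot (u \_ Om) (fun x => \sum_i (h i i \_ Om) x) +
  \sum_i dot (gu i \_ Om) (g i \_ Om) = 0.
Proof.
move=> [lu lgu ugu] Hg [gq [phi [[lq lgq _] tphi qphi dqphi]]].
have lg i : L2 Om (g i) by case: (Hg i).
have lh i j : L2 Om (h i j) by case: (Hg i).
have wg i : weak_grad Om (g i) (h i) by case: (Hg i).
set q := (fun x => _) in lq qphi.
pose ut : V -> R := u \_ Om; pose gut i : V -> R := gu i \_ Om.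
pose gt i : V -> R := g i \_ Om; pose ht i : V -> R := h i i \_ Om.
pose qt : V -> R := q \_ Om.
have lut : ut \in L2T by exact: lu.
have lgut i : gut i \in L2T by exact: lgu.
have lgt i : gt i \in L2T by exact: lg.
have lht i : ht i \in L2T by exact: lh.
have lqt : qt \in L2T by exact: lq.
have gtoff i x : ~ Om x -> gt i x = 0 by exact: restr_out.
have gutoff i x : ~ Om x -> gut i x = 0 by exact: restr_out.
have utoff x : ~ Om x -> ut x = 0 by exact: restr_out.
have qtE x : qt x = \sum_i partial i rho x * gt i x.
  rewrite /qt /gt /q patchE; case: ifPn => xO; first by apply: eq_bigr => i _; rewrite patchE xO.
  by rewrite big1// => i _; rewrite patchE (negbTE xO) mulr0.
pose P x := ut x * \sum_i ht i x + \sum_i gut i x * gt i x.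
have iut_h i : intg (fun x => ut x * ht i x) by exact: Lfun2_intM.
have igg i : intg (fun x => gut i x * gt i x) by exact: Lfun2_intM.
have iP : intg P.
  apply: intgD; last exact: intg_sum.
  by under eq_fun do rewrite mulr_sumr; exact: intg_sum.
have -> : dot ut (fun x => \sum_i ht i x) + \sum_i dot (gut i) (gt i) = \int[mu]_x P x.
  rewrite /P RintegralD//; last 2 first.
  - by under eq_fun do rewrite mulr_sumr; exact: intg_sum.
  - exact: intg_sum.
  by congr (_ + _); rewrite Rintegral_sum.
pose T n := \int[mu]_x (b n x * ut x * qt x).
have lchi v n : v \in L2T -> (fun x => chi n x * v x) \in L2T.
  apply: (@Lfun2_bddM _ _ _ _ 1); first by apply: continuous_measurable_rV; case: (C1chi n).
  by move=> x; have /andP[? ?] := chi01 n x; rewrite ger0_norm.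
have ldchi v n i : v \in L2T -> (fun x => dchi n i x * v x) \in L2T.
  have [c _ dc] := tf_dbounded i (tfchi n).
  by apply: (Lfun2_bddM _ dc); apply: continuous_measurable_rV; case: (C1chi n).
have lb v n : v \in L2T -> (fun x => b n x * v x) \in L2T.
  by have [mb [B bB]] := b_bdd n; exact: Lfun2_bddM bB.
have lccP n i : intg (fun x => chi n x * chi n x * (ut x * ht i x + gut i x * gt i x)).
  apply: (@intg_bddM _ _ _ _ 1); last exact: intgD.
    by apply: measurable_funM; apply: continuous_measurable_rV; case: (C1chi n).
  move=> x; have /andP[? ?] := chi01 n x; rewrite normrM !ger0_norm// mulr_ile1//.
have lccd n i : intg (fun x => b n x * ut x * (partial i rho x * gt i x)).
  apply: Lfun2_intM; first exact: lb.
  have [C C0 hC] := bounded_on (let: And3 a _ _ := C1drho i in a).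
  exact: (bdd_on (let: And3 a _ _ := C1drho i in a) C0 hC (lgt i) (gtoff i)).1.
have eqn n : \int[mu]_x (chi n x * chi n x * P x) + T n = 0.
  have h0 i := local_by_parts (tfchi n) (tfchi n) (weak_grad_wderiv i ugu)
    (weak_grad_wderiv i (wg i)) (lchi _ n lut) (lchi _ n (lgut i))
    (ldchi _ n i lut) (lchi _ n (lgt i)) (lchi _ n (lht i)) (ldchi _ n i (lgt i)).
  transitivity (\sum_(i < d) (0 : R)); last by rewrite big1.
  under [RHS]eq_bigr => i _ do rewrite -(h0 i).
  rewrite -Rintegral_sum => [|i]; last first.
    have := intgD (lccP n i) (lccd n i).
    congr (mu.-integrable _ (EFin \o _)); apply/funext => x.
    by rewrite -/(dzeta n i x) dzetaE; rewrite /ut /gt /gut /ht; ring.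
  rewrite /T -RintegralD//.
  - apply: eq_Rintegral => x _.
    have -> : P x = \sum_i (ut x * ht i x + gut i x * gt i x) by rewrite /P mulr_sumr -big_split.
    rewrite qtE [b n x * ut x * _]mulr_sumr mulr_sumr -big_split/=.
    by apply: eq_bigr => i _; rewrite -/(dzeta n i x) dzetaE; rewrite /ut /gt /gut /ht; ring.
  - rewrite (_ : (fun _ => _) = fun x => \sum_i chi n x * chi n x * (ut x * ht i x + gut i x * gt i x)).
      exact: intg_sum.
    by apply/funext => x; rewrite -mulr_sumr big_split/= -mulr_sumr.
  - by apply: Lfun2_intM => //; exact: lb.
have PT : (fun n => \int[mu]_x (chi n x * chi n x * P x)) @ \oo --> \int[mu]_x P x.
  have [|||||//] := @dominated_cvgR _ _ _ mu (fun n x => chi n x * chi n x * P x) P (fun x => `|P x|).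
  - move=> n; apply: measurable_funM; last exact: intg_meas iP.
    by apply: measurable_funM; apply: continuous_measurable_rV; case: (C1chi n).
  - exact: intg_meas iP.
  - exact: integrable_norm iP.
  - move=> x; have [Ox|nOx] := pselect (Om x).
      rewrite [X in _ --> X](_ : _ = 1 * 1 * P x); last by rewrite !mul1r.
      by apply: cvgM; [apply: cvgM; exact: chi_cvg|exact: cvg_cst].
    have -> : P x = 0.
      by rewrite /P utoff// mul0r add0r big1// => i _; rewrite gtoff// mulr0.
    by under eq_fun do rewrite mulr0; exact: cvg_cst.
  - move=> n x; have /andP[? ?] := chi01 n x.
    by rewrite !normrM (ger0_norm (_ : 0 <= chi n x))// ler_piMl// mulr_ile1.
(* Two limits in this order: at fixed n, q is replaced by the test functions phi j, and the bound
   obtained for all large j passes to the limit; it contains only fixed norms of q and of its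
   gradient, multiplied by norms with the factor zeta n that vanish as n grows. *)
have TT : T @ \oo --> (0 : R).
  have [C C0 HC] := boundary_tf lut lgut (fun i => weak_grad_wderiv i ugu).
  pose gqt i : V -> R := gq i \_ Om.
  (* The 2 is one unit of slack for phi j and one for its derivative, both close to their limits for
     large j. *)
  pose K i := nrm qt + nrm (gqt i) + 2.
  pose B n := C * \sum_i (nrm (fun x => zeta n x * ut x) * K i +
                nrm (fun x => zeta n x * gut i x) * (nrm qt + 1)).
  have TB : \forall n \near \oo, `|T n| <= B n.
    apply: filterS HC => n Hn.
    have lbu : (fun x => b n x * ut x) \in L2T by exact: lb.
    have tphi' j := test_tf (tphi j).
    have lphi j := tf_Lfun2 (tphi' j).
    have phiq : (fun j => nrm (fun x => phi j x - qt x)) @ \oo --> (0 : R).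
      rewrite (_ : (fun j => _) = fun j => L2norm Om (fun x => phi j x - q x)); first exact: qphi.
      apply/funext => j; rewrite L2normE; congr nrm.
      apply/funext => x; rewrite /qt !patchE; case: ifPn => // /negP; rewrite inE => nOx.
      by rewrite (tf_off (tphi' j) nOx).1 subrr.
    have dphiq i : (fun j => nrm (fun x => partial i (phi j) x - gqt i x)) @ \oo --> (0 : R).
      rewrite (_ : (fun j => _) = fun j => L2norm Om (fun x => partial i (phi j) x - gq i x)); first exact: dqphi.
      apply/funext => j; rewrite L2normE; congr nrm.
      apply/funext => x; rewrite /gqt !patchE; case: ifPn => // /negP; rewrite inE => nOx.
      by rewrite (tf_off (tphi' j) nOx).2 subrr.
    have Tj : (fun j => `|\int[mu]_x (b n x * ut x * phi j x)|) @ \oo --> `|T n|.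
      apply: cvg_norm; apply: (@cvg_dot _ _ _ mu (fun=> _) phi) => //.
      rewrite [X in X @ _](_ : _ = fun=> 0); first exact: cvg_cst.
      apply/funext => j; rewrite /nrm /dot (_ : Rintegral _ _ _ = 0) ?sqrtr0//.
      by under eq_Rintegral do rewrite subrr mulr0; rewrite Rintegral_cst// mul0r.
    rewrite -(cvg_lim _ Tj)//; apply: limr_le; first by apply/cvg_ex; eexists; exact: Tj.
    have nle (v_ : nat -> V -> R) v : (forall j, v_ j \in L2T) -> v \in L2T ->
        (fun j => nrm (fun x => v_ j x - v x)) @ \oo --> (0 : R) ->
        \forall j \near \oo, nrm (v_ j) <= nrm v + 1.
      move=> lv_ lv /cvgrPdist_le/(_ 1 ltr01); apply: filterS => j.
      rewrite sub0r normrN ger0_norm ?nrm_ge0// => hj.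
      rewrite [X in nrm X <= _](_ : v_ j = fun x => v x + (v_ j x - v x)).
        by rewrite (le_trans (ler_nrmD _ _))// ?lerD2l//; exact: Lfun2B.
      by apply/funext => x; ring.
    have near1 := nle _ _ lphi lqt phiq.
    have near2 : \forall j \near \oo, forall i, nrm (partial i (phi j)) <= nrm (gqt i) + 1.
      apply: filter_forall => i; apply: nle => // [j|]; first exact: tf_dLfun2 (tphi' j).
      exact: lgq.
    apply: filterS2 near1 near2 => j h1 h2.
    rewrite (le_trans (Hn _ _ (tphi' j)))// ler_wpM2l// ler_sum// => i _.
    rewrite lerD// ler_wpM2l ?nrm_ge0// /K; have := h2 i; lra.
  have B0 : B @ \oo --> (0 : R).
    rewrite -[X in _ --> X](mulr0 C); apply: cvgM; first exact: cvg_cst.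
    apply: cvg_sum0 => i.
    rewrite -[X in _ --> X]addr0; apply: cvgD.
      rewrite -[X in _ --> X](mul0r (K i)); apply: cvgM; last exact: cvg_cst.
      exact: zeta_L2_cvg0.
    rewrite -[X in _ --> X](mul0r (nrm qt + 1)); apply: cvgM; last exact: cvg_cst.
    by apply: zeta_L2_cvg0 => // x; exact: gutoff.
  apply/norm_cvg0P; apply: (@squeeze_cvgr _ _ _ _ (fun=> 0) B) => //; last exact: cvg_cst.
  by apply: filterS TB => n ->; rewrite normr_ge0.
have : (fun n => \int[mu]_x (chi n x * chi n x * P x)) @ \oo --> (0 : R).
  rewrite (_ : (fun n => _) = fun n => - T n); first by rewrite -oppr0; exact: cvgN.
  by apply/funext => n; have /eqP := eqn n; rewrite addr_eq0 => /eqP.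
by move=> /(cvg_lim _) <-//; rewrite (cvg_lim _ PT).
Qed.

End neumann.

(** * Green's formula, periodic case *)

Section periodic.
Context {R : realType} {d : nat}.
Notation V := 'rV[R]_d.
Notation mu := (lebesgue_rV R d).
Notation L2T := (Lfun mu 2%:E).
Notation dot := (dot mu).
Notation nrm := (nrm mu).
Notation intg v := (mu.-integrable setT (EFin \o v)).
Implicit Types (v w phi : V -> R).

Variable L : R.
Hypothesis L0 : 0 < L.
Let Q : set V := [set x | forall i, 0 < x ord0 i < L].
(** The half-open cell tiles the space exactly by lattice translates; it differs from the open cell
    Q by a null set contained in coordinate hyperplanes. *)
Let P : set V := [set x | forall i, 0 <= x ord0 i < L].

Let mQ : measurable Q.
Proof.
apply: (@measurable_box R d (fun=> [set y | 0 < y < L])) => i.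
rewrite (_ : mkset _ = `]0, L[%classic); first exact: measurable_itv.
by apply/seteqP; split=> y /=; rewrite in_itv.
Qed.

Let mP : measurable P.
Proof.
apply: (@measurable_box R d (fun=> [set y | 0 <= y < L])) => i.
rewrite (_ : mkset _ = `[0, L[%classic); first exact: measurable_itv.
by apply/seteqP; split=> y /=; rewrite in_itv.
Qed.

Lemma periodic_dom_measurable : measurable Q. Proof. exact: mQ. Qed.

Let ae_PQ v : ae_eq mu setT (v \_ P) (v \_ Q).
Proof.
have H : \forall x \near almost_everywhere mu, forall i, (x : V) ord0 i != 0.
  apply: filter_forall => i; exists [set x : V | x ord0 i = 0]; split.
  - exact: (@measurable_coord R d i [set 0]).
  - exact: lebesgue_rV_hyperplane.
  - by move=> x /= /negP; rewrite negbK => /eqP.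
apply: filterS H => x xi _; rewrite !patchE; suff -> : (x \in P) = (x \in Q) by [].
apply/idP/idP; rewrite !inE => h i; have /andP[h1 h2] := h i.
  by rewrite h2 andbT lt_def xi h1.
by rewrite h2 ltW.
Qed.

Let Lfun2_P v : measurable_fun setT v -> v \_ Q \in L2T -> v \_ P \in L2T.
Proof.
move=> mv lQ; have mvQ := Lfun2_meas lQ; have [_ /integrableP[_ iQ]] := (Lfun2P mu (v \_ Q)).1 lQ.
have mvP : measurable_fun setT (v \_ P).
  by apply/(measurable_restrictT _ mP); exact: measurable_funS mv.
apply/Lfun2P; split=> //; apply/integrableP; split.
  by apply/measurable_EFinP; exact: measurable_funX.
apply: le_lt_trans iQ; rewrite le_eqVlt; apply/orP; left; apply/eqP.
apply: ge0_ae_eq_integral => //.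
- by apply: measurableT_comp => //; apply/measurable_EFinP; exact: measurable_funX.
- by apply: measurableT_comp => //; apply/measurable_EFinP; exact: measurable_funX.
- by apply: filterS (ae_PQ v) => x + _ => /(_ I) /= ->.
Qed.

Section shifts.
Variable m : nat.

Let c (a : nat) : R := (a%:R - m%:R) * L.
(** Lattice shifts with coordinates - m L, ..., (m - 1) L. They are indexed by finite functions so
    that a sum over shifts of a product over coordinates becomes a product of one-dimensional
    sums. *)
Let sh (k : {ffun 'I_d -> 'I_(2 * m)}) : V := \sum_j c (k j) *: unit_rV j.

Let shE k j : sh k ord0 j = c (k j).
Proof.
rewrite /sh summxE (bigD1 j)//= big1 => [|l lj]; rewrite !mxE eqxx/=.
  by rewrite eqxx mulr1 addr0.
by rewrite eq_sym (negbTE lj) mulr0.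
Qed.

Let box : set V := [set x | forall i, - (m%:R * L) <= x ord0 i < m%:R * L].

Let periodic_sh v k x : Defs.periodic L v -> v (x + sh k) = v x.
Proof.
move=> pv; have p1 x' i (a : nat) : v (x' + (a%:R * L) *: unit_rV i) = v x'.
  elim: a x' => [|a ih] x'; first by rewrite mul0r scale0r addr0.
  by rewrite -natr1 mulrDl mul1r scalerDl addrA pv ih.
have p2 x' i (a : nat) : v (x' + c a *: unit_rV i) = v x'.
  rewrite -(p1 (x' + _) i m) -addrA -scalerDl /c -mulrDl subrK; exact: p1.
rewrite /sh; elim: (index_enum _) x => [|j r ih] x; first by rewrite big_nil addr0.
by rewrite big_cons addrA ih p2.
Qed.

Let indic1 (s : R) : \sum_(a < 2 * m) ((0 <= s - c a < L)%R%:R : R) =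
  (- (m%:R * L) <= s < m%:R * L)%R%:R.
Proof.
have H (n : nat) : \sum_(a < n) ((0 <= s - c a < L)%R%:R : R) = (c 0 <= s < c n)%R%:R.
  elim: n => [|n ih]; first by rewrite big_ord0; case: leP => //= h; rewrite ltNge h.
  have cn : c n.+1 = c n + L by rewrite /c -natr1; ring.
  have c0n : c 0 <= c n by rewrite /c ler_wpM2r ?lerD2r// ?ler_nat// ltW.
  rewrite big_ord_recr/= ih subr_ge0 ltrBlDl cn.
  have [h1|h1] := ltP s (c n).
    by rewrite andbT addr0 (lt_le_trans h1)// ?andbT// lerDl ltW.
  by rewrite andbF add0r (le_trans c0n h1).
rewrite H /c mul2n -addnn natrD addrK sub0r mulNr//.
Qed.

(** In each coordinate exactly one of the 2 m consecutive half-open intervals contains a given point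
    of [- m L, m L); the product over coordinates gives the tiling of the box. *)
Let indic_box (x : V) : \sum_(k : {ffun 'I_d -> 'I_(2 * m)}) (\1_P (x - sh k) : R) = \1_box x.
Proof.
transitivity (\prod_(j < d) \sum_(a < 2 * m) ((0 <= x ord0 j - c a < L)%R%:R : R)).
  rewrite bigA_distr_bigA/=; apply: eq_bigr => k _.
  rewrite indicE; case: (boolP (_ \in P)) => xP.
    rewrite big1// => j _; move: xP; rewrite inE => /(_ j); rewrite !mxE -/(sh k) shE => -> //.
  have [j xj] : exists j, ~~ (0 <= x ord0 j - c (k j) < L).
    apply: contrapT => h; move/negP : xP; apply; rewrite inE => j; rewrite !mxE -/(sh k) shE.
    by apply: contrapT => xj; apply: h; exists j; apply/negP.
  by rewrite (bigD1 j)//= (negbTE xj) mul0r.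
under eq_bigr do rewrite indic1.
rewrite indicE; case: (boolP (x \in box)) => xb.
  by rewrite big1// => j _; move: xb; rewrite inE => ->.
have [j xj] : exists j, ~~ (- (m%:R * L) <= x ord0 j < m%:R * L).
  apply: contrapT => h; move/negP : xb; apply; rewrite inE => j.
  by apply: contrapT => xj; apply: h; exists j; apply/negP.
by rewrite (bigD1 j)//= (negbTE xj) mul0r.
Qed.

Lemma periodic_Lfun2_box v : measurable_fun setT v -> Defs.periodic L v -> v \_ Q \in L2T ->
  (fun x => \1_box x * v x) \in L2T.
Proof.
move=> mv pv lv; have lP := Lfun2_P mv lv.
rewrite (_ : (fun _ => _) = fun x => \sum_(k : {ffun 'I_d -> 'I_(2 * m)}) (v \_ P) (x - sh k)).
  by apply: Lfun2_sum => k; exact: (Lfun2_shift (- sh k) lP).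
apply/funext => x; rewrite -indic_box mulr_suml; apply: eq_bigr => k _.
rewrite patchE indicE; case: ifPn => _; last by rewrite mul0r.
by rewrite mul1r -[in LHS](subrK (sh k) x) (periodic_sh k _ pv).
Qed.

(** Cut the box into translates of P and move each piece back to P: by periodicity v is unchanged,
    so the shifts accumulate on zeta. *)
Lemma periodic_fold zeta v : (forall x, ~ box x -> zeta x = 0) -> Defs.periodic L v ->
  intg (fun x => zeta x * v x) ->
  \int[mu]_x (zeta x * v x) =
  \int[mu]_x (\sum_(k : {ffun 'I_d -> 'I_(2 * m)}) zeta (x + sh k) * (v \_ P) x).
Proof.
move=> z0 pv iv.
have i1 k : intg (fun x => \1_P (x - sh k) * (zeta x * v x)).
  apply: (@intg_bddM _ _ _ _ 1) => //.
    apply: (measurableT_comp (measurable_indic mP)); exact: (measurable_shift (- sh k)).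
  by move=> x; rewrite indicE; case: (_ \in _); rewrite ?normr1 ?normr0.
have E k : (fun x => zeta (x + sh k) * (v \_ P) x) =
    fun x => (fun x => \1_P (x - sh k) * (zeta x * v x)) (x + sh k).
  apply/funext => x /=; rewrite addrK (periodic_sh k x pv) patchE indicE.
  by case: ifPn => _; rewrite ?mulr0 ?mul0r ?mul1r.
rewrite Rintegral_sum; last by move=> k; rewrite E; exact: (intg_shift (sh k) (i1 k)).
transitivity (\sum_(k : {ffun 'I_d -> 'I_(2 * m)}) \int[mu]_x (\1_P (x - sh k) * (zeta x * v x))).
  rewrite -Rintegral_sum//; apply: eq_Rintegral => x _.
  rewrite -mulr_suml indic_box indicE; case: (boolP (x \in box)) => [_|/negP]; first by rewrite mul1r.
  by rewrite inE => /z0 ->; rewrite !mul0r.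
apply: eq_bigr => k _; rewrite -(Rintegral_shift (sh k))//.
by apply: eq_Rintegral => x _; rewrite -[RHS]/((fun x => _) x) E.
Qed.

Lemma cball_box M x : M < m%:R * L -> cball M x -> box x.
Proof.
move=> ML xM j; have := le_trans (coord_le_norm x j) xM.
rewrite ler_norml => /andP[h1 h2]; apply/andP; split.
  by rewrite (le_trans _ h1)// lerN2 ltW.
by rewrite (le_lt_trans h2).
Qed.

Hypothesis m3 : (3 <= m)%N.

(* The translates of [tau] by multiples of [L] telescope to 1, so those of [chi]
   by the lattice [L Z^d] form a C^1 partition of unity. *)
Let tau (s : R) : R := smoothstep (L^-1 * s) - smoothstep (L^-1 * s - 1).
Let chi (x : V) : R := \prod_(j < d) tau (x ord0 j).

Let C1chi : exists dchi, C1 chi dchi.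
Proof.
have C1s := C1_comp (@is_derive_smoothstep R) (@dsmoothstep_continuous R).
apply: C1_prod => j; have cj := C1Z L^-1 (@C1_coord R d j).
by eexists; exact: C1B (C1s _ _ _ cj) (C1s _ _ _ (C1B cj (C1_cst 1))).
Qed.

Let chi_supp x : ~ cball (2 * L) x -> chi x = 0.
Proof.
move=> xM; have [j xj] : exists j, ~~ (0 <= x ord0 j <= 2 * L).
  apply: contrapT => h; apply: xM; rewrite /cball/= leNgt; apply/negP => xL.
  have : `|x| < `|x|; last by rewrite ltxx.
  apply: norm_lt_coord; first by rewrite (lt_trans _ xL)// mulr_gt0.
  move=> j; have : 0 <= x ord0 j <= 2 * L by apply: contrapT => /negP xj; apply: h; exists j.
  by move=> /andP[x0 x2]; rewrite ger0_norm// (le_lt_trans x2).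
rewrite /chi (bigD1 j)//=; suff -> : tau (x ord0 j) = 0 by rewrite mul0r.
move: xj; rewrite negb_and -!ltNge /tau => /orP[xj|xj].
  rewrite !smoothstep_le0 ?subrr//; have : L^-1 * x ord0 j <= 0 by rewrite mulr_ge0_le0// ?invr_ge0 ltW.
    by move=> h; rewrite (le_trans _ h)// lerBlDr lerDl.
  by [].
have h : 2 <= L^-1 * x ord0 j by rewrite ler_pdivlMl// mulrC ltW.
by rewrite !smoothstep_ge1 ?subrr// ?lerBrDr ?(le_trans _ h)// ler1n.
Qed.

(** The sum telescopes to a difference of two values of [smoothstep]; m >= 3 pushes their arguments
    beyond 1 and below 0. The interval is wider than the period so that the translates of chi sum to
    1 on an open neighbourhood of the cell, where this identity can be differentiated. *)
Let tau_sum (s : R) : - L < s < 2 * L -> \sum_(a < 2 * m) tau (s + c a) = 1.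
Proof.
move=> /andP[s1 s2].
have H (n : nat) : \sum_(a < n) tau (s + c a) =
    smoothstep (L^-1 * s + n%:R - m%:R - 1) - smoothstep (L^-1 * s - m%:R - 1).
  elim: n => [|n ih]; first by rewrite big_ord0 addr0 subrr.
  rewrite big_ord_recr/= ih /tau.
  have -> : L^-1 * (s + c n) = L^-1 * s + n.+1%:R - m%:R - 1.
    by rewrite /c -natr1; field; rewrite gt_eqF.
  have -> : L^-1 * s + n.+1%:R - m%:R - 1 - 1 = L^-1 * s + n%:R - m%:R - 1.
    by rewrite -natr1; ring.
  ring.
have m3' : 3 <= m%:R :> R by rewrite ler_nat.
have h1 : - 1 < L^-1 * s by rewrite ltr_pdivlMl// mulrN1.
have h2 : L^-1 * s < 2 by rewrite ltr_pdivrMl// mulrC.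
rewrite H smoothstep_ge1 ?smoothstep_le0 ?subr0//; first by lra.
rewrite natrM; lra.
Qed.

Let chi_sum (x : V) : (forall j, - L < x ord0 j < 2 * L) ->
  \sum_(k : {ffun 'I_d -> 'I_(2 * m)}) chi (x + sh k) = 1.
Proof.
move=> xj; transitivity (\prod_(j < d) \sum_(a < 2 * m) tau (x ord0 j + c a)).
  rewrite bigA_distr_bigA/=; apply: eq_bigr => k _; apply: eq_bigr => j _.
  by rewrite mxE shE.
by rewrite big1// => j _; exact: tau_sum.
Qed.

Let dchi_sum dchi i x : C1 chi dchi -> P x ->
  \sum_(k : {ffun 'I_d -> 'I_(2 * m)}) dchi i (x + sh k) = 0.
Proof.
move=> cchi Px; pose ctr : V := const_mx (L / 2).
(* A sup-norm ball around the centre of the cell: L / 2 -+ 3 L / 2 are the ends - L and 2 L of the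
   range of [chi_sum]. *)
pose O : set V := [set x | `|x - ctr| < 3 / 2 * L].
have oO : open O.
  rewrite (_ : O = (fun x : V => `|x - ctr|) @^-1` [set y | y < 3 / 2 * L])//.
  apply: open_comp; last exact: open_lt.
  move=> y _; apply: (@continuous_comp _ _ _ (fun x : V => x - ctr) (fun x : V => `|x|)).
    exact: (@continuous_shift R d (- ctr)).
  exact: norm_continuous.
have Obd y : O y -> forall j, - L < y ord0 j < 2 * L.
  move=> yO j; have := le_lt_trans (coord_le_norm (y - ctr) j) yO.
  rewrite !mxE ltr_norml => /andP[h1 h2].
  have aux (z : R) : - (3 / 2 * L) < z - L / 2 -> z - L / 2 < 3 / 2 * L -> - L < z < 2 * L.
    by move=> *; apply/andP; split; lra.
  exact: aux.
have PO : O x.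
  apply: norm_lt_coord => [|j]; first by rewrite mulr_gt0// divr_gt0.
  rewrite !mxE; have := Px j.
  have aux (z : R) : 0 <= z < L -> `|z - L / 2| < 3 / 2 * L.
    by move=> /andP[? ?]; rewrite ltr_norml; apply/andP; split; lra.
  exact: aux.
have C1T : C1 (fun x => \sum_(k : {ffun 'I_d -> 'I_(2 * m)}) chi (x + sh k) - 1)
   (fun i x => \sum_(k : {ffun 'I_d -> 'I_(2 * m)}) dchi i (x + sh k) - 0).
  by apply: C1B; [apply: C1_sum => k; exact: C1_shift|exact: C1_cst].
have := partial_off_support i C1T (open_closedC oO) (fun y => _) (x := x).
rewrite subr0; apply.
  by move=> y /contrapT /Obd yO; rewrite chi_sum ?subrr.
by apply.
Qed.

Hypothesis mL : 3 * L + 1 < m%:R * L.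

(** In [local_by_parts] the weights reduce to chi and its derivative because th = 1 around the
    support of chi. Folding onto one cell replaces chi by 1 and its derivative by 0, so no boundary
    terms on the faces of the cell ever appear. *)
Lemma periodic_by_parts i v v' w w' :
  measurable_fun setT v -> measurable_fun setT v' ->
  measurable_fun setT w -> measurable_fun setT w' ->
  Defs.periodic L v -> Defs.periodic L v' -> Defs.periodic L w -> Defs.periodic L w' ->
  v \_ Q \in L2T -> v' \_ Q \in L2T -> w \_ Q \in L2T -> w' \_ Q \in L2T ->
  wderiv_in setT i v v' -> wderiv_in setT i w w' ->
  dot (v \_ Q) (w' \_ Q) + dot (v' \_ Q) (w \_ Q) = 0.
Proof.
move=> mv mv' mw mw' pv pv' pw pw' lv lv' lw lw' vv' ww'.
have [dchi cchi] := C1chi.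
have L30 : 0 <= 3 * L by rewrite mulr_ge0// ltW.
(* The radius 3 L exceeds the radius 2 L of the support of chi, so the gradient of th vanishes on
   that support; [mL] keeps the support of th inside the box. *)
have [th [dth [tth th01 th1 th0]]] := @bump_exists R d (3 * L) L30.
have tchi : tf setT chi dchi.
  by split=> //; exists (cball (2 * L)); split=> //; exact: compact_cball.
have dchi0 x : ~ cball (2 * L) x -> dchi i x = 0.
  exact: (partial_off_support i cchi (@closed_cball R d (2 * L)) chi_supp).
have L2 (z u : V -> R) : measurable_fun setT z -> (exists C, forall x, `|z x| <= C) ->
    (forall x, ~ cball (3 * L + 1) x -> z x = 0) ->
    measurable_fun setT u -> Defs.periodic L u -> u \_ Q \in L2T -> (fun x => z x * u x) \in L2T.
  move=> mz [C zC] z0 mu' pu lu.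
  rewrite (_ : (fun _ => _) = fun x => z x * (\1_box x * u x)).
    by apply: (Lfun2_bddM mz zC); exact: periodic_Lfun2_box.
  apply/funext => x; have [/(cball_box mL) xb|/z0 ->] := pselect (cball (3 * L + 1) x); last by rewrite !mul0r.
  by rewrite indicE mem_set// mul1r.
have sub23 x : ~ cball (3 * L + 1) x -> ~ cball (2 * L) x.
  by move=> h; apply: contra_not h; rewrite /cball/= => h; rewrite (le_trans h)//; lra.
have L2c (u : V -> R) : measurable_fun setT u -> Defs.periodic L u -> u \_ Q \in L2T -> (fun x => chi x * u x) \in L2T.
  apply: L2; first by apply: continuous_measurable_rV; exact: tf_cont tchi.
    by have [C _ hC] := tf_bounded tchi; exists C.
  by move=> x /sub23; exact: chi_supp.
have L2dc (u : V -> R) : measurable_fun setT u -> Defs.periodic L u -> u \_ Q \in L2T -> (fun x => dchi i x * u x) \in L2T.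
  apply: L2; first by apply: continuous_measurable_rV; exact: tf_dcont tchi.
    by have [C _ hC] := tf_dbounded i tchi; exists C.
  by move=> x /sub23; exact: dchi0.
have L2t (u : V -> R) : measurable_fun setT u -> Defs.periodic L u -> u \_ Q \in L2T -> (fun x => th x * u x) \in L2T.
  apply: L2 => //; first by apply: continuous_measurable_rV; exact: tf_cont tth.
  by have [C _ hC] := tf_bounded tth; exists C.
have L2dt (u : V -> R) : measurable_fun setT u -> Defs.periodic L u -> u \_ Q \in L2T -> (fun x => dth i x * u x) \in L2T.
  apply: L2; first by apply: continuous_measurable_rV; exact: tf_dcont tth.
    by have [C _ hC] := tf_dbounded i tth; exists C.
  exact: (partial_off_support i tth.1 (@closed_cball R d (3 * L + 1)) th0).
have := local_by_parts tchi tth vv' ww' (L2c _ mv pv lv) (L2c _ mv' pv' lv') (L2dc _ mv pv lv)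
  (L2t _ mw pw lw) (L2t _ mw' pw' lw') (L2dt _ mw pw lw).
pose X x := v x * w' x + v' x * w x; pose Y x := v x * w x.
have chith x : chi x * th x = chi x.
  have [xM|/chi_supp ->] := pselect (cball (2 * L) x); last by rewrite mul0r.
  by rewrite th1 ?mulr1// /cball/=; apply: (le_trans xM); lra.
have thdchi x : th x * dchi i x = dchi i x.
  have [xM|/dchi0 ->] := pselect (cball (2 * L) x); last by rewrite mulr0.
  by rewrite th1 ?mul1r// /cball/=; apply: (le_trans xM); lra.
have chidth x : chi x * dth i x = 0.
  have [xM|/chi_supp ->] := pselect (cball (2 * L) x); last by rewrite mul0r.
  have cl : closed [set x : V | 3 * L <= `|x|].
    rewrite (_ : mkset _ = (fun x : V => `|x|) @^-1` [set y | 3 * L <= y])//.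
    by apply: closed_comp; [move=> y _; exact: norm_continuous|exact: closed_ge].
  have := partial_off_support i (C1B tth.1 (C1_cst 1)) cl (fun y => _) (x := x).
  rewrite subr0 => ->; first by rewrite mulr0.
    by move=> y /= /negP; rewrite -ltNge => yL; rewrite th1 ?subrr// /cball/= ltW.
  by apply/negP; rewrite -ltNge (le_lt_trans xM)// ltr_pM2r// ltr_nat.
have iX : intg (fun x => chi x * X x).
  rewrite (_ : (fun _ => _) = fun x => (chi x * v x) * (th x * w' x) + (chi x * v' x) * (th x * w x)).
    by apply: intgD; apply: Lfun2_intM; [exact: L2c|exact: L2t|exact: L2c|exact: L2t].
  by apply/funext => x; rewrite /X -{1}chith; ring.
have iY : intg (fun x => dchi i x * Y x).
  rewrite (_ : (fun _ => _) = fun x => (dchi i x * v x) * (th x * w x)).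
    by apply: Lfun2_intM; [exact: L2dc|exact: L2t].
  by apply/funext => x; rewrite /Y -{1}thdchi; ring.
have pX : Defs.periodic L X by move=> x j; rewrite /X pv pv' pw pw'.
have pY : Defs.periodic L Y by move=> x j; rewrite /Y pv pw.
have box2 x : ~ box x -> ~ cball (2 * L) x.
  by move=> h; apply: contra_not h; apply: cball_box; rewrite (le_lt_trans _ mL)//; lra.
have := periodic_fold (fun x h => chi_supp (box2 x h)) pX iX.
have := periodic_fold (fun x h => dchi0 x (box2 x h)) pY iY.
rewrite [X in _ = X -> _](_ : _ = 0); last first.
  rewrite [LHS](_ : _ = \int[mu]_x (0 : R)); last first.
    apply: eq_Rintegral => x _; rewrite -mulr_suml.
    have [Px|nPx] := pselect (P x); first by rewrite dchi_sum// mul0r.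
    by rewrite (restr_out _ nPx) mulr0.
  by rewrite Rintegral_cst// mul0r.
rewrite [X in _ -> _ = X -> _](_ : _ = \int[mu]_x (X \_ P) x); last first.
  apply: eq_Rintegral => x _; rewrite -mulr_suml.
  have [Px|nPx] := pselect (P x); last by rewrite (restr_out _ nPx) mulr0.
  rewrite chi_sum ?mul1r// => j; have := Px j.
  have aux (z : R) : 0 <= z < L -> - L < z < 2 * L.
    by move=> /andP[? ?]; apply/andP; split; lra.
  exact: aux.
move=> hY hX; rewrite [X in X = _ -> _](_ : _ = \int[mu]_x (chi x * X x) + \int[mu]_x (dchi i x * Y x)).
  rewrite hX hY addr0 => XP.
  rewrite /dot -RintegralD//; [|exact: Lfun2_intM|exact: Lfun2_intM].
  (* Folding produces the half-open cell; the open one has the same integral. *)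
  rewrite -XP /Rintegral; congr fine; apply: ae_eq_integral => //.
  - apply/measurable_EFinP; apply: measurable_funD; apply: measurable_funM;
      [exact: Lfun2_meas lv|exact: Lfun2_meas lw'|exact: Lfun2_meas lv'|exact: Lfun2_meas lw].
  - apply/measurable_EFinP; apply/(measurable_restrictT _ mP); apply: (@measurable_funS _ _ _ _ setT) => //.
    by apply: measurable_funD; apply: measurable_funM.
  apply: filterS (ae_PQ X) => x + _ => /(_ I) /= ->; congr EFin; rewrite !patchE.
  by case: ifP => _ //; rewrite !mul0r addr0.
rewrite -RintegralD//; apply: eq_Rintegral => x _.
by rewrite chidth add0r chith thdchi.
Qed.

End shifts.

Lemma periodic_intg v w M : measurable_fun setT v -> Defs.periodic L v -> v \_ Q \in L2T ->
  w \in L2T -> (forall x, ~ cball M x -> w x = 0) -> intg (fun x => v x * w x).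
Proof.
move=> mv pv lv lw w0; pose m := (Num.trunc (M / L)).+1.
have Mm : M < m%:R * L by rewrite -ltr_pdivrMr// truncnS_gt.
have := Lfun2_intM (periodic_Lfun2_box m mv pv lv) lw.
congr (mu.-integrable _ (EFin \o _)); apply/funext => x.
have [/(cball_box Mm) xb|/w0 ->] := pselect (cball M x); last by rewrite !mulr0.
by rewrite indicE mem_set// mul1r.
Qed.

Lemma green_periodic (s := @Periodic R d L) (u : V -> R) gu g h :
  in_H1 s u gu -> (forall i, in_H1 s (g i) (h i)) ->
  dot (u \_ Q) (fun x => \sum_i (h i i \_ Q) x) +
  \sum_i dot (gu i \_ Q) (g i \_ Q) = 0.
Proof.
move=> [lu lgu [U [U' [[mU mU'] [pU pU'] [UE UE'] wU]]]] Hg.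
have [m m3 mL] : exists2 m : nat, (3 <= m)%N & 3 * L + 1 < m%:R * L.
  exists (Num.trunc ((3 * L + 1) / L)).+3 => //.
  rewrite -ltr_pdivrMr// (lt_le_trans (truncnS_gt _))// ler_nat; exact: leq_addl 2 _.
have restr_eq (v w : V -> R) : (forall x, Q x -> v x = w x) -> v \_ Q = w \_ Q.
  by move=> vw; apply/funext => x; rewrite !patchE; case: ifP => //; rewrite inE => /vw.
have key i : dot (u \_ Q) (h i i \_ Q) + dot (gu i \_ Q) (g i \_ Q) = 0.
  have [lg lh [W [W' [[mW mW'] [pW pW'] [WE WE'] wW]]]] := Hg i.
  rewrite -(restr_eq _ _ UE) -(restr_eq _ _ (UE' i)) -(restr_eq _ _ WE) -(restr_eq _ _ (WE' i)).
  have wT v (v' : 'I_d -> V -> R) : weak_grad setT v v' -> wderiv_in setT i v (v' i).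
    by move=> /(@weak_grad_wderiv _ _ _ _ _ i); rewrite !patch_setT.
  apply: (periodic_by_parts m3 mL (i := i)) => //; try exact: wT.
  - by rewrite (restr_eq _ _ UE).
  - by rewrite (restr_eq _ _ (UE' i)); exact: lgu.
  - by rewrite (restr_eq _ _ WE).
  - by rewrite (restr_eq _ _ (WE' i)); exact: lh.
rewrite /dot.
rewrite [X in X + _](_ : _ = \sum_i dot (u \_ Q) (h i i \_ Q)); last first.
  rewrite -Rintegral_sum => [|i]; last first.
    by apply: Lfun2_intM; [exact: lu|case: (Hg i) => _ lh _; exact: lh].
  by apply: eq_Rintegral => x _; rewrite mulr_sumr.
by rewrite -big_split/= big1.
Qed.

End periodic.

(** * The energy inequality *)

(** The constant contributes c times the integral of a derivative of a test function, which is 0.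
    The integrability hypothesis permits splitting the integral; it is checked differently in the
    two settings. *)
Lemma weak_grad_addc (R : realType) (d : nat) (U : set 'rV[R]_d)
  (v : 'rV[R]_d -> R) (g : 'I_d -> 'rV[R]_d -> R) (c : R) :
  (forall phi dphi i, tf U phi dphi ->
    (lebesgue_rV R d).-integrable setT (EFin \o (fun x => (v \_ U) x * dphi i x))) ->
  weak_grad U v g -> weak_grad U (fun x => v x + c) g.
Proof.
move=> ivphi vg i phi /[dup] /test_tf tp /(vg i phi) <-.
have off x : ~ U x -> partial i phi x = 0 by move=> /(tf_off tp)[_].
have idphi : (lebesgue_rV R d).-integrable setT (EFin \o partial i phi).
  have [[_ cdp _] [K [cK _ pK]]] := tp.
  apply: (compact_supp_intg (cdp i) cK).
  exact: (partial_off_support i tp.1 (compact_closed_rV cK) pK).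
have -> : \int[lebesgue_rV R d]_(x in U) ((v x + c) * partial i phi x) =
    \int[lebesgue_rV R d]_x ((v \_ U) x * partial i phi x + c * partial i phi x).
  rewrite Rintegral_mkcond; apply: eq_Rintegral => x _; rewrite !patchE.
  case: ifPn => [_|/negP]; first by rewrite mulrDl.
  by rewrite inE => /off ->; rewrite !mulr0 addr0.
rewrite RintegralD//; [|exact: ivphi tp|exact: intgZ].
rewrite RintegralZl// (int_partial0 i (tfT tp)) mulr0 addr0.
rewrite [RHS]Rintegral_mkcond; apply: eq_Rintegral => x _; rewrite !patchE.
by case: ifPn => //; rewrite mul0r.
Qed.

(** Here a and b are the new and old squared (-1)-norms, c their cross term, N the squared norm of
    the gradient and I the nonlinear term; the bound on c turns a - c into at least (a - b) / 2. *)
Lemma energy_arith (R : realFieldType) (gam eps k a b c N I C : R) :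
  0 < gam -> 0 < eps -> 0 < k -> 2 * c <= b + a ->
  a - c = - k * (eps * N + I) -> a <= gam ^+ 2 * N -> - C <= I ->
  a * (1 + 2 * k * eps / gam ^+ 2) <= b + 2 * k * C.
Proof.
move=> gam0 eps0 k0 half main aN CI.
have h1 : k * eps * (a / gam ^+ 2) <= k * eps * N.
  rewrite ler_wpM2l ?mulr_ge0 ?(ltW k0) ?(ltW eps0)// ler_pdivrMr ?exprn_gt0//.
  by rewrite mulrC.
have h2 : k * - C <= k * I by rewrite ler_wpM2l// ltW.
have -> : a * (1 + 2 * k * eps / gam ^+ 2) = a + 2 * (k * eps * (a / gam ^+ 2)) by ring.
lra.
Qed.

Section settings.
Context {R : realType} {d : nat}.
Notation V := 'rV[R]_d.
Notation mu := (lebesgue_rV R d).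
Notation L2T := (Lfun mu 2%:E).
Notation dot := (dot mu).
Notation nrm := (nrm mu).
Notation intg v := (mu.-integrable setT (EFin \o v)).
Implicit Types (v w : V -> R).

Variable s : setting R d.
Hypothesis hs : admissible s.

Lemma dom_measurable : measurable (dom s).
Proof.
case: s hs => [rho adm|L L0]; first exact: open_measurable_rV (neumann_dom_open adm).
exact: periodic_dom_measurable.
Qed.

Lemma dom_bounded : bounded_set (dom s).
Proof.
case: s hs => [rho [] //|L /= L0].
have [M [Mr HM]] := @bounded_cball R d L; exists M; split=> // x Mx y Qy.
apply: (HM x Mx); rewrite /cball/= leNgt; apply/negP => yL.
have : `|y| < `|y|; last by rewrite ltxx.
apply: norm_lt_coord; first exact: lt_trans yL.
by move=> i; have /andP[h1 h2] := Qy i; rewrite (lt_trans _ yL)// gtr0_norm.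
Qed.

Lemma indic_dom_Lfun2 : (\1_(dom s) : V -> R) \in L2T.
Proof. exact: indic_Lfun2 dom_measurable dom_bounded. Qed.

Lemma cst_restr (c : R) : (fun=> c) \_ (dom s) = fun x : V => c * \1_(dom s) x.
Proof.
by apply/funext => x; rewrite patchE indicE; case: ifP => _; rewrite ?mulr1 ?mulr0.
Qed.

Lemma L2_addc v c : L2 (dom s) v -> L2 (dom s) (fun x => v x + c).
Proof.
move=> lv; rewrite /L2 (@restr_map2 _ _ +%R _ v (fun=> c)) ?addr0//.
by apply: Lfun2D => //; rewrite cst_restr; apply: Lfun2Z; exact: indic_dom_Lfun2.
Qed.

Lemma in_H1_L2 v g : in_H1 s v g -> L2 (dom s) v /\ forall i, L2 (dom s) (g i).
Proof. by rewrite /in_H1; case: s => [rho []|L []]. Qed.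

Lemma in_H1_addc v g c : in_H1 s v g -> in_H1 s (fun x => v x + c) g.
Proof.
move=> hv; have [lv lg] := in_H1_L2 hv; have lvc := L2_addc c lv.
move: hv lv lg lvc; rewrite /in_H1; case: s hs => [rho adm [_ _ vg] lv lg lvc|L L0].
  split=> //; apply: weak_grad_addc vg => phi dphi i tp.
  by apply: Lfun2_intM => //; exact: tf_dLfun2 tp.
move=> [_ _ [V0 [G [[mV mG] [pV pG] [VE GE] wV]]]] lv lg lvc.
split=> //; exists (fun x => V0 x + c), G; split=> //.
- by split=> //; exact: measurable_funD.
- by split=> // x i; rewrite pV.
- by split=> // x Qx; rewrite VE.
apply: weak_grad_addc wV => phi dphi i tp; rewrite patch_setT.
have [[_ cdp _] [K [cK _ pK]]] := tp; have [M KM] := compact_sub_cball cK.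
have dp0 x : ~ cball M x -> dphi i x = 0.
  apply: (partial_off_support i tp.1 (@closed_cball R d M)) => y yM.
  by apply: pK; apply: contra_not yM => /KM.
apply: (periodic_intg L0 mV pV _ (tf_dLfun2 i tp) dp0).
rewrite (_ : V0 \_ _ = v \_ (dom (Periodic L))); first exact: lv.
by apply/funext => x; rewrite !patchE; case: ifP => //; rewrite inE => /VE.
Qed.

Lemma in_H1_cst (c : R) : in_H1 s (fun=> c) (fun _ _ => 0).
Proof.
suff h : in_H1 s (fun=> 0) (fun _ _ => 0).
  by have := in_H1_addc c h; under [fun x => 0 + c]eq_fun do rewrite add0r.
have l0 : L2 (dom s) (fun=> 0).
  by rewrite /L2 cst_restr; under eq_fun do rewrite mul0r; exact: Lfun2_0.
have w0 U : weak_grad U (fun=> 0 : R) (fun _ _ => 0).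
  move=> i phi _; under eq_Rintegral do rewrite mul0r.
  by under [in RHS]eq_Rintegral do rewrite mul0r; rewrite [\int[_]_(_ in _) _]Rintegral_mkcond
    (_ : _ \_ _ = fun=> 0) ?Rintegral_cst// ?mul0r ?oppr0//; apply/funext => x; rewrite patchE; case: ifP.
move: l0; rewrite /in_H1; case: s => [rho|L] l0; split=> //.
by exists (fun=> 0), (fun _ _ => 0); split.
Qed.

(** Only w carries the boundary condition, u is any function of the space H^1 of the setting. Thus u
    may be a constant, which gives mean zero of A w, or w minus its mean, which gives the squared
    gradient norm. *)
Lemma green w Aw : graphA s w Aw -> L2 (dom s) Aw /\ exists2 g, in_H1 s w g &
  forall u gu, in_H1 s u gu -> ip (dom s) Aw u = \sum_i ip (dom s) (g i) (gu i).
Proof.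
move=> [g [h [hw hg bc lAw AwE]]]; split=> //; exists g => // u gu hu.
have key : dot (u \_ (dom s)) (fun x => \sum_i (h i i \_ (dom s)) x) +
    \sum_i dot (gu i \_ (dom s)) (g i \_ (dom s)) = 0.
  move: hs hw hg bc hu; case: (s) => [rho adm|L L0] hw hg bc hu.
    refine (green_neumann adm hu hg bc).
  refine (green_periodic L0 hu hg).
have [lu lgu] := in_H1_L2 hu.
have lh i j : L2 (dom s) (h i j) by have [] := in_H1_L2 (hg i).
have lS : (fun x => \sum_i (h i i \_ (dom s)) x) \in L2T by apply: Lfun2_sum => i; exact: lh.
rewrite ipE (ae_eq_dot (v' := fun x => -1 * \sum_i (h i i \_ (dom s)) x))//.
- rewrite dotZl// dotC mulN1r.
  under eq_bigr do rewrite ipE dotC.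
  by move/eqP : key; rewrite addrC addr_eq0 => /eqP ->.
- exact: Lfun2Z.
apply: filterS AwE => x xE _; rewrite patchE; case: ifPn => xD.
  by rewrite (xE (set_mem xD)) mulN1r; congr (- _); apply: eq_bigr => i _; rewrite patchE xD.
by rewrite big1 ?mulr0// => i _; rewrite patchE (negbTE xD).
Qed.

Lemma int_dom v : \int[mu]_(x in dom s) v x = dot (v \_ (dom s)) (\1_(dom s)).
Proof.
rewrite Rintegral_mkcond; apply: eq_Rintegral => x _; rewrite patchE indicE.
by case: ifPn => _; rewrite ?mulr1 ?mulr0.
Qed.

Lemma volE : vol (dom s) = dot (\1_(dom s)) (\1_(dom s)).
Proof.
rewrite /vol -(mul1r (fine _)) -Rintegral_cst; last exact: dom_measurable.
rewrite int_dom; congr dot; rewrite cst_restr; apply/funext => x; exact: mul1r.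
Qed.

Lemma centered_restr v : centered (dom s) v \_ (dom s) =
  fun x => (v \_ (dom s)) x - mean (dom s) v * \1_(dom s) x.
Proof.
apply/funext => x; rewrite !patchE indicE /centered.
by case: ifPn => _; rewrite ?mulr1 ?mulr0 ?subr0.
Qed.

Lemma centered_L20 v : L2 (dom s) v -> L20 s (centered (dom s) v).
Proof.
move=> lv; split; first exact: L2_addc.
have l1 := indic_dom_Lfun2.
rewrite /mean int_dom centered_restr dotBl//; last exact: Lfun2Z.
(* At volume 0 the inverse is 0 by convention and the mean vanishes. *)
rewrite dotZl// -volE /mean int_dom; have [->|v0] := eqVneq (vol (dom s)) 0.
  by rewrite invr0 !mul0r.
by field.
Qed.

Lemma dot_L20_1 v : L20 s v -> dot (v \_ (dom s)) (\1_(dom s)) = 0.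
Proof.
move=> [lv]; rewrite /mean int_dom; have l1 := indic_dom_Lfun2.
(* At volume 0 the mean carries no information, but the indicator then has norm 0 and Cauchy-Schwarz
   gives the claim. *)
have [v0 _|v0 /eqP] := eqVneq (vol (dom s)) 0; last first.
  by rewrite mulf_eq0 invr_eq0 (negbTE v0) => /eqP.
apply/eqP; rewrite -normr_le0 (le_trans (normr_dot lv l1))//.
by rewrite {2}/nrm -volE v0 sqrtr0 mulr0.
Qed.

Lemma graphA_mean0 w Aw : graphA s w Aw -> L20 s Aw.
Proof.
move=> /green[lAw [g hw gr]]; split=> //; rewrite /mean.
have := gr _ _ (in_H1_cst 1); rewrite big1; last first.
  move=> i _; rewrite /ip; under eq_Rintegral do rewrite mulr0.
  rewrite Rintegral_mkcond (_ : _ \_ _ = fun=> 0) ?Rintegral_cst// ?mul0r//.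
  by apply/funext => x; rewrite patchE; case: ifP.
rewrite /ip; under eq_Rintegral do rewrite mulr1.
by move=> ->; rewrite mulr0.
Qed.

Lemma graphA_addc w Aw c : graphA s w Aw -> graphA s (fun x => w x + c) Aw.
Proof.
by move=> [g [h [hw hg bc lAw AwE]]]; exists g, h; split=> //; exact: in_H1_addc.
Qed.

Section energy.
Variables G S : (V -> R) -> V -> R.
Hypotheses (hG : inverse_of_A s G) (hS : nonneg_sqrt s G S).

Let normc v := normN1 s S (centered (dom s) v).

Lemma energy_step (gam eps k K : R) (f : R -> R) (v u Au b : V -> R) :
  0 < gam -> gamma1_const s S gam -> 0 < eps -> 0 < k ->
  (forall y, - K <= f y * (y - mean (dom s) v)) ->
  L2 (dom s) v -> graphA s u Au -> graphA s (fun x => eps * Au x + f (u x)) b ->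
  ae_eq mu (dom s) (fun x => (u x - v x) / k + b x) (cst 0) ->
  mean (dom s) u = mean (dom s) v /\
  normc u ^+ 2 * (1 + 2 * k * eps / gam ^+ 2) <=
    normc v ^+ 2 + 2 * k * (K * vol (dom s)).
Proof.
move=> gam0 hgam eps0 k0 fK lv hu hw sch.
have [SL20 _ Ssym _ SS] := hS.
set D := dom s.
have l1 : \1_D \in L2T := indic_dom_Lfun2.
have [lAu [g hg gr]] := green hu.
have [lu lg] := in_H1_L2 hg.
have [lb [gw hgw _]] := green hw.
have [lw _] := in_H1_L2 hgw.
have b0 := graphA_mean0 hw.
pose ut : V -> R := u \_ D; pose vt : V -> R := v \_ D; pose bt : V -> R := b \_ D.
have lut : ut \in L2T by exact: lu.
have lvt : vt \in L2T by exact: lv.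
have lbt : bt \in L2T by exact: lb.
have uvb : ae_eq mu setT (fun x => ut x - vt x) (fun x => - k * bt x).
  apply: filterS sch => x xE _; rewrite /ut /vt /bt !patchE; case: ifPn => xD; last by rewrite mulr0 subr0.
  have /eqP := xE (set_mem xD); rewrite /= addr_eq0 => /eqP h.
  have -> : u x - v x = k * ((u x - v x) / k) by field; rewrite gt_eqF.
  by rewrite h mulrN mulNr.
have mE : mean D u = mean D v.
  rewrite /mean !int_dom; congr (_ * _); apply/eqP; rewrite -subr_eq0 -dotBl//.
  rewrite (ae_eq_dot _ _ l1 uvb); [|exact: Lfun2B|exact: Lfun2Z].
  by rewrite dotZl// (dot_L20_1 b0) mulr0.
split=> //.
pose U := centered D u; pose W := centered D v.
have U0 : L20 s U := centered_L20 lu.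
have W0 : L20 s W := centered_L20 lv.
have SU := SL20 _ U0; have SW := SL20 _ W0; have Sb := SL20 _ b0.
have SSU := SL20 _ SU.
have normcE x : normc x ^+ 2 = ip D (S (centered D x)) (S (centered D x)).
  by rewrite /normc /normN1 L2normE sqr_nrm ipE.
have a'E : normc u ^+ 2 = ip D U (S (S U)) by rewrite normcE; exact: Ssym U0 SU.
have cross : ip D (S W) (S U) = ip D W (S (S U)) by rewrite Ssym.
have diff : ip D U (S (S U)) - ip D W (S (S U)) = - k * ip D b (S (S U)).
  rewrite !ipE -dotBl//; [|exact: U0.1|exact: W0.1|exact: SSU.1].
  rewrite -dotZl//; last exact: SSU.1.
  apply: ae_eq_dot; [apply: Lfun2B; [exact: U0.1|exact: W0.1]|exact: Lfun2Z|exact: SSU.1|].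
  have aux (x y z : R) : x - z - (y - z) = x - y by ring.
  apply: filterS uvb => x + _ => /(_ I) h.
  by rewrite -/bt -h /U /W !centered_restr mE aux.
(* Both copies of S are moved onto b, giving (G b, U). Since b = A w, also b = A (w - m(w)), so G b
   is w - m(w) almost everywhere, and the constant m(w) is orthogonal to U. *)
have bSS : ip D b (S (S U)) = ip D (fun x => eps * Au x + f (u x)) U.
  rewrite -Ssym// -Ssym// !ipE.
  pose w := fun x => eps * Au x + f (u x).
  have w0 : L20 s (centered D w) := centered_L20 lw.
  have Gb : ae_eq mu D (G b) (centered D w).
    by apply: hG.2 => //; exact: graphA_addc.
  have SSb := SS _ b0.
  rewrite (ae_eq_dot (v' := centered D w \_ D)).
  - rewrite centered_restr dotBl//; [|exact: Lfun2Z|exact: U0.1].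
    rewrite dotZl//; last exact: U0.1.
    by rewrite [dot (\1_D) _]dotC (dot_L20_1 U0) mulr0 subr0.
  - exact: (SL20 _ Sb).1.
  - exact: w0.1.
  - exact: U0.1.
  apply: filterS2 SSb Gb => x h1 h2 _; rewrite !patchE; case: ifPn => // xD.
  by rewrite h1 ?h2//; exact: set_mem.
have fuE x : ((f \o u) \_ D) x = ((fun x => eps * Au x + f (u x)) \_ D) x - eps * (Au \_ D) x.
  have aux (y z : R) : z = y + z - y by ring.
  by rewrite !patchE; case: ifP => _ /=; [exact: aux|rewrite mulr0 subr0].
have lfu : (f \o u) \_ D \in L2T.
  rewrite (_ : _ \_ _ = fun x => ((fun x => eps * Au x + f (u x)) \_ D) x - eps * (Au \_ D) x).
    by apply: Lfun2B => //; exact: Lfun2Z.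
  by apply/funext => x; exact: fuE.
have split : ip D (fun x => eps * Au x + f (u x)) U = eps * ip D Au U + ip D (f \o u) U.
  rewrite !ipE -dotZl//; last exact: U0.1.
  rewrite -dotDl//; [|exact: Lfun2Z|exact: U0.1].
  by apply: eq_Rintegral => x _; rewrite fuE; ring.
have NE : ip D Au U = norm1 s g ^+ 2.
  rewrite (gr U g); last exact: in_H1_addc.
  rewrite /norm1 sqr_sqrtr; last by apply: sumr_ge0 => i _; rewrite sqr_ge0.
  by apply: eq_bigr => i _; rewrite ipE L2normE sqr_nrm.
have Nge : normc u ^+ 2 <= gam ^+ 2 * norm1 s g ^+ 2.
  rewrite -exprMn ler_pXn2r ?nnegrE ?mulr_ge0 ?sqrtr_ge0// ?(ltW gam0)//.
  exact: hgam.
have Fge : - (K * vol D) <= ip D (f \o u) U.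
  rewrite volE -mulNr ipE -dotZl//.
  apply: le_Rintegral => //.
  - by apply: Lfun2_intM => //; exact: Lfun2Z.
  - by apply: Lfun2_intM => //; exact: U0.1.
  move=> x _; rewrite /U !patchE indicE; case: ifPn => xD; last by rewrite !mulr0.
  by rewrite !mulr1 /centered mE; exact: fK.
have half : 2 * ip D (S W) (S U) <= normc v ^+ 2 + normc u ^+ 2.
  rewrite (congr2 +%R (normcE v) (normcE u)) (ipE D (S W) (S U)).
  rewrite (ipE D (S W) (S W)) (ipE D (S U) (S U)).
  exact: dot_le_half_sqr SW.1 SU.1.
have main : normc u ^+ 2 - ip D (S W) (S U) = - k * (eps * norm1 s g ^+ 2 + ip D (f \o u) U).
  by rewrite a'E cross diff bSS split NE.
exact: energy_arith gam0 eps0 k0 half main Nge Fge.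
Qed.

End energy.

End settings.

(** * Decay *)

(** Each step is dominated by the affine map a |-> E a + M (1 - E) with fixed point M = 2 C q / eps.
    The composition of such maps has the same form with the factors E multiplied, and the exponents
    add up to t n. *)
Lemma exp_decay_recursion (R : realType) (gam eps C K : R) (t a : nat -> R) :
  0 < gam -> 0 < eps -> 0 <= C -> t 0%N = 0 -> (forall n, t n < t n.+1) ->
  (forall n, t n.+1 - t n <= K) -> (forall n, 0 <= a n) ->
  (forall n, a n.+1 * (1 + 2 * (t n.+1 - t n) * eps / gam ^+ 2) <=
             a n + 2 * (t n.+1 - t n) * C) ->
  forall n, a n <= expR (- (eps * t n / (gam ^+ 2 + eps * K))) * a 0%N
    + 2 * C * ((gam ^+ 2 + eps * K) / eps)
      * (1 - expR (- (eps * t n / (gam ^+ 2 + eps * K)))).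
Proof.
move=> gam0 eps0 C0 t0 tS tK a0 rec.
have g2 : 0 < gam ^+ 2 by rewrite exprn_gt0.
have K0 : 0 < K by rewrite (lt_le_trans _ (tK 0%N))// subr_gt0.
pose q := gam ^+ 2 + eps * K; have q0 : 0 < q by rewrite addr_gt0// mulr_gt0.
rewrite -/q; pose M := 2 * C * (q / eps); have M0 : 0 <= M by rewrite !mulr_ge0// ?divr_ge0 ?invr_ge0 ?ltW.
elim=> [|n ih]; first by rewrite t0 mulr0 mul0r oppr0 expR0 mul1r subrr mulr0 addr0.
pose k := t n.+1 - t n; have k0 : 0 < k by rewrite subr_gt0.
pose x := eps * k / q; have x0 : 0 < x by rewrite divr_gt0// mulr_gt0.
pose kap := 2 * k * eps / gam ^+ 2; have kap0 : 0 < kap by rewrite divr_gt0// !mulr_gt0.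
have -> : expR (- (eps * t n.+1 / q)) = expR (- (eps * t n / q)) * expR (- x).
  by rewrite -expRD; congr expR; rewrite /x /k; ring.
set e := expR (- (eps * t n / q)) in ih *; set E := expR (- x).
have E0 : 0 < E by exact: expR_gt0.
(* After clearing denominators this is gam^2 + 2 eps k <= 2 q, a consequence of k <= K. *)
have xk : x * (1 + kap) <= kap.
  have -> : x * (1 + kap) = eps * k * (gam ^+ 2 + 2 * k * eps) / (q * gam ^+ 2).
    by rewrite /x /kap; field; rewrite !gt_eqF.
  rewrite ler_pdivrMr ?mulr_gt0//.
  have -> : kap * (q * gam ^+ 2) = eps * k * (2 * q) by rewrite /kap; field; rewrite gt_eqF.
  rewrite ler_wpM2l ?mulr_ge0 ?ltW// /q.
  have : eps * k <= eps * K by rewrite ler_wpM2l ?tK// ltW.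
  lra.
(* From E >= 1 - x and (1 - x) (1 + kap) = 1 + kap - x (1 + kap) >= 1. *)
have h1 : 1 <= E * (1 + kap).
  have : 1 - x <= E by have := expR_ge1Dx (- x).
  move=> h; have : (1 - x) * (1 + kap) <= E * (1 + kap) by rewrite ler_wpM2r// addr_ge0// ltW.
  lra.
(* Since x <= kap and E (1 + x) <= 1, the right-hand side is at least (1 - E) (1 + x) >= x. *)
have h2 : x <= (1 - E) * (1 + kap).
  have Ex : E * (1 + x) <= 1.
    rewrite -[leRHS](expRxMexpNx_1 x) mulrC -/E; apply: ler_wpM2r; first exact: ltW.
    exact: expR_ge1Dx.
  have xkap : x <= kap by apply: le_trans xk; rewrite ler_peMr ?(ltW x0)// lerDl ltW.
  have : E <= 1 by rewrite -expR0 ler_expR oppr_le0 ltW.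
  nra.
have Mx : M * x = 2 * k * C by rewrite /M /x -/q; field; rewrite !gt_eqF.
have step : a n.+1 <= E * a n + M * (1 - E).
  have kp : 0 < 1 + kap by rewrite addr_gt0.
  rewrite -(ler_pM2r kp); apply: le_trans (rec n) _; rewrite -/k -Mx mulrDl.
  rewrite lerD//; first by rewrite mulrAC ler_peMl.
  by rewrite -(mulrA M); exact: ler_wpM2l.
apply: le_trans step _.
have : E * a n <= E * (e * a 0%N + M * (1 - e)) by rewrite ler_wpM2l// ltW.
have -> : 2 * C * (q / eps) = M by [].
lra.
Qed.

Theorem lemma4p2 (R : realType) (d : nat) (hd : (0 < d <= 3)%N)
  (s : setting R d) (hs : admissible s)
  (G Ghalf : ('rV[R]_d -> R) -> 'rV[R]_d -> R)
  (hG : inverse_of_A s G) (hGhalf : nonneg_sqrt s G Ghalf)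
  (gamma1 : R) (hgamma1 : 0 < gamma1) (hgamma : gamma1_const s Ghalf gamma1)
  (eps : R) (heps : 0 < eps)
  (p : nat) (hp : (2 <= p)%N) (hp3 : d = 3%N -> p = 2%N)
  (F : R -> R) (hF0 : F 0 = 0)
  (hF1 : forall x, derivable F x 1)
  (hF2 : forall x, derivable (F^`())%classic x 1)
  (hF2c : continuous ((F^`())^`())%classic)
  (f : R -> R) (hf : f = (F^`())%classic)
  (c0 c1 c3 : R) (c2 : R -> R) (hc0 : 0 < c0)
  (ha : forall v, p%:R * c0 * v ^+ (2 * p) - c1 <= f v * v)
  (hb : forall eta, 0 < eta ->
    forall v, `|f v| <= eta * c0 * v ^+ (2 * p) + c2 eta)
  (hc : forall v, 2^-1 * c0 * v ^+ (2 * p) - c3 <= F v /\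
                  F v <= 3 / 2 * c0 * v ^+ (2 * p) + c3)
  (r alpha : R) (hr : 0 < r) (halpha : 0 < alpha)
  (t : nat -> R) (ht : time_mesh t) (hk : has_ubound (range (step t))) :
  let Om := dom s in
  let k := sup (range (step t)) in
  let eta := alpha^-1 * (p%:R - 3 / 2) in
  let C1 := (c1 + c2 eta * alpha + 2 * c3) * vol Om in
  let rho0k := Num.sqrt (2 * C1 * ((gamma1 ^+ 2 + eps * k) / eps)) in
  let normc v := normN1 s Ghalf (centered Om v) in
  (forall u0 u, scheme s eps f (step t) u0 u ->
     normc u0 <= r -> `|mean Om u0| <= alpha ->
     forall n,
       normc (u n.+1) ^+ 2 <=
       expR (- (eps * t n.+1 / (gamma1 ^+ 2 + eps * k))) * normc u0 ^+ 2
       + 2 * C1 * ((gamma1 ^+ 2 + eps * k) / eps)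
         * (1 - expR (- (eps * t n.+1 / (gamma1 ^+ 2 + eps * k))))) /\
  (forall rho, rho0k < rho ->
     exists n0k : nat, (0 < n0k)%N /\
       forall u0 u, scheme s eps f (step t) u0 u ->
         normc u0 <= r -> `|mean Om u0| <= alpha ->
         forall n, (n0k <= n)%N -> normc (u n) <= rho).
Proof.
move=> Om k eta C1 rho0k normc.
have [t0 tS toy] := ht.
have p2 : 2 <= p%:R :> R by rewrite ler_nat.
have eta0 : 0 < eta by rewrite mulr_gt0 ?invr_gt0//; lra.
have pp0 : (2 * p)%N != 0%N by rewrite muln_eq0 /= -lt0n (leq_trans _ hp).
have c30 : 0 <= c3.
  by have [h1 h2] := hc 0; move: h1 h2; rewrite !expr0n (negbTE pp0) !mulr0; lra.
have c10 : 0 <= c1 by have := ha 0; rewrite expr0n (negbTE pp0) !mulr0; lra.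
have c20 : 0 <= c2 eta.
  by have := hb eta eta0 0; rewrite expr0n (negbTE pp0) !mulr0 add0r => /(le_trans _); apply.
pose K := c1 + c2 eta * alpha + 2 * c3.
have K0 : 0 <= K by rewrite !addr_ge0// mulr_ge0// ltW.
have C10 : 0 <= C1 by rewrite mulr_ge0// fine_ge0.
(* Since alpha * eta = p - 3/2, the term f(y) m uses up all but 3/2 of the coefficient p supplied by
   (a), and the remaining multiple of c_0 y^{2p} is nonnegative. *)
have fK m y : `|m| <= alpha -> - K <= f y * (y - m).
  move=> ma; have v0 : 0 <= y ^+ (2 * p) by rewrite exprM exprn_ge0 ?sqr_ge0.
  have h1 := ha y; have h2 := hb eta eta0 y.
  have h3 : f y * m <= alpha * (eta * c0 * y ^+ (2 * p) + c2 eta).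
    rewrite (le_trans (ler_norm _))// normrM mulrC.
    by apply: ler_pM.
  have h4 : alpha * (eta * c0 * y ^+ (2 * p) + c2 eta) =
      (p%:R - 3 / 2) * (c0 * y ^+ (2 * p)) + c2 eta * alpha.
    by rewrite /eta; field; rewrite gt_eqF.
  have h5 : 0 <= c0 * y ^+ (2 * p) by rewrite mulr_ge0// ltW.
  have h6 : f y * (y - m) = f y * y - f y * m by ring.
  rewrite h6 /K; lra.
have tk n : t n.+1 - t n <= k.
  by apply: ub_le_sup => //; exists n.
have bound u0 u : scheme s eps f (step t) u0 u -> `|mean Om u0| <= alpha ->
    forall n, normc (u n) ^+ 2 <=
       expR (- (eps * t n / (gamma1 ^+ 2 + eps * k))) * normc u0 ^+ 2
       + 2 * C1 * ((gamma1 ^+ 2 + eps * k) / eps)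
         * (1 - expR (- (eps * t n / (gamma1 ^+ 2 + eps * k)))).
  move=> [lu0 u0E sch] ma.
  have lu n : L2 Om (u n).
    case: n => [|n]; first by rewrite u0E.
    have [Au [b [hu _ _]]] := sch n.
    have [_ [g hg _]] := green hs hu.
    by have [] := in_H1_L2 hg.
  have st n : `|mean Om (u n)| <= alpha -> mean Om (u n.+1) = mean Om (u n) /\
     normc (u n.+1) ^+ 2 * (1 + 2 * (t n.+1 - t n) * eps / gamma1 ^+ 2) <=
     normc (u n) ^+ 2 + 2 * (t n.+1 - t n) * C1.
    move=> man; have [Au [b [hu hw sc]]] := sch n.
    apply: (energy_step hs hG hGhalf hgamma1 hgamma heps _ _ (lu n) hu hw sc).
      by rewrite subr_gt0.
    by move=> y; exact: fK.
  (* The bound on the mean is what allows step n, and step n conserves the mean, so both are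
     propagated together. *)
  have mn n : `|mean Om (u n)| <= alpha.
    by elim: n => [|n ih]; [rewrite u0E|rewrite (st n ih).1].
  rewrite -u0E; apply: (exp_decay_recursion hgamma1 heps C10 t0 tS tk).
    by move=> n; exact: sqr_ge0.
  by move=> n; exact: (st n (mn n)).2.
split=> [u0 u sch _ ma n|rho rhoM]; first exact: bound.
set M := 2 * C1 * _ in rho0k rhoM bound *.
have q0 : 0 < gamma1 ^+ 2 + eps * k.
  rewrite addr_gt0 ?exprn_gt0// mulr_gt0// (lt_le_trans _ (tk 0%N))// subr_gt0//.
have M0 : 0 <= M by apply: mulr_ge0; [exact: mulr_ge0|apply: divr_ge0; exact: ltW].
have rho0 : 0 < rho by rewrite (le_lt_trans _ rhoM)// sqrtr_ge0.
have Mrho : M < rho ^+ 2.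
  by rewrite -(sqr_sqrtr M0) ltr_pXn2r// nnegrE ?sqrtr_ge0 ?ltW.
(* With y = eps t_n / q and e^{-y} (1 + y) <= 1, the term e^{-y} r^2 is at most rho^2 - M once y >=
   r^2 / (rho^2 - M). A is the time at which this holds; only r stands for the initial value. *)
pose A := (gamma1 ^+ 2 + eps * k) / eps * (r ^+ 2 / (rho ^+ 2 - M)).
have /cvgryPge/(_ A)[N _ HN] := toy.
exists N.+1; split=> // u0 u sch ur ma n Nn.
have tn : A <= t n by apply: HN => /=; exact: ltnW.
rewrite -(@ler_pXn2r _ 2)// ?nnegrE ?sqrtr_ge0 ?(ltW rho0)//.
apply: le_trans (bound _ _ sch ma n) _.
set y := eps * t n / _; set e := expR (- y).
have y1 : r ^+ 2 / (rho ^+ 2 - M) <= y.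
  rewrite /y ler_pdivlMr// -[leLHS]mulrC -ler_pdivrMl//.
  by rewrite mulrCA mulrA; exact: tn.
have y0 : 0 <= y by apply: le_trans y1; rewrite divr_ge0 ?sqr_ge0// subr_ge0 ltW.
have e0 : 0 < e by exact: expR_gt0.
have ey : e * (1 + y) <= 1.
  rewrite -[leRHS](expRxMexpNx_1 y) mulrC -/e; apply: ler_wpM2r; first exact: ltW.
  exact: expR_ge1Dx.
have er : e * r ^+ 2 <= rho ^+ 2 - M.
  have dM : 0 < rho ^+ 2 - M by rewrite subr_gt0.
  move: y1; rewrite ler_pdivrMr// => y1.
  have : e * r ^+ 2 <= e * (y * (rho ^+ 2 - M)) by rewrite ler_wpM2l// ltW.
  have : e * y * (rho ^+ 2 - M) <= 1 * (rho ^+ 2 - M).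
    by apply: ler_wpM2r; [exact: ltW|lra].
  lra.
have un2 : normc u0 ^+ 2 <= r ^+ 2 by rewrite ler_pXn2r ?nnegrE ?sqrtr_ge0// ltW.
have : e * normc u0 ^+ 2 <= e * r ^+ 2 by rewrite ler_wpM2l// ltW.
have : M * (1 - e) <= M by rewrite ler_piMr// gerBl ltW.
lra.
Qed.
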